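(* $n_4^{*}\leq 338196$.
   Context: $B^{d}=\{\mathbf{x}\in\mathbb{R}^{d} : |\mathbf{x}|\leq 1\}$ is the closed Euclidean unit ball, and $\kappa_d=\mathrm{vol}(B^d)$ is its $d$-dimensional Lebesgue measure. A set $C\subset\mathbb{R}^d$ is a packing (set) if $(\mathbf{x}+\mathrm{int}\,B^d)\cap(\mathbf{y}+\mathrm{int}\,B^d)=\emptyset$ for all distinct $\mathbf{x},\mathbf{y}\in C$. Let $\mathscr{P}_n^d$ be the set of all packing sets in $\mathbb{R}^d$ with exactly $n$ points. The finite packing density of $C\in\mathscr{P}_n^d$ is $\delta(C)=\dfrac{n\,\kappa_d}{\mathrm{vol}(\mathrm{conv}\,C+B^d)}$, where $+$ is Minkowski addition. For $d\geq 2$ and $n\geq 1$ let $\mathscr{C}_n^d\subseteq\mathscr{P}_n^d$ be the set of all packings with greatest density in $\mathscr{P}_n^d$, and let $k(d,n)=\max\{\dim C : C\in\mathscr{C}_n^d\}$, where $\dim C$ is the dimension of the affine hull of $C$. Define $n_d^{*}=\min\{n\in\mathbb{N} : k(d,n)>1\}$, with $\mathbb{N}=\{1,2,\ldots\}$. *)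

(* Defs.v *)
From mathcomp Require Import all_boot all_order all_algebra.
From mathcomp Require Import all_classical all_reals all_analysis.

Set Implicit Arguments.
Unset Strict Implicit.
Unset Printing Implicit Defensive.

Import Order.TTheory GRing.Theory Num.Theory.
Import numFieldNormedType.Exports.

Local Open Scope classical_set_scope.
Local Open Scope ring_scope.

Definition is_max (A : set nat) (k : nat) : Prop := A k /\ ubound A k.

Definition is_min (A : set nat) (k : nat) : Prop := A k /\ lbound A k.

Definition tcons (T : Type) (d : nat) (p : T * d.-tuple T) : d.+1.-tuple T :=
  [tuple of p.1 :: p.2].

(* The d-fold product of Lebesgue measure on R, on the measurable type
   d.-tuple R; the empty product is the unit mass on the one-point space. *)
Fixpoint tuple_lebesgue (R : realType) (d : nat) :
    set (d.-tuple (measurableTypeR R)) -> \bar R :=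
  match d with
  | 0 => dirac [tuple]
  | d'.+1 =>
      pushforward (lebesgue_measure \x tuple_lebesgue (R := R) (d := d'))%E
        (@tcons _ d')
  end.

Section Packings.
Variables (R : realType) (d : nat).
Local Notation E := 'rV[R]_d.

Definition vol (A : set E) : \bar R :=
  tuple_lebesgue [set t : d.-tuple R | A (\row_i tnth t i)].

(* The library norm on 'rV[R]_d is the sup norm, hence this definition. *)
Definition enorm (x : E) : R := Num.sqrt (\sum_(i < d) x 0 i ^+ 2).

Definition unit_ball : set E := [set x | enorm x <= 1].

Definition minkowski_sum (A B : set E) : set E :=
  [set x + y | x in A & y in B].

Definition convex_hull (C : set E) : set E := smallest (@convex_set R E) C.

Definition affine_set (A : set E) : Prop :=
  forall x y (t : R), A x -> A y -> A ((1 - t) *: x + t *: y).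

Definition affine_hull (C : set E) : set E := smallest affine_set C.

(* The affine hull is a translate of a k-dimensional linear subspace; no k
   satisfies this when C is empty. *)
Definition has_dim (C : set E) (k : nat) : Prop :=
  exists (x : E) (V : {vspace E}),
    affine_hull C = [set x + v | v in [set` V]] /\ \dim V = k.

Definition packing (C : set E) : Prop :=
  forall x y, C x -> C y -> x <> y ->
    [set x + z | z in unit_ball°] `&` [set y + z | z in unit_ball°] = set0.

Definition packings (n : nat) : set (set E) :=
  [set C | packing C /\ (C #= `I_n)%card].

Definition density (n : nat) (C : set E) : R :=
  n%:R * fine (vol unit_ball) /
    fine (vol (minkowski_sum (convex_hull C) unit_ball)).

Definition best_packings (n : nat) : set (set E) :=
  [set C | packings n C /\
           forall C', packings n C' -> density n C' <= density n C].

(* k(d,n) = k *)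
Definition is_k (n k : nat) : Prop :=
  is_max [set j | exists2 C, best_packings n C & has_dim C j] k.

End Packings.

(* n*_d = m *)
Definition is_nstar (R : realType) (d m : nat) : Prop :=
  is_min [set n | (0 < n)%N /\ exists2 k, @is_k R d n k & (1 < k)%N] m.

(* Main.v *)
Require Import Defs.
From HB Require Import structures.
From mathcomp Require Import all_boot all_order all_algebra.
From mathcomp Require Import all_classical all_reals all_analysis.
From mathcomp Require Import measurable_realfun ring lra zify.
From Stdlib Require BinNat Nnat.

(**
Let n = 32 * 53 * 199 = 337504.  A packing of n balls whose centres lie on a
line contains two centres at distance at least 2 (n - 1), hence its outer
parallel body contains a cylinder of that length over the three-dimensional
unit ball, and its volume is at least 2 (n - 1) kappa_3
([collinear_spread], [outer_length]).  Among all packings of n points one has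
least volume, by compactness ([best_packing_exists]).  So as soon as some
packing of n points has an outer body of volume smaller than
2 (n - 1) kappa_3, no best packing is collinear, k(4, n) > 1 and the minimum
n*_4 is at most n.

The packing is a piece of the checkerboard lattice: sqrt 2 times the integer
points z with odd coordinate sum, |z_i| <= 16 for the first three coordinates,
|z_4| <= 19 and |z_1| + ... + |z_4| <= 33.  Two such z differ by a nonzero
vector of even coordinate sum, so they are at distance at least sqrt 2.  There
are exactly n of them ([card_cluster]).

For an upper bound of the volume, divide by sqrt 2 and take absolute values of
the coordinates; the outer body folds onto a subset of the orthant whose
volume must be multiplied by 4 * 16 = 64.  A folded point y satisfies
w . y <= max of w over the cluster + |w| / sqrt 2 for every weight w; the weights
e_i, (1,1,1,1), (1,1,1,1) - e_i, (1,1,1,1) + e_i and (1,1,1,1) + 4 e_i define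
the polytope [in_polytope] ([outer_in_polytope]).  It lies in the simplex of
size 33 + sqrt 2, and each of the remaining inequalities cuts off a part of
this simplex: a corner beyond y_i = 16 or 19, a slab along the facet y_i = 0
where the other three coordinates have a large sum, and two wedges along the
ridge where y_i and the total are both close to their bounds.  In each of these
parts one finds an explicit cell that is the affine image of a simplex or of
a product of two triangles, so its volume is a rational number.  The sixteen cells
are pairwise disjoint ([profile_inj]) and miss the polytope ([cell_props]); the
volume of the simplex minus the volumes of the cells is small enough
([numerical_bound]) when kappa_3 is bounded below with pi > 3.1415
([vol_sqball3]).

The volume is an iterated product of Lebesgue measures, which is handled one
coordinate at a time with Fubini's theorem ([vol_fubini1]); a linear change of
variables multiplies it by the determinant ([unitmx_linear_law]).
*)

Set Implicit Arguments.
Unset Strict Implicit.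
Unset Printing Implicit Defensive.
Import Order.TTheory GRing.Theory Num.Theory.
Import numFieldNormedType.Exports.
Local Open Scope classical_set_scope.
Local Open Scope ring_scope.

(** * The product measure on tuples *)

Section TupleMeasure.
Variable R : realType.
Local Notation mR := (measurableTypeR R).

Lemma measurable_tcons d : measurable_fun setT (@tcons mR d).
Proof. exact: (@measurable_cons _ _ _ _ fst d snd). Qed.

Lemma tcons_preimage d (X : set (d.+1.-tuple mR)) : measurable X ->
  measurable (@tcons mR d @^-1` X).
Proof. by move=> mX; rewrite -[X in measurable X]setTI; exact: measurable_tcons. Qed.

Section step.
Variables (d : nat) (m : {sigma_finite_measure set (d.-tuple mR) -> \bar R}).
(** The measure on (d+1)-tuples obtained from a measure on d-tuples in the recursion
    of the product measure; it is built from a structured measure so that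
    sigma-finiteness, which Fubini needs, passes through the recursion. *)
Definition lebesgue_cons := pushforward (lebesgue_measure \x m)%E (@tcons mR d).
Local Notation nu := lebesgue_cons.

Let nu0 : nu set0 = 0%E.
Proof. by rewrite /nu /pushforward preimage_set0 measure0. Qed.
Let nu_ge0 A : (0 <= nu A)%E.
Proof. by rewrite /nu /pushforward; exact: measure_ge0. Qed.
Let nu_add : semi_sigma_additive nu.
Proof.
move=> F mF tF mUF; rewrite /nu /pushforward preimage_bigcup.
apply: measure_semi_sigma_additive.
- by move=> n; exact: tcons_preimage.
- apply/trivIsetP => /= i j _ _ ij; rewrite -preimage_setI.
  by move/trivIsetP : tF => /(_ _ _ _ _ ij) ->//; rewrite preimage_set0.
- by rewrite -preimage_bigcup; exact: tcons_preimage.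
Qed.
HB.instance Definition _ := isMeasure.Build _ _ _ nu nu0 nu_ge0 nu_add.

Let nu_sf : sigma_finite setT nu.
Proof.
pose lm : {sigma_finite_measure set mR -> \bar R} := lebesgue_measure.
have /sigma_finiteP[F [TF ndF Foo]] := sigma_finiteT lm.
have /sigma_finiteP[G [TG ndG Goo]] := sigma_finiteT m.
pose hd := @thead d mR; pose tl (t : d.+1.-tuple mR) : d.-tuple mR := [tuple of behead t].
have tlE (a : mR) (t : d.-tuple mR) : tl (tcons (a, t)) = t by exact: val_inj.
have mhd X : measurable X -> measurable (hd @^-1` X).
  by move=> mX; rewrite -[_ @^-1` _]setTI; exact: measurable_tnth.
have mtl X : measurable X -> measurable (tl @^-1` X).
  by move=> mX; rewrite -[_ @^-1` _]setTI; exact: measurable_behead.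
exists (fun n => hd @^-1` F n `&` tl @^-1` G n).
  apply/esym; rewrite -subTset => t _.
  have [n _ Fn] : (\bigcup_i F i) (hd t) by rewrite -TF.
  have [k _ Gk] : (\bigcup_i G i) (tl t) by rewrite -TG.
  exists (maxn n k) => //; split => /=.
    by move: Fn; apply/subsetPset/ndF/leq_maxl.
  by move: Gk; apply/subsetPset/ndG/leq_maxr.
move=> k; have [mF Fy] := Foo k; have [mG Gy] := Goo k.
split; first by apply: measurableI; [exact: mhd|exact: mtl].
rewrite /nu /pushforward (_ : _ @^-1` _ = F k `*` G k).
  by rewrite product_measure1E// lte_mul_pinfty// ge0_fin_numE.
by apply/seteqP; split => -[a t] /=; rewrite /hd theadE tlE.
Qed.
HB.instance Definition _ := Measure_isSigmaFinite.Build _ _ _ nu nu_sf.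
End step.

Fixpoint tuple_measure d : {sigma_finite_measure set (d.-tuple mR) -> \bar R} :=
  match d with
  | 0 => @dirac _ _ ([tuple] : 0.-tuple mR) R
  | d'.+1 => lebesgue_cons (tuple_measure d')
  end.

Lemma tuple_lebesgueE d : @tuple_lebesgue R d = tuple_measure d :> (set _ -> \bar R).
Proof. by elim: d => //= d ->. Qed.

End TupleMeasure.

(** * Translation and dilation on the line *)

Section LebLine.
Variable R : realType.
Local Notation mR := (measurableTypeR R).
Local Notation leb := (@lebesgue_measure R).

(** Lebesgue measure is determined by its values on intervals, and the shifted
    measure has the same ones. *)
Lemma lebesgue_preimageD (b : R) (X : set mR) : measurable X ->
  leb [set x | X (x + b)] = leb X.
Proof.
move=> mX; pose f (x : mR) : mR := x + b.
have mf : measurable_fun setT f by exact: measurable_funD.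
pose mu : {measure set mR -> \bar R} := measure_function_pushforward__canonical__measure_function_Measure leb mf.
rewrite [RHS](@lebesgue_measure_unique R mu) // => _ [[x y] /= _ <-].
rewrite /mu /= /pushforward (_ : f @^-1` _ = `]x - b, y - b]%classic); last first.
  by apply/seteqP; split => z; rewrite /f /= !in_itv /= ltrBlDr lerBrDr.
by rewrite !lebesgue_measure_itv/= !lte_fin ltrD2r; case: ifP => // _; rewrite -!EFinB; congr (_%:E); lra.
Qed.

(** Both sides agree on intervals when the factor is positive; a negative factor
    reduces to a positive one by reflection. *)
Lemma lebesgue_preimageM (a : R) (X : set mR) : a != 0 -> measurable X ->
  leb [set x | X (a * x)] = ((`|a|^-1)%:E * leb X)%E.
Proof.
have pos (c : R) (Y : set mR) : 0 < c -> measurable Y ->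
    leb [set x | Y (c * x)] = ((c^-1)%:E * leb Y)%E.
  move=> c0 mY; pose f (x : mR) : mR := c * x.
  have mf : measurable_fun setT f by exact: measurable_funM.
  pose nu : {measure set mR -> \bar R} := measure_function_pushforward__canonical__measure_function_Measure leb mf.
  pose mu : {measure set mR -> \bar R} := mscale (NngNum (ltW c0)) nu.
  suff -> : leb Y = mu Y.
    rewrite /mu /= /mscale /= muleA -EFinM mulVf ?gt_eqF// mul1e.
    by [].
  apply: (@lebesgue_measure_unique R mu) => // _ [[x y] /= _ <-].
  rewrite /mscale /= /pushforward (_ : f @^-1` _ = `]c^-1 * x, c^-1 * y]%classic); last first.
    by apply/seteqP; split => z; rewrite /f /= !in_itv /= ![_^-1 * _]mulrC ltr_pdivrMr// ler_pdivlMr// ![_ * c]mulrC.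
  rewrite !lebesgue_measure_itv/= !lte_fin ltr_pM2l ?invr_gt0//.
  case: ifP => _; last by rewrite mule0.
  rewrite -!EFinB -EFinM; congr (_%:E).
  by rewrite -mulrBr mulrA mulfV ?gt_eqF// mul1r.
move=> a0 mX; have [a1|a1] := ltP 0 a; first by rewrite gtr0_norm// pos.
have an : 0 < - a by rewrite oppr_gt0 lt_neqAle a0.
have mXN : measurable [set x | X (- x)].
  have mN : measurable_fun setT (fun x : mR => - x : mR) by exact: measurable_funN.
  by rewrite -[[set x | _]]setTI; exact: mN.
rewrite (_ : [set x | _] = [set x | [set x | X (- x)] (- a * x)]); last first.
  by apply/seteqP; split => x /=; rewrite mulNr opprK.
by rewrite pos// ler0_norm// -(@lebesgue_measureN R X mX).
Qed.

End LebLine.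

(** * Borel sets of row vectors, volume and Fubini *)

Section BorelRows.
Variable R : realType.
Local Notation mR := (measurableTypeR R).

(** Row vectors with the Borel sigma-algebra of the normed space.  The volume is
    computed on tuples, whose sigma-algebra is the product one; [measurable_t2r]
    links the two. *)
Definition brow d : Type := g_sigma_algebraType (@open 'rV[R]_d).
HB.instance Definition _ d := Measurable.on (brow d).

Definition borel d (A : set 'rV[R]_d) : Prop := @measurable _ (brow d) A.

Lemma borel_open d (A : set 'rV[R]_d) : open A -> borel A.
Proof. exact: sub_sigma_algebra. Qed.

Lemma borelC d (A : set 'rV[R]_d) : borel A -> borel (~` A).
Proof. exact: (@measurableC _ (brow d)). Qed.

Lemma borel_closed d (A : set 'rV[R]_d) : closed A -> borel A.
Proof. by move=> cA; rewrite -[A]setCK; apply: borelC; apply: borel_open; exact: closed_openC. Qed.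

Lemma borelI d (A B : set 'rV[R]_d) : borel A -> borel B -> borel (A `&` B).
Proof. exact: (@measurableI _ (brow d)). Qed.

Lemma borelU d (A B : set 'rV[R]_d) : borel A -> borel B -> borel (A `|` B).
Proof. exact: (@measurableU _ (brow d)). Qed.

Lemma borelD d (A B : set 'rV[R]_d) : borel A -> borel B -> borel (A `\` B).
Proof. exact: (@measurableD _ (brow d)). Qed.

Lemma borel_preimage m n (f : 'rV[R]_m -> 'rV[R]_n) (A : set 'rV[R]_n) :
  continuous f -> borel A -> borel (f @^-1` A).
Proof.
move=> cf bA.
have mf : @measurable_fun _ _ (brow m) (brow n) setT f.
  apply: (@measurability _ _ (brow m) (brow n) setT f (@open 'rV[R]_n)) => // _ [B oB <-]; rewrite setTI.
  by apply: borel_open; apply: open_comp => // x _; exact: cf.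
by rewrite -[_ @^-1` _]setTI; exact: mf.
Qed.

Definition t2r d (t : d.-tuple mR) : brow d := \row_i tnth t i.

Definition box d (p : 'rV[rat]_d * nat) : set 'rV[R]_d :=
  [set x | forall i, `|x 0 i - ratr (p.1 0 i)| < p.2.+1%:R^-1].

(** Open sets are countable unions of rational boxes, which makes them
    measurable for the product sigma-algebra. *)
Lemma open_rat_boxes d (U : set 'rV[R]_d) : open U ->
  U = \bigcup_p (if `[<box p `<=` U>] then box p else set0).
Proof.
move=> oU; apply/seteqP; split; last by move=> x [p _]; case: asboolP => // pU /pU.
move=> x Ux; have := open_nbhs_nbhs (conj oU Ux).
move=> /nbhs_ballP[e /= e0] eU.
have [k ke] : exists k : nat, k.+1%:R^-1 < e / 2.
  have e2 : 0 < (e / 2)^-1 by rewrite invr_gt0 divr_gt0.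
  exists (Num.truncn (e / 2)^-1).
  have h := truncnS_gt (e / 2)^-1.
  by rewrite -[ltRHS]invrK ltf_pV2 ?posrE.
have H i : exists q : rat, `|x 0 i - ratr q| < k.+1%:R^-1.
  have k0 : 0 < k.+1%:R^-1 :> R by rewrite invr_gt0.
  have [|q] := @rat_in_itvoo R (x 0 i - k.+1%:R^-1) (x 0 i + k.+1%:R^-1).
    by move: k0; move: (k.+1%:R^-1) (x 0 i) => *; lra.
  by rewrite in_itv /= => /andP[q1 q2]; exists q; rewrite ltr_norml; apply/andP; split; move: q1 q2; move: (k.+1%:R^-1) (x 0 i) (ratr q) => *; lra.
have [q qx] := choice H.
exists (\row_i q i, k) => //.
rewrite asboolT; first by move=> i; rewrite mxE; exact: qx.
move=> y /= hy; apply: eU; split => // i j; rewrite ord1 /ball /=.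
have := hy j; have := qx j; rewrite !mxE /= => h1 h2.
rewrite (_ : x 0 j - y 0 j = (x 0 j - ratr (q j)) - (y 0 j - ratr (q j))); last by ring.
by rewrite (le_lt_trans (ler_normB _ _))// (splitr e) ltrD// (lt_trans _ ke).
Qed.

Lemma measurable_t2r d : measurable_fun setT (@t2r d).
Proof.
apply: (@measurability _ _ _ (brow d) setT _ (@open 'rV[R]_d)) => // _ [U oU <-].
rewrite setTI (open_rat_boxes oU) preimage_bigcup.
apply: countable_bigcupT_measurable => [|p]; first exact: countableP.
case: asboolP => _; last by rewrite preimage_set0.
rewrite (_ : _ @^-1` _ = \bigcap_(i in [set: 'I_d])
  ((fun t : d.-tuple mR => tnth t i) @^-1`
   [set x | `|x - ratr (p.1 0 i)| < p.2.+1%:R^-1])); last first.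
  apply/seteqP; split => t /= h i; first by move=> _; have := h i; rewrite /= mxE.
  by rewrite mxE; exact: h.
apply: fin_bigcap_measurable => // i _.
rewrite -[_ @^-1` _]setTI; apply: measurable_tnth => //.
rewrite (_ : mkset _ = ball (ratr (p.1 0 i) : R) p.2.+1%:R^-1).
  exact: measurable_ball.
by apply/seteqP; split => x /=; rewrite /ball /= distrC.
Qed.

Definition row_measure d : {measure set (brow d) -> \bar R} :=
  measure_function_pushforward__canonical__measure_function_Measure
    (tuple_measure R d) (@measurable_t2r d).

Lemma volE d : @vol R d = row_measure d :> (set _ -> _).
Proof. by rewrite /vol tuple_lebesgueE. Qed.

Lemma vol_ge0 d (A : set 'rV[R]_d) : (0 <= vol A)%E.
Proof. by rewrite volE. Qed.

Lemma vol0 d : vol (set0 : set 'rV[R]_d) = 0%E.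
Proof. by rewrite volE measure0. Qed.

Lemma le_vol d (A B : set 'rV[R]_d) : borel A -> borel B -> A `<=` B ->
  (vol A <= vol B)%E.
Proof. by move=> bA bB AB; rewrite volE; apply: le_measure => //; rewrite inE. Qed.

Lemma volU d (A B : set 'rV[R]_d) : borel A -> borel B -> A `&` B = set0 ->
  vol (A `|` B) = (vol A + vol B)%E.
Proof. by move=> bA bB AB; rewrite volE; exact: (measureU (row_measure d)). Qed.

Definition rcons_row d (a : R) (v : 'rV[R]_d) : 'rV[R]_d.+1 := row_mx (a%:M : 'rV_1) v.

Lemma rcons_row0 d a (v : 'rV[R]_d) : rcons_row a v 0 ord0 = a.
Proof.
rewrite /rcons_row (_ : ord0 = lshift d (ord0 : 'I_1) :> 'I_d.+1); last exact: val_inj.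
apply: etrans (row_mxEl (a%:M : 'rV_1) v 0 ord0) _.
by rewrite mxE eqxx.
Qed.

Lemma rcons_rowS d a (v : 'rV[R]_d) j : rcons_row a v 0 (lift ord0 j) = v 0 j.
Proof.
rewrite /rcons_row (_ : lift ord0 j = rshift 1 j :> 'I_d.+1); last exact: val_inj.
exact: (row_mxEr (a%:M : 'rV_1) v 0 j).
Qed.

Lemma t2r_tcons d (a : mR) (t : d.-tuple mR) : t2r (tcons (a, t)) = rcons_row a (t2r t).
Proof.
apply/rowP => i; rewrite {1}/t2r mxE.
have [j ->|->] := unliftP ord0 i; last by rewrite rcons_row0 tnth0.
by rewrite rcons_rowS mxE tnthS.
Qed.

Lemma continuous_rowP m n (f : 'rV[R]_m -> 'rV[R]_n) :
  (forall j, continuous (fun x => f x 0 j)) -> continuous f.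
Proof.
move=> cf x U /nbhs_ballP[e e0 eU].
have H : \forall y \near x, forall j, ball (f x 0 j) e (f y 0 j).
  apply: (filter_forall (nbhs_filter x)) => j.
  exact: (cf j x _ (nbhsx_ballx _ e e0)).
by apply: (filterS _ H) => y hy; apply: eU; split => // i j; rewrite ord1.
Qed.

Lemma continuous_rcons_row d a : continuous (@rcons_row d a).
Proof.
apply: continuous_rowP => i; have [j ->|->] := unliftP ord0 i.
  under eq_fun do rewrite rcons_rowS.
  exact: coord_continuous.
under eq_fun do rewrite rcons_row0.
exact: cst_continuous.
Qed.

(** The slicing formula along the first coordinate holds by construction, for any set. *)
Lemma vol_fubini1 d (X : set 'rV[R]_d.+1) :
  vol X = (\int[lebesgue_measure]_a vol [set v : 'rV_d | X (rcons_row a v)])%E.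
Proof.
rewrite {1}/vol tuple_lebesgueE /= /lebesgue_cons /pushforward /product_measure1.
apply: eq_integral => a _ /=.
rewrite volE /row_measure /= /pushforward; congr (tuple_measure R d _).
by apply/seteqP; split => t; rewrite /xsection /= inE -t2r_tcons.
Qed.

Lemma measurable_vol_slice d (X : set 'rV[R]_d.+1) : borel X ->
  measurable_fun setT (fun a : mR => vol [set v : 'rV_d | X (rcons_row a v)]).
Proof.
move=> bX; pose P : set (mR * d.-tuple mR) := [set p | X (t2r (tcons p))].
have mP : measurable P.
  have := @measurable_tcons R d measurableT [set t | X (t2r t)]; rewrite setTI; apply.
  by rewrite -[mkset _]setTI; exact: (@measurable_t2r d.+1).
rewrite (_ : (fun _ => _) = tuple_measure R d \o xsection P).
  exact: measurable_fun_xsection.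
apply/funext => a /=; rewrite volE /row_measure /= /pushforward; congr (tuple_measure R d _).
by apply/seteqP; split => t; rewrite /xsection /= inE -t2r_tcons.
Qed.

(** Integration in the other order; a shear that changes only the first coordinate
    acts on each line as a translation. *)
Lemma vol_fubini2 d (X : set 'rV[R]_d.+1) : borel X ->
  vol X = (\int[tuple_measure R d]_t lebesgue_measure [set a : mR | X (rcons_row a (t2r t))])%E.
Proof.
move=> bX.
rewrite {1}/vol tuple_lebesgueE /= /lebesgue_cons /pushforward.
pose lm : {sigma_finite_measure set mR -> \bar R} := lebesgue_measure.
pose P : set (mR * d.-tuple mR) := [set p | X (t2r (tcons p))].
have mP : measurable P.
  have := @measurable_tcons R d measurableT [set t | X (t2r t)]; rewrite setTI; apply.
  by rewrite -[mkset _]setTI; exact: (@measurable_t2r d.+1).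
have -> : (lebesgue_measure \x tuple_measure R d)%E P = (lm \x^ tuple_measure R d)%E P.
  apply: product_measure_unique => // A B mA mB.
  exact: product_measure2E.
apply: eq_integral => t _ /=; congr (lebesgue_measure _).
by apply/seteqP; split => a; rewrite /ysection /= inE -t2r_tcons.
Qed.
End BorelRows.

(** * Volume under affine maps *)

Section LinearLaw.
Variable R : realType.
Local Notation mR := (measurableTypeR R).
Local Notation leb := (@lebesgue_measure R).

Lemma integral_preimageD (b : R) (g : mR -> \bar R) :
  measurable_fun setT g -> (forall x, 0 <= g x)%E ->
  (\int[leb]_x g (x + b)%R = \int[leb]_x g x)%E.
Proof.
move=> mg g0; pose f (x : mR) : mR := x + b.
have mf : measurable_fun setT f by exact: measurable_funD.
have := @ge0_integral_pushforward _ _ mR mR R f mf leb setT g measurableT mg.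
rewrite preimage_setT => <-; last by move=> x _.
apply: eq_measure_integral => A mA _; rewrite /pushforward.
exact: lebesgue_preimageD.
Qed.

Lemma integral_preimageM (a : R) (g : mR -> \bar R) : a != 0 ->
  measurable_fun setT g -> (forall x, 0 <= g x)%E ->
  (\int[leb]_x g (a * x)%R = (`|a|^-1)%:E * \int[leb]_x g x)%E.
Proof.
move=> a0 mg g0; pose f (x : mR) : mR := a * x.
have mf : measurable_fun setT f by exact: measurable_funM.
have := @ge0_integral_pushforward _ _ mR mR R f mf leb setT g measurableT mg.
rewrite preimage_setT => <-; last by move=> x _.
have an : 0 <= `|a|^-1 by rewrite invr_ge0.
rewrite -(@ge0_integral_mscale _ mR R leb setT measurableT (NngNum an))//.
apply: eq_measure_integral => A mA _; rewrite /pushforward /mscale /=.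
exact: lebesgue_preimageM.
Qed.

Lemma rcons_rowP d (v : 'rV[R]_d.+1) : exists a u, v = rcons_row a u.
Proof.
exists (v 0 ord0), (\row_j v 0 (lift ord0 j)); apply/rowP => i.
have [j ->|->] := unliftP ord0 i; last by rewrite rcons_row0.
by rewrite rcons_rowS mxE.
Qed.

Lemma rcons_rowD d a b (u v : 'rV[R]_d) :
  rcons_row a u + rcons_row b v = rcons_row (a + b) (u + v).
Proof.
apply/rowP => i; rewrite mxE.
have [j ->|->] := unliftP ord0 i; first by rewrite !rcons_rowS mxE.
by rewrite !rcons_row0.
Qed.

Lemma borel_slice d (X : set 'rV[R]_d.+1) a : borel X ->
  borel [set v : 'rV_d | X (rcons_row a v)].
Proof. by move=> bX; apply: (borel_preimage (@continuous_rcons_row R d a)). Qed.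

Lemma vol_preimageD d (b : 'rV[R]_d) (X : set 'rV[R]_d) : borel X ->
  vol [set v | X (v + b)] = vol X.
Proof.
elim: d b X => [|d IH] b X bX.
  by congr vol; apply/seteqP; split => v /=; rewrite (thinmx0 b) addr0.
have [b0 [b' ->]] := rcons_rowP b.
rewrite !vol_fubini1 -[RHS](@integral_preimageD b0); last 2 first.
- exact: measurable_vol_slice.
- by move=> x; exact: vol_ge0.
apply: eq_integral => a _ /=; rewrite -[RHS](IH b'); last exact: borel_slice.
by congr vol; apply/seteqP; split => v /=; rewrite rcons_rowD.
Qed.

(** Change of variables for the matrix M, with the determinant on the right. *)
Definition linear_law d (M : 'M[R]_d) := forall X : set 'rV[R]_d, borel X ->
  vol [set v | X (v *m M)] = ((`|\det M|^-1)%:E * vol X)%E.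

Lemma continuous_sumr (T : topologicalType) (I : Type) (r : seq I)
    (F : I -> T -> R) : (forall i, continuous (F i)) ->
  continuous (fun x => \sum_(i <- r) F i x).
Proof.
move=> cF; elim: r => [|i r IH] x.
  by under eq_fun do rewrite big_nil; exact: cvg_cst.
under eq_fun do rewrite big_cons.
by apply: cvgD; [exact: cF|exact: IH].
Qed.

Lemma continuousDc (V : normedModType R) (b : V) : continuous (fun v => v + b).
Proof. by move=> x; apply: cvgD; [exact: cvg_id|exact: cvg_cst]. Qed.

Lemma continuousMc (T : topologicalType) (f : T -> R) c :
  continuous f -> continuous (fun x => f x * c).
Proof. by move=> cf x; apply: cvgM; [exact: cf|exact: cvg_cst]. Qed.

Lemma continuous_mulmxr m n (M : 'M[R]_(m, n)) :
  continuous (fun v : 'rV[R]_m => v *m M).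
Proof.
apply: continuous_rowP => j.
under eq_fun do rewrite mxE.
apply: continuous_sumr => i; apply: continuousMc.
exact: coord_continuous.
Qed.

Lemma borel_mulmx m n (M : 'M[R]_(m, n)) (X : set 'rV[R]_n) : borel X ->
  borel [set v : 'rV_m | X (v *m M)].
Proof. by move=> bX; apply: (borel_preimage (@continuous_mulmxr m n M)). Qed.

Lemma linear_lawM d (M N : 'M[R]_d) : linear_law M -> linear_law N ->
  linear_law (M *m N).
Proof.
move=> hM hN X bX.
rewrite (_ : mkset _ = [set v | [set u | X (u *m N)] (v *m M)]); last first.
  by apply/seteqP; split => v /=; rewrite mulmxA.
rewrite hM ?hN//; last exact: borel_mulmx.
by rewrite det_mulmx normrM invfM EFinM muleA.
Qed.

Lemma rcons_row_mul_block d x (u : 'rV[R]_d) (a : R) r c D :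
  rcons_row x u *m (block_mx a%:M r c D : 'M[R]_(1 + d)) =
  rcons_row (x * a + (u *m c) 0 0) (x *: r + u *m D).
Proof.
apply: etrans (mul_row_block (x%:M : 'rV_1) u _ r c D) _.
rewrite !mul_scalar_mx /rcons_row; congr row_mx.
by apply/rowP => i; rewrite ord1 !mxE eqxx !mulr1n.
Qed.

(** The first coordinate is scaled, and on each slice the other coordinates undergo
    a map that satisfies the law followed by a translation. *)
Lemma linear_law_upper d (a : R) r (D : 'M[R]_d) : a != 0 -> linear_law D ->
  linear_law (block_mx a%:M r 0 D : 'M[R]_(1 + d)).
Proof.
move=> a0 hD X bX.
rewrite det_ublock det_scalar1 normrM invfM EFinM -muleA.
rewrite !vol_fubini1 -ge0_integralZl//; last 2 first.
- exact: measurable_vol_slice.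
- by move=> x _; exact: vol_ge0.
rewrite -integral_preimageM//; last 2 first.
- by apply: measurable_funeM; exact: measurable_vol_slice.
- by move=> x; rewrite mule_ge0// ?lee_fin ?invr_ge0//; exact: vol_ge0.
apply: eq_integral => x _ /=.
have bS : borel [set w | X (rcons_row (a * x) w)] by exact: borel_slice.
pose X' := [set w | [set w | X (rcons_row (a * x) w)] (w + x *: r)].
rewrite -(vol_preimageD (x *: r) bS) -/X' -hD; last first.
  apply: (@borel_preimage _ _ _ (fun w => w + x *: r)) bS.
  exact: continuousDc.
congr vol; apply/seteqP; split => u /=; rewrite rcons_row_mul_block;
  by rewrite mulmx0 mxE addr0 mulrC addrC.
Qed.

Lemma measurable_line d (u : 'rV[R]_d) (X : set 'rV[R]_d.+1) : borel X ->
  measurable [set a : mR | X (rcons_row a u)].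
Proof.
move=> bX.
have mf : @measurable_fun _ _ mR (brow R d.+1) setT (fun a => rcons_row a u).
  apply: (@measurability _ _ _ (brow R d.+1) setT _ (@open 'rV[R]_d.+1)) => //.
  move=> _ [B oB <-]; rewrite setTI; apply: measurable_realfun.open_measurable.
  apply: open_comp => // x _; move: x.
  suff : continuous (fun a : R => rcons_row a u) by [].
  move=> x U /nbhs_ballP[e e0 eU]; apply/nbhs_ballP; exists e => // y xy.
  apply: eU; split => // i k; rewrite ord1.
  have [k' ->|->] := unliftP ord0 k; last by rewrite !rcons_row0.
  by rewrite !rcons_rowS; exact: ballxx.
by rewrite -[mkset _]setTI; exact: mf.
Qed.

(** Such a shear moves the first coordinate only, by an amount depending on the others. *)
Lemma linear_law_lower d (c : 'cV[R]_d) :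
  linear_law (block_mx (1%:M : 'M[R]_1) 0 c 1%:M : 'M[R]_(1 + d)).
Proof.
move=> X bX; rewrite det_lblock !det1 mulr1 normr1 invr1 mul1e.
rewrite !vol_fubini2//; last exact: borel_mulmx.
apply: eq_integral => t _; set u := t2r t.
have mS : measurable [set a : mR | X (rcons_row a u)].
  exact: measurable_line.
rewrite -(lebesgue_preimageD ((u *m c) 0 0) mS).
congr (leb _); apply/seteqP; split => x /=; rewrite rcons_row_mul_block;
  by rewrite scaler0 add0r mulmx1 mulr1.
Qed.

(** Induction on the dimension by block elimination.  A matrix whose top left entry is not zero
    is a lower shear times a block upper triangular matrix; otherwise a shear adds
    a row that creates such a pivot. *)
Lemma unitmx_linear_law d (M : 'M[R]_d) : M \in unitmx -> linear_law M.
Proof.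
elim: d M => [|d IH] M uM.
  move=> X bX; rewrite det_mx00 normr1 invr1 mul1e; congr vol.
  by apply/seteqP; split => v /=; rewrite [v *m M]thinmx0 (thinmx0 v).
rewrite unitmxE unitfE in uM.
have step (a : R) r (c : 'cV[R]_d) (D : 'M[R]_d) : a != 0 ->
    \det (block_mx a%:M r c D : 'M[R]_(1 + d)) != 0 ->
    linear_law (block_mx a%:M r c D : 'M[R]_(1 + d)).
  move=> a0.
  have -> : (block_mx a%:M r c D : 'M[R]_(1 + d)) =
      block_mx (1%:M : 'M[R]_1) 0 (a^-1 *: c) 1%:M *m
      block_mx a%:M r 0 (D - a^-1 *: c *m r) :> 'M[R]_(1 + d).
    rewrite mulmx_block !mul1mx !mul0mx !addr0 addrC subrK.
    by rewrite mul_mx_scalar scalerA mulfV// scale1r.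
  rewrite det_mulmx det_lblock det_ublock !det1 mulr1 mul1r det_scalar1 mulf_eq0 negb_or.
  move=> /andP[_ dD]; apply: linear_lawM; first exact: linear_law_lower.
  by apply: linear_law_upper => //; apply: IH; rewrite unitmxE unitfE.
pose N := M : 'M[R]_(1 + d).
have NE : M = block_mx ((N 0 0)%:M) (ursubmx N) (dlsubmx N) (drsubmx N).
  rewrite -[LHS](@submxK _ 1 d 1 d) -/N.
  suff -> : ulsubmx N = (N 0 0)%:M by [].
  by apply/matrixP => i j; rewrite !ord1 !mxE eqxx mulr1n; congr (N _ _); exact: val_inj.
have [N0|N0] := eqVneq (N 0 0) 0; last first.
  by rewrite NE; apply: step => //; rewrite -NE.
(* a zero first column would make the determinant vanish *)
have [j cj] : exists j, dlsubmx N j 0 != 0.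
  apply/not_existsP => h; move: uM; rewrite NE N0.
  rewrite (_ : dlsubmx N = 0); last first.
    by apply/matrixP => i k; rewrite ord1 [RHS]mxE; apply/eqP/negPn/negP/h.
  have E := det_ublock (0%:M : 'M[R]_1) (ursubmx N) (drsubmx N).
  by rewrite E det_scalar1 mul0r eqxx.
pose e : 'rV[R]_d := delta_mx 0 j.
pose U : 'M[R]_(1 + d) := block_mx 1%:M e 0 1%:M.
pose V : 'M[R]_(1 + d) := block_mx 1%:M (- e) 0 1%:M.
have VU : V *m U = 1%:M.
  rewrite mulmx_block !mul1mx !mul0mx !mulmx0 !mulmx1 !addr0 !add0r subrr.
  by rewrite -scalar_mx_block.
rewrite -[M]mul1mx -VU -mulmxA; apply: linear_lawM.
  apply: linear_law_upper; first exact: oner_neq0.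
  by move=> X bX; rewrite det1 normr1 invr1 mul1e; congr vol; apply/seteqP; split => v /=; rewrite mulmx1.
have UN : U *m M = block_mx ((dlsubmx N j 0)%:M) (ursubmx N + e *m drsubmx N)
    (dlsubmx N) (drsubmx N) :> 'M[R]_(1 + d).
  rewrite NE N0; apply: etrans (mulmx_block _ _ _ _ _ _ _ _) _.
  rewrite !mul1mx !mul0mx !add0r; congr (block_mx _ _ _ _).
  rewrite -rowE; apply/matrixP => i k; rewrite !ord1 !mxE !eqxx mulr1n.
  by rewrite add0r.
rewrite UN; apply: step => //; rewrite -UN det_mulmx mulf_neq0//.
by rewrite det_ublock !det1 mulr1 oner_neq0.
Qed.
End LinearLaw.

(** * Volume by slices and the volume of a simplex *)

Section Slices.
Variable R : realType.
Local Notation mR := (measurableTypeR R).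
Local Notation leb := (@lebesgue_measure R).

Lemma FTC2_is_derive (F f : R -> R) (a b : R) : a < b ->
  (forall x, a <= x <= b -> is_derive x 1 F (f x)) ->
  (forall x, a <= x <= b -> {for x, continuous f}) ->
  (\int[leb]_(x in `[a, b]) (f x)%:E = (F b - F a)%:E)%E.
Proof.
move=> ab dF cf.
have cF x : a <= x <= b -> {for x, continuous F}.
  move=> xab; apply: differentiable_continuous; apply/derivable1_diffP.
  by have [] := dF x xab.
rewrite (continuous_FTC2 ab (F := F)) ?EFinB//.
- by apply: continuous_in_subspaceT => x; rewrite inE /= in_itv /= => xab; exact: cf.
- split.
  + move=> x; rewrite in_itv /= => /andP[ax xb].
    by have := dF x; rewrite (ltW ax) (ltW xb) => /(_ isT)[].
  + by apply: cvg_at_right_filter; apply: cF; rewrite lexx ltW.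
  + by apply: cvg_at_left_filter; apply: cF; rewrite lexx ltW.
- move=> x; rewrite in_itv /= => /andP[ax xb]; rewrite derive1E.
  by have := dF x; rewrite (ltW ax) (ltW xb) => /(_ isT)[].
Qed.

(** A lower bound for the volume by integrating a lower bound for the slices. *)
Lemma vol_slice_ge d (X : set 'rV[R]_d.+1) (f : R -> R) a b :
  borel X -> (forall x, a <= x <= b -> {for x, continuous f}) ->
  (forall x, a <= x <= b -> 0 <= f x) ->
  (forall x, a <= x <= b -> ((f x)%:E <= vol [set v : 'rV_d | X (rcons_row x v)])%E) ->
  (\int[leb]_(x in `[a, b]) (f x)%:E <= vol X)%E.
Proof.
move=> bX cf f0 fX; rewrite vol_fubini1.
have mX := measurable_vol_slice bX.
have mf : measurable_fun `[a, b]%classic (EFin \o f).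
  apply/measurable_EFinP; apply: subspace_continuous_measurable_fun => //.
  by apply: continuous_in_subspaceT => x; rewrite inE /= in_itv /= => xab; exact: cf.
apply: (@le_trans _ _ (\int[leb]_(x in `[a, b]) vol [set v : 'rV_d | X (rcons_row x v)])%E).
  by apply: ge0_le_integral => //; exact: measurable_funTS.
apply: ge0_subset_integral => //.
by move=> x _; exact: vol_ge0.
Qed.

Lemma vol_slice_eq d (X : set 'rV[R]_d.+1) (f : R -> R) a b :
  (forall x, a <= x <= b -> (f x)%:E = vol [set v : 'rV_d | X (rcons_row x v)]) ->
  (forall x v, X (rcons_row x v) -> a <= x <= b) ->
  (\int[leb]_(x in `[a, b]) (f x)%:E = vol X)%E.
Proof.
move=> fX Xab; rewrite vol_fubini1 integral_mkcond.
apply: eq_integral => x _; rewrite patchE.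
have [xab|nab] := boolP (a <= x <= b).
  by rewrite mem_set ?fX//= in_itv.
rewrite memNset /=; last by rewrite in_itv /=; exact/negP.
rewrite (_ : mkset _ = set0) ?vol0//.
by apply/seteqP; split => v //= /Xab; exact/negP.
Qed.

Definition simplex d (s : R) : set 'rV[R]_d :=
  [set v | (forall i, 0 <= v 0 i) /\ \sum_i v 0 i <= s].

Lemma closed_le_cont (T : topologicalType) (f g : T -> R) :
  continuous f -> continuous g -> closed [set x | f x <= g x].
Proof.
move=> cf cg; rewrite (_ : mkset _ = (fun x => f x - g x) @^-1` [set y | y <= 0]).
  apply: closed_comp; last exact: closed_le.
  by move=> x _; apply: cvgB; [exact: cf|exact: cg].
by apply/seteqP; split => x /=; rewrite subr_le0.
Qed.

Lemma closed_simplex d s : closed (@simplex d s).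
Proof.
rewrite (_ : @simplex d s =
  \bigcap_(i in [set: 'I_d]) [set v | 0 <= v 0 i] `&` [set v | \sum_i v 0 i <= s]).
  apply: closedI.
    apply: closed_bigI => i _; apply: closed_le_cont; first exact: cst_continuous.
    exact: coord_continuous.
  apply: closed_le_cont; last exact: cst_continuous.
  by apply: continuous_sumr => i; exact: coord_continuous.
by apply/seteqP; split => v /= [h1 h2]; split => // i; [move=> _|]; exact: h1.
Qed.

(** A slice of a simplex is a smaller simplex. *)
Lemma simplex_rcons d s a (v : 'rV[R]_d) :
  simplex s (rcons_row a v) <-> 0 <= a /\ simplex (s - a) v.
Proof.
rewrite /simplex /= big_ord_recl rcons_row0.
have -> : \sum_(j < d) rcons_row a v 0 (lift ord0 j) = \sum_j v 0 j.
  by apply: eq_bigr => j _; exact: rcons_rowS.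
rewrite lerBrDl; split.
  move=> [h1 h2]; split; first by have := h1 ord0; rewrite rcons_row0.
  by split => // i; have := h1 (lift ord0 i); rewrite rcons_rowS.
move=> [a0 [h1 h2]]; split => // i.
by have [j ->|->] := unliftP ord0 i; rewrite ?rcons_rowS ?rcons_row0.
Qed.

Lemma is_derive_simplex d (s x : R) :
  is_derive x 1 (fun y => - ((s - y) ^+ d.+1 / d.+1`!%:R)) ((s - x) ^+ d / d`!%:R).
Proof.
have h : is_derive x 1 (fun y : R => s - y) (-1).
  by rewrite -[-1]sub0r; apply: is_deriveB.
have hX := @is_deriveX _ _ _ d.+1 x 1 _ h.
have hM := @is_deriveZ _ _ _ _ (- (d.+1`!%:R)^-1) x 1 _ hX.
have -> : (fun y => - ((s - y) ^+ d.+1 / d.+1`!%:R)) =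
  (- (d.+1`!%:R)^-1) *: ((fun y => s - y) ^+ d.+1).
  apply/funext => y; transitivity (- (d.+1`!%:R)^-1 * (s - y) ^+ d.+1).
    by rewrite mulNr mulrC.
  rewrite [RHS]/GRing.scale /=; congr (_ * _).
  by rewrite exprfctE.
apply: is_derive_eq hM _.
rewrite factS natrM invfM /GRing.scale /= mulrN1 mulrNN mulrACA.
by rewrite mulVf ?pnatr_eq0// mul1r mulrC.
Qed.

Lemma continuous_simplex d (s x : R) :
  {for x, continuous (fun y => (s - y) ^+ d / d`!%:R)}.
Proof.
apply: cvgM; last exact: cvg_cst.
apply: (@cvg_comp _ _ _ (fun y => s - y) (fun y => y ^+ d)); last exact: exprn_continuous.
by apply: cvgB; [exact: cvg_cst|exact: cvg_id].
Qed.

(** Induction on the dimension, integrating the volumes of the slices. *)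
Lemma vol_simplex d (s : R) : 0 <= s -> vol (@simplex d s) = (s ^+ d / d`!%:R)%:E.
Proof.
elim: d s => [|d IH] s s0.
  rewrite expr0 fact0 divr1 /vol /= diracE mem_set//=.
  by split => [[]//|]; rewrite big_ord0.
rewrite -(@vol_slice_eq d _ (fun x => (s - x) ^+ d / d`!%:R) 0 s); first last.
- move=> x v /simplex_rcons[-> [v0 vs]] /=.
  by rewrite -subr_ge0 (le_trans _ vs)// sumr_ge0.
- move=> x /andP[x0 xs]; rewrite -IH ?subr_ge0//; congr vol.
  by apply/seteqP; split => v /=; rewrite simplex_rcons; [split|case].
have [->|sn0] := eqVneq s 0.
  by rewrite set_itv1 integral_set1 expr0n /= mul0r.
have {sn0} sp : 0 < s by rewrite lt_neqAle eq_sym sn0.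
rewrite (FTC2_is_derive sp (fun x _ => is_derive_simplex d s x)
  (fun x _ => @continuous_simplex d s x)).
by rewrite subrr subr0 expr0n /= mul0r oppr0 add0r opprK.
Qed.
End Slices.

(** * Cartesian products and balls *)

Section Products.
Variable R : realType.
Local Notation mR := (measurableTypeR R).
Local Notation leb := (@lebesgue_measure R).

Lemma vol_row0 (A : set 'rV[R]_0) : vol A = (\1_A 0)%:E.
Proof.
rewrite /vol /= diracE indicE; congr ((_ : bool)%:R)%:E.
by apply/idP/idP; rewrite !inE /= (thinmx0 (\row_i _)).
Qed.

Lemma lsubmx_rcons m n a (v : 'rV[R]_(m + n)) :
  lsubmx (rcons_row a v : 'rV[R]_(m.+1 + n)) = rcons_row a (lsubmx v).
Proof.
apply/rowP => i; rewrite mxE; have [j ->|->] := unliftP ord0 i.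
  rewrite [RHS]rcons_rowS [RHS]mxE.
  rewrite (_ : lshift n (lift ord0 j) = lift ord0 (lshift n j) :> 'I_(m + n).+1).
    exact: rcons_rowS.
  exact: val_inj.
rewrite rcons_row0 (_ : lshift n ord0 = ord0 :> 'I_(m + n).+1).
  exact: rcons_row0.
exact: val_inj.
Qed.

Lemma rsubmx_rcons m n a (v : 'rV[R]_(m + n)) :
  rsubmx (rcons_row a v : 'rV[R]_(m.+1 + n)) = rsubmx v.
Proof.
apply/rowP => i; rewrite [LHS]mxE [RHS]mxE.
rewrite (_ : rshift m.+1 i = lift ord0 (rshift m i) :> 'I_(m + n).+1).
  exact: rcons_rowS.
exact: val_inj.
Qed.

(** Induction on the dimension of the first factor, slicing along its first coordinate. *)
Lemma vol_prod m n (A : set 'rV[R]_m) (B : set 'rV[R]_n) : borel A ->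
  vol [set w : 'rV_(m + n) | A (lsubmx w) /\ B (rsubmx w)] = (vol A * vol B)%E.
Proof.
elim: m A => [|m IH] A bA.
  have rE (w : 'rV[R]_(0 + n)) : rsubmx w = w.
    by apply/rowP => i; rewrite mxE; congr (w _ _); exact: val_inj.
  rewrite vol_row0 indicE; have [|] := boolP (0 \in A).
    rewrite inE => A0; rewrite mul1e; congr vol; apply/seteqP; split => w /=; rewrite rE.
      by case.
    by move=> Bw; split => //; rewrite (thinmx0 (lsubmx w)).
  move=> nA0; rewrite mul0e (_ : mkset _ = set0) ?vol0//.
  apply/seteqP; split => w //= [+ _]; rewrite (thinmx0 (lsubmx w)) => A0.
  by case/negP: nA0; rewrite inE.
rewrite (@vol_fubini1 _ (m + n)) [vol A]vol_fubini1.
rewrite -(@ge0_integralZr _ mR R leb setT measurableT); last 3 first.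
- exact: measurable_vol_slice.
- by move=> x _; exact: vol_ge0.
- exact: vol_ge0.
apply: eq_integral => a _; rewrite -IH; last exact: borel_slice.
by congr vol; apply/seteqP; split => w /=; rewrite lsubmx_rcons rsubmx_rcons.
Qed.

(** The ball of squared radius c: slicing a ball gives a ball of squared radius
    c - a^2, so this parameter avoids square roots. *)
Definition sqball d (c : R) : set 'rV[R]_d := [set v | \sum_i v 0 i ^+ 2 <= c].

Lemma sqball_rcons d c a (v : 'rV[R]_d) :
  sqball c (rcons_row a v) <-> sqball (c - a ^+ 2) v.
Proof.
rewrite /sqball /= big_ord_recl rcons_row0.
have -> : \sum_(j < d) rcons_row a v 0 (lift ord0 j) ^+ 2 = \sum_j v 0 j ^+ 2.
  by apply: eq_bigr => j _; rewrite rcons_rowS.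
by rewrite lerBrDl.
Qed.

Lemma closed_sqball d c : closed (@sqball d c).
Proof.
apply: closed_le_cont; last exact: cst_continuous.
apply: continuous_sumr => i.
suff cs (T : topologicalType) (f : T -> R) : continuous f -> continuous (fun x => f x ^+ 2).
  by apply: cs; exact: coord_continuous.
by move=> cf x; apply: (@cvg_comp _ _ _ f (fun y => y ^+ 2)); [exact: cf|exact: exprn_continuous].
Qed.

Lemma sqball_le0 d c (v : 'rV[R]_d) : sqball c v -> 0 <= c.
Proof. by rewrite /sqball /=; apply: le_trans; rewrite sumr_ge0// => i _; exact: sqr_ge0. Qed.

Lemma vol_sqball1 c : 0 <= c -> vol (@sqball 1 c) = (2 * Num.sqrt c)%:E.
Proof.
move=> c0; rewrite -(@vol_slice_eq R 0 _ (cst 1) (- Num.sqrt c) (Num.sqrt c)).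
- rewrite -[LHS]/(\int[leb]_(x in `[(- Num.sqrt c)%R, Num.sqrt c]) cst 1%:E x)%E.
  rewrite integral_cst//= mul1e lebesgue_measure_itv /= lte_fin.
  case: ifPn => [_|]; first by rewrite -EFinB; congr (_%:E); ring.
  rewrite -leNgt => h; have : Num.sqrt c = 0 by have := sqrtr_ge0 c; lra.
  by move=> ->; rewrite mulr0.
- move=> x /andP[x1 x2]; rewrite vol_row0 indicE mem_set//; apply/sqball_rcons.
  rewrite /sqball /= big_ord0 subr_ge0 -(sqr_sqrtr c0) -real_normK ?num_real//.
  by rewrite ler_pXn2r ?nnegrE ?sqrtr_ge0// ler_norml x1.
- move=> x v /sqball_rcons/sqball_le0; rewrite subr_ge0 => h.
  by rewrite -ler_norml -sqrtr_sqr ler_wsqrtr.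
Qed.

Lemma vol_sqball_scale d c : 0 < c ->
  vol (@sqball d c) = ((Num.sqrt c ^+ d)%:E * vol (@sqball d 1))%E.
Proof.
move=> c0; have s0 : 0 < Num.sqrt c by rewrite sqrtr_gt0.
have bS : borel (@sqball d 1) by apply: borel_closed; exact: closed_sqball.
have uM : (Num.sqrt c)^-1%:M \in @unitmx R d.
  by rewrite unitmxE det_scalar unitfE expf_neq0// invr_neq0// gt_eqF.
have := unitmx_linear_law uM bS.
rewrite det_scalar exprVn normrV ?unitfE ?expf_neq0 ?gt_eqF//.
rewrite invrK ger0_norm ?exprn_ge0 ?ltW// => <-.
have eqS (v : 'rV[R]_d) : sqball c v <-> sqball 1 (v *m (Num.sqrt c)^-1%:M).
  rewrite /sqball /= mul_mx_scalar.
  rewrite (_ : \sum_i ((_ *: v) 0 i) ^+ 2 = c^-1 * \sum_i v 0 i ^+ 2).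
    by rewrite ler_pdivrMl// mulr1.
  rewrite mulr_sumr; apply: eq_bigr => i _.
  by rewrite mxE exprMn exprVn sqr_sqrtr// ltW.
by congr vol; apply/seteqP; split => v /eqS.
Qed.

(** The part of the disc over [-sin q, sin q] already has area at least 2 q. *)
Lemma vol_sqball2_ge (q : R) : 0 < q < pi / 2 -> ((2 * q)%:E <= vol (@sqball 2 1))%E.
Proof.
move=> /andP[q0 q2].
have sq0 : 0 < sin q by rewrite sin_gt0_pihalf// q0.
have cq0 : 0 < cos q by rewrite cos_gt0_pihalf// q2 andbT (lt_trans _ q0)// oppr_lt0 divr_gt0// pi_gt0.
have sq1 : sin q < 1.
  rewrite -sin_pihalf ltr_sin// in_itv/=.
    by rewrite (ltW q2) andbT (le_trans _ (ltW q0))// oppr_le0 divr_ge0// pi_ge0.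
  by rewrite lexx andbT ge0_cp// divr_ge0// pi_ge0.
pose f (x : R) := 2 * Num.sqrt (1 - x ^+ 2).
(* twice the antiderivative of sqrt (1 - x^2) *)
pose F (x : R) := x * Num.sqrt (1 - x ^+ 2) + asin x.
have x1 x : - sin q <= x <= sin q -> -1 < x < 1 by move=> /andP[]; lra.
have x2 x : - sin q <= x <= sin q -> 0 < 1 - x ^+ 2.
  by move=> /x1 /andP[]; nra.
have cf x : - sin q <= x <= sin q -> {for x, continuous f}.
  move=> h; apply: cvgM; first exact: cvg_cst.
  apply: (@cvg_comp _ _ _ (fun y => 1 - y ^+ 2) Num.sqrt); last exact: sqrt_continuous.
  by apply: cvgB; [exact: cvg_cst|exact: exprn_continuous].
have dF x : - sin q <= x <= sin q -> is_derive x 1 F (f x).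
  move=> h; have /andP[xl xr] := x1 x h; have xp := x2 x h.
  have d2 : is_derive x 1 (fun y : R => 1 - y ^+ 2) (- (2 * x)).
    by apply: is_derive_eq; rewrite /GRing.scale /=; ring.
  have d1 : is_derive x 1 (fun y : R => Num.sqrt (1 - y ^+ 2))
      (- x / Num.sqrt (1 - x ^+ 2)).
    apply: is_derive_eq (@is_derive1_comp R Num.sqrt (fun y => 1 - y ^+ 2) x _ _
      (is_derive1_sqrt xp) d2) _.
    by field; rewrite gt_eqF ?sqrtr_gt0.
  have d3 : is_derive x 1 (@asin R) (Num.sqrt (1 - x ^+ 2))^-1.
    by apply: is_derive1_asin; rewrite xl xr.
  apply: is_derive_eq (is_deriveD (is_deriveM (@is_derive_id _ _ x 1) d1) d3) _.
  have sp : 0 < Num.sqrt (1 - x ^+ 2) by rewrite sqrtr_gt0.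
  have se : Num.sqrt (1 - x ^+ 2) ^+ 2 = 1 - x ^+ 2 by rewrite sqr_sqrtr// ltW.
  rewrite /GRing.scale /= /f mulr1.
  move: (Num.sqrt _) sp se => s sp se; apply: (mulIf (lt0r_neq0 sp)).
  transitivity (- x ^+ 2 + s ^+ 2 + 1); first by field; rewrite gt_eqF.
  by rewrite -mulrA -expr2 se; ring.
apply: le_trans (@vol_slice_ge R 1 _ f (- sin q) (sin q) _ _ _ _).
- rewrite (FTC2_is_derive _ dF cf); last by lra.
  rewrite lee_fin /F sqrrN -cos2sin2 sqrtr_sqr (gtr0_norm cq0).
  have -> : asin (- sin q) = - q.
    by rewrite -sinN sinK// in_itv /=; apply/andP; split; have := @pi_ge0 R; lra.
  have -> : asin (sin q) = q.
    by rewrite sinK// in_itv /=; apply/andP; split; have := @pi_ge0 R; lra.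
  by rewrite mulNr; have := mulr_gt0 sq0 cq0; lra.
- by apply: borel_closed; exact: closed_sqball.
- exact: cf.
- by move=> x h; rewrite mulr_ge0// sqrtr_ge0.
- move=> x h; rewrite /f -vol_sqball1; last by rewrite ltW// x2.
  apply: le_vol.
  + by apply: borel_closed; exact: closed_sqball.
  + by apply: borel_slice; apply: borel_closed; exact: closed_sqball.
  + by move=> v hv; apply/sqball_rcons.
Qed.

(** The alternating series of the cosine is above its partial sum of degree ten. *)
Lemma cos_ge_taylor (x : R) : 0 < x < 2 ->
  1 - x ^+ 2 / 2 + x ^+ 4 / 24 - x ^+ 6 / 720 + x ^+ 8 / (720 * 56) - x ^+ 10 / (720 * 5040) < cos x.
Proof.
move=> /andP[x0 x2].
have h := @cvg_cos_coeff' R x; rewrite -(cvg_lim (@Rhausdorff R) h).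
have F n : n.+2`!%:R = n.+2%:R * n.+1%:R * n`!%:R :> R by rewrite !factS !natrM mulrA.
have S n : (-1) ^+ n.+1 = - (-1) ^+ n :> R by rewrite exprS mulN1r.
rewrite (_ : _ - _ = \sum_(0 <= i < 6) cos_coeff' x i); last first.
  do 6 rewrite big_nat_recl//; rewrite big_nil /cos_coeff' -!exprnP !S expr0.
  rewrite -[0.*2]/0%N -[1.*2]/2%N -[2.*2]/4%N -[3.*2]/6%N -[4.*2]/8%N -[5.*2]/10%N.
  by rewrite !F fact0; field.
apply: lt_sum_lim_series; first by move/cvgP in h.
move=> d; rewrite /cos_coeff' -!exprnP.
have -> : (-1) ^+ (6 + d.*2) = 1 :> R.
  by rewrite -signr_odd oddD odd_double.
have -> : (-1) ^+ (6 + d.*2.+1) = -1 :> R.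
  by rewrite -signr_odd oddD /= odd_double.
rewrite (_ : 6 + d.*2.+1 = (6 + d.*2).+1)%N; last by rewrite addnS.
have : (0 < 6 + d.*2)%N by [].
move: (6 + d.*2)%N => n n0; rewrite doubleS 2!exprS F mul1r mulN1r mulNr subr_gt0.
have xn : 0 < x ^+ n.*2 by rewrite exprn_gt0.
have fn : 0 < (n.*2)`!%:R :> R by rewrite ltr0n fact_gt0.
have a1 : 2 <= n.*2.+1%:R :> R by rewrite ler_nat ltnS double_gt0.
have a2 : 2 <= n.*2.+2%:R :> R by rewrite ler_nat.
rewrite ltr_pdivrMr ?mulr_gt0 ?(lt_le_trans _ a1) ?(lt_le_trans _ a2)//.
move: (x ^+ n.*2) (n.*2)`!%:R n.*2.+1%:R n.*2.+2%:R xn fn a1 a2 => X F' B A xn fn a1 a2.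
rewrite (_ : X / F' * _ = X * (A * B)); last by field; rewrite gt_eqF.
rewrite mulrA [ltLHS]mulrC ltr_pM2l//.
nra.
Qed.
Lemma pi_gt_of_taylor (q : R) : 0 < q < 2 ->
  0 <= 1 - q ^+ 2 / 2 + q ^+ 4 / 24 - q ^+ 6 / 720 + q ^+ 8 / (720 * 56)
    - q ^+ 10 / (720 * 5040) -> q < pi / 2.
Proof.
move=> q02 /le_lt_trans/(_ (cos_ge_taylor q02)) cq; have /andP[q0 q2] := q02.
rewrite ltNge; apply/negP => h.
have pi2 := @pi_ge2 R.
suff : cos q <= cos (pi / 2) by rewrite cos_pihalf leNgt cq.
rewrite leNgt ltr_cos ?in_itv /=; first by rewrite -leNgt.
  by apply/andP; split; lra.
by apply/andP; split; lra.
Qed.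

(** The bound pi > 3.1415, from the sign of the cosine. *)
Lemma pihalf_gt : (3 + 283 / 2000) / 2 < pi / 2 :> R.
Proof. by apply: pi_gt_of_taylor; first (by apply/andP; split; lra); lra. Qed.

Lemma vol_sqball2 : ((3 + 283 / 2000)%:E <= vol (@sqball 2 1))%E.
Proof.
rewrite (_ : 3 + _ = 2 * ((3 + 283 / 2000) / 2)); last by field.
by apply: vol_sqball2_ge; rewrite pihalf_gt andbT; lra.
Qed.

(** The slice at height x is a disc of squared radius 1 - x^2; 283 / 2000 is the
    decimal part of 3.1415. *)
Lemma vol_sqball3 : ((4 / 3 * (3 + 283 / 2000))%:E <= vol (@sqball 3 1))%E.
Proof.
pose c : R := 3 + 283 / 2000.
have c0 : 0 < c by rewrite /c; lra.
pose f (x : R) := c * (1 - x ^+ 2).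
pose F (x : R) := c * (x - x ^+ 3 / 3).
have cf x : {for x, continuous f}.
  apply: cvgM; first exact: cvg_cst.
  by apply: cvgB; [exact: cvg_cst|exact: exprn_continuous].
have dF (x : R) : is_derive x 1 F (f x).
  by apply: is_derive_eq; rewrite /GRing.scale /= /f; field.
apply: le_trans (@vol_slice_ge R 2 _ f (-1) 1 _ _ _ _).
- rewrite (FTC2_is_derive _ (fun x _ => dF x) (fun x _ => cf x)); last by lra.
  by rewrite lee_fin /F /c; lra.
- by apply: borel_closed; exact: closed_sqball.
- by move=> x _; exact: cf.
- by move=> x h; apply: mulr_ge0; [exact: ltW|nra].
- move=> x h.
  have [x1|x0] := eqVneq (x ^+ 2) 1; first by rewrite /f x1 subrr mulr0 vol_ge0.
  have x1 : 0 < 1 - x ^+ 2 by rewrite subr_gt0 lt_neqAle x0 /=; nra.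
  rewrite (_ : mkset _ = sqball (1 - x ^+ 2)); last by apply/seteqP; split => v /sqball_rcons.
  rewrite vol_sqball_scale// sqr_sqrtr; last exact: ltW.
  rewrite /f [c * _]mulrC EFinM.
  by apply: lee_wpmul2l; [rewrite lee_fin ltW|exact: vol_sqball2].
Qed.
End Products.

(** * Euclidean norm, convex hulls and outer parallel bodies *)

Section Geometry.
Variable R : realType.

Section dim.
Variable d : nat.
Local Notation E := 'rV[R]_d.
Implicit Types (x y z : E) (A C : set E).

Definition sqn x : R := \sum_i x 0 i ^+ 2.

Lemma sqn_ge0 x : 0 <= sqn x.
Proof. by apply: sumr_ge0 => i _; exact: sqr_ge0. Qed.

Lemma enormE x : enorm x = Num.sqrt (sqn x).
Proof. by []. Qed.

Lemma enorm_ge0 x : 0 <= enorm x.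
Proof. exact: sqrtr_ge0. Qed.

Lemma sqr_enorm x : enorm x ^+ 2 = sqn x.
Proof. by rewrite sqr_sqrtr ?sqn_ge0. Qed.

Lemma sqnE x : sqn x = (x *m x^T) 0 0.
Proof. by rewrite mxE; apply: eq_bigr => i _; rewrite mxE expr2. Qed.

Lemma sqnZ a x : sqn (a *: x) = a ^+ 2 * sqn x.
Proof. by rewrite mulr_sumr; apply: eq_bigr => i _; rewrite mxE exprMn. Qed.

Lemma enormZ a x : enorm (a *: x) = `|a| * enorm x.
Proof. by rewrite !enormE sqnZ sqrtrM ?sqr_ge0// sqrtr_sqr. Qed.

Lemma enormN x : enorm (- x) = enorm x.
Proof. by rewrite -scaleN1r enormZ normrN normr1 mul1r. Qed.

Lemma enorm0 : enorm (0 : E) = 0.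
Proof. by rewrite -(scale0r (0 : E)) enormZ normr0 mul0r. Qed.

Lemma sqn_eq0 x : sqn x = 0 -> x = 0.
Proof.
move=> /eqP; rewrite psumr_eq0; last by move=> i _; exact: sqr_ge0.
move=> /allP h; apply/rowP => i; rewrite mxE.
by have := h i (mem_index_enum _); rewrite /= sqrf_eq0 => /eqP.
Qed.

Lemma enorm_eq0 x : enorm x = 0 -> x = 0.
Proof. by move=> h; apply: sqn_eq0; rewrite -sqr_enorm h expr0n. Qed.

Lemma enorm_gt0 x : x != 0 -> 0 < enorm x.
Proof.
by move=> x0; rewrite lt_neqAle enorm_ge0 andbT eq_sym; apply: contra_neq x0 => /enorm_eq0.
Qed.

(** Cauchy-Schwarz, by summing a weighted arithmetic-geometric inequality. *)
Lemma dot_le x y : \sum_i x 0 i * y 0 i <= enorm x * enorm y.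
Proof.
have [->|x0] := eqVneq x 0.
  by rewrite enorm0 mul0r big1// => i _; rewrite mxE mul0r.
have [->|y0] := eqVneq y 0.
  by rewrite enorm0 mulr0 big1// => i _; rewrite mxE mulr0.
have a0 := enorm_gt0 x0; have b0 := enorm_gt0 y0.
set a := enorm x in a0 *; set b := enorm y in b0 *.
have h i : x 0 i * y 0 i <= a * b / 2 * (a^-2 * x 0 i ^+ 2 + b^-2 * y 0 i ^+ 2).
  have := sqr_ge0 (x 0 i / a - y 0 i / b).
  rewrite (_ : _ * (_ + _) = x 0 i * y 0 i + a * b / 2 * (x 0 i / a - y 0 i / b) ^+ 2).
    by move=> ?; rewrite lerDl mulr_ge0// divr_ge0// mulr_ge0// ltW.
  by field; rewrite !gt_eqF.
apply: le_trans (ler_sum _ (fun i _ => h i)) _.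
rewrite -mulr_sumr big_split /= -!mulr_sumr -!/(sqn _) -!sqr_enorm -/a -/b.
by rewrite le_eqVlt; apply/orP; left; apply/eqP; field; rewrite !gt_eqF.
Qed.

Lemma sqnD x y : sqn (x + y) = sqn x + 2 * (\sum_i x 0 i * y 0 i) + sqn y.
Proof.
rewrite mulr_sumr -!big_split /=; apply: eq_bigr => i _; rewrite mxE; ring.
Qed.

Lemma ler_enormD x y : enorm (x + y) <= enorm x + enorm y.
Proof.
rewrite -(ler_pXn2r (n := 2)) ?nnegrE ?addr_ge0 ?enorm_ge0// sqr_enorm sqnD.
rewrite sqrrD !sqr_enorm mulr2n; have := dot_le x y; lra.
Qed.

Lemma continuous_enorm : continuous (@enorm R d).
Proof.
move=> x; apply: (@cvg_comp _ _ _ sqn Num.sqrt); last exact: sqrt_continuous.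
suff cs : continuous sqn by exact: cs.
rewrite /sqn.
apply: continuous_sumr => i.
suff cs (T : topologicalType) (f : T -> R) : continuous f -> continuous (fun t => f t ^+ 2).
  by apply: cs; exact: coord_continuous.
by move=> cf t; apply: (@cvg_comp _ _ _ f (fun u => u ^+ 2)); [exact: cf|exact: exprn_continuous].
Qed.

Lemma coord_le_enorm x i : `|x 0 i| <= enorm x.
Proof.
rewrite -sqrtr_sqr enormE ler_wsqrtr// /sqn (bigD1 i)//= lerDl.
by apply: sumr_ge0 => j _; exact: sqr_ge0.
Qed.

Lemma enorm_le_coord x e : 0 <= e -> (forall i, `|x 0 i| <= e) -> enorm x <= d%:R * e.
Proof.
move=> e0 h; rewrite -(ler_pXn2r (n := 2)) ?nnegrE ?enorm_ge0 ?mulr_ge0// sqr_enorm.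
apply: (@le_trans _ _ (\sum_(i < d) e ^+ 2)).
  by apply: ler_sum => i _; rewrite -real_normK ?num_real// ler_pXn2r ?nnegrE// ltW.
rewrite sumr_const card_ord -[leLHS]mulr_natl exprMn ler_wpM2r ?sqr_ge0//.
by rewrite -natrX ler_nat; case: (d) => // n; rewrite expnS leq_pmulr// expn1.
Qed.

Lemma unit_ballE : @unit_ball R d = sqball 1.
Proof.
apply/seteqP; split => x; rewrite /unit_ball /sqball /= -/(sqn x) -sqr_enorm => h.
  by rewrite expr_le1// enorm_ge0.
by rewrite -(@expr_le1 _ 2)// enorm_ge0.
Qed.

Lemma closed_unit_ball : closed (@unit_ball R d).
Proof. by rewrite unit_ballE; exact: closed_sqball. Qed.

Lemma compact_unit_ball : compact (@unit_ball R d).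
Proof.
apply: bounded_closed_compact; last exact: closed_unit_ball.
exists 1; split; first exact: num_real.
move=> M M1 x /= xB; rewrite /Num.Def.normr /= mx_normrE.
apply: bigmax_le; first by rewrite (le_trans _ (ltW M1)).
by move=> [i j] _ /=; rewrite ord1 (le_trans (coord_le_enorm x j))// (le_trans xB)// ltW.
Qed.

(** Convexity with real weights; the library notion quantifies over weights in a
    bundled unit interval. *)
Definition convexP A := forall x y (t : R), 0 <= t <= 1 -> A x -> A y ->
  A (t *: x + (1 - t) *: y).

Lemma convex_setP A : @convex_set R E A <-> convexP A.
Proof.
split=> [h x y t /andP[t0 t1] Ax Ay|h x y l].
  have := h x y (Itv01 t0 t1); rewrite !inE; exact.
rewrite !inE => Ax Ay; apply: h => //.
by apply/andP; split; [exact: ge0|exact: le1].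
Qed.

Lemma sub_hull C : C `<=` convex_hull C.
Proof. exact: sub_smallest. Qed.

Lemma hull_convex C : convexP (convex_hull C).
Proof.
move=> x y t t01 hx hy A [cA CA].
have /convex_setP := cA; apply => //; [exact: hx|exact: hy].
Qed.

Lemma hull_min C A : convexP A -> C `<=` A -> convex_hull C `<=` A.
Proof. by move=> cA CA; apply: smallest_sub => //; exact/convex_setP. Qed.

Lemma convex_unit_ball : convexP (@unit_ball R d).
Proof.
move=> x y t /andP[t0 t1]; rewrite /unit_ball /= => hx hy.
apply: le_trans (ler_enormD _ _) _; rewrite !enormZ !ger0_norm ?subr_ge0//.
by nra.
Qed.

Definition outer C := minkowski_sum (convex_hull C) (@unit_ball R d).

End dim.
End Geometry.

(** * Compactness of hulls and the cylinder bound *)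

Section Hull.
Variable R : realType.

Section dim.
Variable d : nat.
Local Notation E := 'rV[R]_d.
Implicit Types (x y z : E) (A C : set E).

(** The convex hull of a convex set and one more point.  The point itself is
    adjoined to cover the empty set. *)
Definition cone_over x A : set E :=
  [set x] `|` [set (p.1 *: x + (1 - p.1) *: p.2) | p in `[0, 1]%classic `*` A].

Lemma cone_over_convex x A : convexP A -> convexP (cone_over x A).
Proof.
move=> cA.
have in_cone (t : R) a : 0 <= t <= 1 -> A a -> cone_over x A (t *: x + (1 - t) *: a).
  by move=> t01 Aa; right; exists (t, a) => //; split => //=; rewrite in_itv.
have key (t t' l : R) a a' : 0 <= t <= 1 -> 0 <= t' <= 1 -> 0 <= l <= 1 -> A a -> A a' ->
    cone_over x A (l *: (t *: x + (1 - t) *: a) + (1 - l) *: (t' *: x + (1 - t') *: a')).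
  move=> /andP[t0 t1] /andP[u0 u1] /andP[l0 l1] Aa Aa'.
    (* total weight of x; if it is 1 the combination is x itself *)
pose T := l * t + (1 - l) * t'.
  have lt0 : 0 <= l * (1 - t) by rewrite mulr_ge0// subr_ge0.
  have lt1 : 0 <= (1 - l) * (1 - t') by rewrite mulr_ge0// subr_ge0.
  have TE : 1 - T = l * (1 - t) + (1 - l) * (1 - t') by rewrite /T; ring.
  have T0 : 0 <= T by rewrite addr_ge0// mulr_ge0// subr_ge0.
  have [T1|T1] := eqVneq (1 - T) 0.
    have e1 : l * (1 - t) = 0 by lra.
    have e2 : (1 - l) * (1 - t') = 0 by lra.
    left; rewrite !scalerDr !scalerA e1 e2 !scale0r !addr0 -scalerDl.
    by rewrite (_ : _ + _ = 1) ?scale1r// -/T; lra.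
  have T2 : 0 < 1 - T by rewrite lt_neqAle eq_sym T1 TE addr_ge0.
  have -> : l *: (t *: x + (1 - t) *: a) + (1 - l) *: (t' *: x + (1 - t') *: a') =
     T *: x + (1 - T) *: ((l * (1 - t) / (1 - T)) *: a +
                          (1 - l * (1 - t) / (1 - T)) *: a').
    rewrite [in RHS]scalerDr !scalerDr !scalerA addrACA -scalerDl -/T.
    congr (_ + (_ *: _ + _ *: _)); first by field.
    by rewrite mulrBr mulr1 TE; field; rewrite -TE.
  apply: in_cone; first by rewrite T0 /=; lra.
  apply: cA => //; apply/andP; split; first by apply: divr_ge0 => //; exact: ltW.
  by rewrite ler_pdivrMr// mul1r TE; lra.
have xx (l : R) : l *: x + (1 - l) *: x = x by rewrite -scalerDl addrC subrK scale1r.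
move=> p q l l01 [->|[[t a] /= [+ Aa] <-]] [->|[[t' a'] /= [+ Aa'] <-]].
- by left; rewrite xx.
- rewrite in_itv /= => t01; rewrite -[X in l *: X](_ : 1 *: x + (1 - 1) *: a' = x).
    by apply: key => //; rewrite lexx ler01.
  by rewrite subrr scale0r addr0 scale1r.
- rewrite in_itv /= => t01; rewrite -[X in _ + _ *: X](_ : 1 *: x + (1 - 1) *: a = x).
    by apply: key => //; rewrite lexx ler01.
  by rewrite subrr scale0r addr0 scale1r.
- by rewrite !in_itv /= => t01 t01'; apply: key.
Qed.

Lemma compact_cone_over x A : compact A -> compact (cone_over x A).
Proof.
move=> cA; apply: compactU; first exact: compact_set1.
apply: continuous_compact; last first.
  by apply: compact_setX => //; exact: segment_compact.
apply: continuous_subspaceT => -[t a].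
apply: cvgD; first by apply: cvgZr_tmp; exact: cvg_fst.
apply: cvgZ; last exact: cvg_snd.
by apply: cvgB; [exact: cvg_cst|exact: cvg_fst].
Qed.

(** Adjoining one point replaces a hull by the cone over it, the continuous image
    of a compact set. *)
Lemma compact_hull_seq (s : seq E) : compact (convex_hull [set` s]).
Proof.
elim: s => [|x s IH].
  rewrite (_ : convex_hull _ = set0); first exact: compact0.
  apply/seteqP; split => // y hy; have : convexP (set0 : set E) by [].
  by move=> c0; apply: (hull_min c0 _ hy); move=> z.
rewrite (_ : convex_hull _ = cone_over x (convex_hull [set` s])).
  exact: compact_cone_over.
apply/seteqP; split.
  apply: hull_min; first by apply: cone_over_convex; exact: hull_convex.
  move=> y /=; rewrite inE => /orP[/eqP ->|ys]; first by left.
  right; exists (0, y); last by rewrite scale0r add0r subr0 scale1r.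
  by split => /=; [rewrite in_itv /= lexx ler01|exact: sub_hull].
have sx : convex_hull [set` x :: s] x by apply: sub_hull; rewrite /= mem_head.
move=> y [->//|[[t a] /= [+ ha] <-]]; rewrite in_itv /= => t01.
apply: hull_convex => //; apply: hull_min ha; first exact: hull_convex.
by move=> z zs; apply: sub_hull; rewrite /= inE zs orbT.
Qed.

Lemma compact_outer C : finite_set C -> compact (outer C).
Proof.
move=> /finite_seqP[s ->].
rewrite (_ : outer _ = [set p.1 + p.2 | p in convex_hull [set` s] `*` @unit_ball R d]).
  apply: continuous_compact; last first.
    by apply: compact_setX; [exact: compact_hull_seq|exact: compact_unit_ball].
  apply: continuous_subspaceT => -[t a].
  by apply: cvgD; [exact: cvg_fst|exact: cvg_snd].
apply/seteqP; split => y.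
  by move=> [a ha [b hb <-]]; exists (a, b).
by move=> [[a b] [/= ha hb] <-]; exists a => //; exists b.
Qed.

Lemma borel_outer C : finite_set C -> borel (outer C).
Proof.
move=> /compact_outer cC; apply: borel_closed.
by apply: compact_closed => //; exact: norm_hausdorff.
Qed.
End dim.

Section cylinder.
Variable d : nat.
Local Notation E := 'rV[R]_d.+1.

(** The Householder reflection in the hyperplane orthogonal to e - v exchanges the
    unit vectors e and v. *)
Lemma unit_row_image (v : E) : sqn v = 1 ->
  exists H : 'M[R]_d.+1, [/\ (forall x, sqn (x *m H) = sqn x), `|\det H| = 1 &
    rcons_row 1 0 *m H = v].
Proof.
move=> v1; have [e eE] : exists e : E, e = rcons_row 1 0 by exists (rcons_row 1 0).
rewrite -eE; have e1 : sqn e = 1.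
  rewrite eE /sqn big_ord_recl rcons_row0 expr1n big1 ?addr0// => i _.
  by rewrite rcons_rowS mxE expr0n.
have orth (H : 'M[R]_d.+1) : H *m H^T = 1%:M ->
    (forall x : E, sqn (x *m H) = sqn x) /\ `|\det H| = 1.
  move=> HH; split.
    by move=> x; rewrite !sqnE trmx_mul mulmxA -(mulmxA x) HH mulmx1.
  have := congr1 determinant HH; rewrite det_mulmx det_tr det1 => /eqP.
  by rewrite -expr2 sqrf_eq1 => /orP[]/eqP ->; rewrite ?normrN normr1.
have [ev|ev] := eqVneq e v.
  exists 1%:M; have [|h1 h2] := orth 1%:M; first by rewrite trmx1 mulmx1.
  by split => //; rewrite mulmx1.
pose w := e - v.
have w0 : sqn w != 0 by apply: contra_neq ev => /sqn_eq0 /eqP; rewrite subr_eq0 => /eqP.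
have ww : w *m w^T = (sqn w)%:M.
  by apply/matrixP => i j; rewrite !ord1 sqnE [RHS]mxE eqxx mulr1n.
(* the reflection x - 2 (x . w) / (w . w) w *)
pose c := 2 / sqn w.
pose H : 'M[R]_d.+1 := 1%:M - c *: (w^T *m w).
have HT : H^T = H by rewrite /H linearB /= trmx1 linearZ /= trmx_mul trmxK.
have HH : H *m H^T = 1%:M.
  have MM : (w^T *m w) *m (w^T *m w) = sqn w *: (w^T *m w).
    by rewrite mulmxA -(mulmxA w^T) ww mul_mx_scalar -scalemxAl.
  have cs : c * c * sqn w = c + c by rewrite /c; field.
  rewrite HT /H; move: (w^T *m w) MM => M MM.
  rewrite mulmxBl mul1mx mulmxBr mulmx1 -scalemxAl -scalemxAr MM !scalerA.
  by rewrite cs scalerDl opprB addrK subrK.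
have [h1 h2] := orth H HH.
exists H; split => //.
have cd : c * (e *m w^T) 0 0 = 1.
  have dE : (e *m w^T) 0 0 = 1 - \sum_i e 0 i * v 0 i.
    rewrite -e1 mxE /sqn -sumrB; apply: eq_bigr => i _.
    by rewrite !mxE mulrBr expr2.
  have sE : sqn w = sqn e + sqn v - 2 * \sum_i e 0 i * v 0 i.
    rewrite mulr_sumr /sqn -big_split /= -sumrB; apply: eq_bigr => i _.
    by rewrite !mxE; ring.
  rewrite /c dE mulrAC; apply: (mulIf w0); rewrite mulfVK// mul1r sE e1 v1; ring.
rewrite /H mulmxBr mulmx1 -scalemxAr mulmxA (mx11_scalar (e *m w^T)).
by rewrite mul_scalar_mx scalerA cd scale1r /w opprB addrC subrK.
Qed.

Lemma continuous_lsub m n : continuous (fun w : 'rV[R]_(m + n) => lsubmx w).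
Proof.
apply: continuous_rowP => j; under eq_fun do rewrite mxE.
exact: coord_continuous.
Qed.

Lemma continuous_rsub m n : continuous (fun w : 'rV[R]_(m + n) => rsubmx w).
Proof.
apply: continuous_rowP => j; under eq_fun do rewrite mxE.
exact: coord_continuous.
Qed.

Lemma rsubmx0 n (v : 'rV[R]_(0 + n)) : rsubmx v = v.
Proof. by apply/rowP => i; rewrite mxE; congr (v _ _); exact: val_inj. Qed.

(** The outer body contains, around the segment from p to q, a cylinder over the
    unit ball of one dimension less. *)
Lemma vol_outer_ge (C : set E) p q : borel (outer C) -> C p -> C q ->
  ((enorm (q - p))%:E * vol (@sqball R d 1) <= vol (outer C))%E.
Proof.
move=> bC Cp Cq; set l := enorm (q - p).
have [l0|l0] := eqVneq l 0; first by rewrite l0 mul0e vol_ge0.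
have lp : 0 < l by rewrite lt_neqAle eq_sym l0 enorm_ge0.
pose v := l^-1 *: (q - p).
have v1 : sqn v = 1 by rewrite sqnZ -sqr_enorm -/l exprVn mulVf// expf_neq0.
have [H [Hn Hd Hv]] := unit_row_image v1.
pose X : set E := [set w | simplex l (lsubmx (w : 'rV_(1 + d))) /\ sqball 1 (rsubmx (w : 'rV_(1 + d)))].
have volX : vol X = (l%:E * vol (@sqball R d 1))%E.
  rewrite (@vol_prod R 1 d).
    by rewrite vol_simplex ?ltW// expr1 -[1`!]/1%N divr1.
  by apply: borel_closed; exact: closed_simplex.
rewrite -volX.
have bK : borel [set w | outer C (w + p)].
  by apply: (@borel_preimage _ _ _ (fun w => w + p)) bC; exact: continuousDc.
have uH : H \in unitmx.
  by rewrite unitmxE unitfE -normr_eq0 Hd oner_neq0.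
have := unitmx_linear_law uH bK; rewrite Hd invr1 mul1e vol_preimageD// => <-.
apply: le_vol.
- apply: borel_closed; apply: closedI.
    apply: (@closed_comp _ _ (fun w : E => lsubmx (w : 'rV_(1 + d))));
      last exact: closed_simplex.
    by move=> w _; exact: continuous_lsub.
  apply: (@closed_comp _ _ (fun w : E => rsubmx (w : 'rV_(1 + d))));
    last exact: closed_sqball.
  by move=> w _; exact: continuous_rsub.
- exact: borel_mulmx.
move=> w [[s0 s1] hb] /=.
have [a [u wE]] := rcons_rowP w.
have a0 : 0 <= a by have := s0 ord0; rewrite wE lsubmx_rcons rcons_row0.
have al : a <= l.
  by move: s1; rewrite big_ord1 wE lsubmx_rcons rcons_row0.
exists (p + a *: v).
  have -> : p + a *: v = (a / l) *: q + (1 - a / l) *: p.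
    rewrite scalerBl scale1r addrCA; congr (_ + _).
    by rewrite -scalerBr /v scalerA.
  apply: hull_convex; [|exact: sub_hull|exact: sub_hull].
  apply/andP; split; first by apply: divr_ge0 => //; exact: ltW.
  by rewrite ler_pdivrMr// mul1r.
exists (rcons_row 0 u *m H).
  rewrite unit_ballE /sqball /= -/(sqn _) Hn /sqn big_ord_recl rcons_row0 expr0n add0r.
  under eq_bigr do rewrite rcons_rowS.
  by move: hb; rewrite wE rsubmx_rcons rsubmx0.
have -> : w = a *: rcons_row 1 0 + rcons_row 0 u.
  rewrite wE; apply/rowP => i; rewrite [RHS]mxE [X in _ = X + _]mxE.
  have [j ->|->] := unliftP ord0 i; last by rewrite !rcons_row0 mulr1 addr0.
  by rewrite !rcons_rowS [(0 : 'rV_d) 0 j]mxE mulr0 add0r.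
by rewrite mulmxDl -scalemxAl Hv [RHS]addrC addrA.
Qed.
End cylinder.
End Hull.

(** * Packings, dimension and collinear sets *)

Section Packing.
Variable R : realType.
Variable d : nat.
Local Notation E := 'rV[R]_d.
Implicit Types (x y z : E) (A C : set E).

Lemma open_ball_interior z : enorm z < 1 -> (@unit_ball R d)° z.
Proof.
move=> z1.
have oB : open [set z : E | enorm z < 1].
  rewrite (_ : mkset _ = (@enorm R d) @^-1` [set t | t < 1]) //.
  by apply: open_comp; [move=> t _; exact: continuous_enorm|exact: open_lt].
have : nbhs z [set z : E | enorm z < 1] by apply: open_nbhs_nbhs; split.
by apply: filterS => t /= /ltW.
Qed.

Lemma interior_ball_lt z : (@unit_ball R d)° z -> enorm z < 1.
Proof.
move=> hz; rewrite ltNge; apply/negP => z1.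
have z0 : 0 < enorm z by exact: lt_le_trans z1.
have : \forall t \near (0:R), unit_ball (z + t *: z).
  have c0 : {for 0, continuous (fun t : R => z + t *: z)}.
    apply: cvgD; first exact: cvg_cst.
    by apply: cvgZr_tmp; exact: cvg_id.
  apply: c0; rewrite scale0r addr0; exact: hz.
move=> /nbhs_ballP[e /= e0 he].
(* moving outwards by the factor 1 + e / 2 must not leave the ball *)
have := he (e / 2); rewrite /ball /= sub0r normrN gtr0_norm ?divr_gt0// => /(_ _).
rewrite -{1}[z]scale1r -scalerDl /unit_ball /= enormZ.
have e2 : 0 < e / 2 by rewrite divr_gt0.
rewrite gtr0_norm ?addr_gt0//.
have h : e / 2 < e by lra.
by move=> /(_ h); nra.
Qed.

(** If two centres were closer than 2, their midpoint would be interior to both balls. *)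
Lemma packing_dist C x y : packing C -> C x -> C y -> x != y -> 2 <= enorm (x - y).
Proof.
move=> pC Cx Cy xy; rewrite leNgt; apply/negP => h.
have := pC x y Cx Cy (elimN eqP xy); apply/eqP/set0P.
(* the midpoint *)
exists (2^-1 *: (x + y)).
have half (u v : E) : enorm (u - v) < 2 -> enorm (2^-1 *: (v - u)) < 1.
  by move=> uv; rewrite enormZ -enormN opprB gtr0_norm//; lra.
split.
  exists (2^-1 *: (y - x)); first by apply: open_ball_interior; exact: half.
  by apply/rowP => i; rewrite !mxE; field.
exists (2^-1 *: (x - y)); first by apply: open_ball_interior; apply: half; rewrite -enormN opprB.
by apply/rowP => i; rewrite !mxE; field.
Qed.

Lemma dist_packing C :
  (forall x y, C x -> C y -> x != y -> 2 <= enorm (x - y)) -> packing C.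
Proof.
move=> h x y Cx Cy /eqP xy; apply/seteqP; split => // z [[u + <-] [v + uv]].
move=> /interior_ball_lt u1 /interior_ball_lt v1.
have := h x y Cx Cy xy; rewrite (_ : x - y = v - u).
  by have := ler_enormD v (- u); rewrite enormN; lra.
apply/eqP; rewrite subr_eq addrAC eq_sym subr_eq; apply/eqP; by rewrite -uv addrC.
Qed.

Lemma card_enum C n : (C #= `I_n)%card ->
  exists s : 'I_n -> E, injective s /\ C = range s.
Proof.
move=> /card_esym /card_set_bijP[f [f1 f2 f3]].
exists (fun i => f i); split.
  by move=> i j /f2 h; apply: val_inj; apply: h; rewrite inE /=.
apply/seteqP; split => [x /f3[i /= ni <-]|x [i _ <-]].
  by exists (Ordinal ni).
by apply: f1 => /=.
Qed.

Lemma enum_card C n (s : 'I_n -> E) : injective s -> C = range s -> (C #= `I_n)%card.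
Proof.
move=> si ->; apply: card_eq_trans (inj_card_eq _) _; first by move=> i j _ _; exact: si.
rewrite card_eq_sym (_ : `I_n = [set val i | i in [set: 'I_n]]).
  by apply: inj_card_eq => i j _ _; exact: val_inj.
by apply/seteqP; split => [i /= ni|_ [i _ <-] /=] //; exists (Ordinal ni).
Qed.

(** Pigeonhole: if all values lay in an interval shorter than n g, two of the n + 1
    would fall in the same one of n subintervals of length g. *)
Lemma spread n (T : 'I_n.+1 -> R) (g : R) : 0 < g ->
  (forall i j, i != j -> g <= `|T i - T j|) -> exists i j, n%:R * g <= T j - T i.
Proof.
move=> g0 gT.
have [i0 hi0] : exists i0, forall i, T i0 <= T i.
  by have [i _ hi] := @arg_minP _ _ _ ord0 xpredT T isT; exists i => j; exact: hi.
have [j0 hj0] : exists j0, forall i, T i <= T j0.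
  by have [i _ hi] := @arg_maxP _ _ _ ord0 xpredT T isT; exists i => j; exact: hi.
exists i0, j0; rewrite leNgt; apply/negP => h.
pose q i := (T i - T i0) / g.
have q0 i : 0 <= q i by rewrite divr_ge0// ?subr_ge0// ltW.
have qn i : q i < n%:R.
  by rewrite ltr_pdivrMr// (le_lt_trans _ h)// lerB.
have tn i : (Num.truncn (q i) < n)%N.
  by rewrite -(ltr_nat R) (le_lt_trans _ (qn i))// truncn_le.
have inj : injective (fun i => Ordinal (tn i)).
  move=> i j /(congr1 val) /= tij; apply/eqP; apply/negPn/negP => ij.
  have := gT i j ij; rewrite -(@ler_pM2r _ g^-1) ?invr_gt0// mulfV ?gt_eqF//.
  rewrite -[g^-1]gtr0_norm ?invr_gt0// -normrM.
  rewrite (_ : _ * _ = q i - q j); last by rewrite /q; field; rewrite gt_eqF.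
  have a1 := truncn_le (q i); have a2 := truncn_le (q j).
  rewrite q0 in a1; rewrite q0 in a2.
  have b1 := truncnS_gt (q i); have b2 := truncnS_gt (q j).
  rewrite tij in a1 b1; rewrite leNgt ltr_norml => /negP; apply.
  by rewrite -natr1 in b1 b2; apply/andP; split; lra.
have := leq_card _ inj; rewrite !card_ord.
by rewrite ltnn.
Qed.

Lemma affine_hull_sub C : C `<=` affine_hull C.
Proof. exact: sub_smallest. Qed.

(** On a line the distance is the difference of the parameters, so
    pairwise distances at least 2 force a large diameter. *)
Lemma collinear_spread C n k : packing C -> (C #= `I_n.+1)%card -> has_dim C k -> (k <= 1)%N ->
  exists p q, [/\ C p, C q & n%:R * 2 <= enorm (q - p)].
Proof.
move=> pC cC [x [V [hV dV]]] k1.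
have [v Vv] : exists v, (V <= <[v]>)%VS.
  have [V0|V0] := eqVneq (vpick V) 0.
    by exists 0; move/eqP: V0; rewrite vpick0 => /eqP ->; exact: sub0v.
  exists (vpick V); have : (<[vpick V]> == V)%VS.
    by rewrite eqEdim -memvE memv_pick dim_vline V0 dV.
  by move/eqP => ->.
have [s [si sC]] := card_enum cC.
have Cs i : C (s i) by rewrite sC; exists i.
have st i : exists t : R, s i = x + t *: v.
  have : affine_hull C (s i) by apply: affine_hull_sub.
  rewrite hV => -[u /= uV <-]; have := subvP Vv _ uV => /vlineP[t ->].
  by exists t.
have [t tE] := choice st.
pose T i := t i * enorm v.
have sT i j : enorm (s i - s j) = `|T i - T j|.
  rewrite !tE opprD addrACA subrr add0r -scalerBl enormZ /T -mulrBl normrM.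
  by rewrite (ger0_norm (enorm_ge0 _)).
have [i j ij|i [j ij]] := @spread n T 2 (ltr0Sn R 1).
  by rewrite -sT; apply: (packing_dist pC (Cs i) (Cs j)); apply/eqP => /si/eqP; apply/negP.
by exists (s i), (s j); split => //; rewrite sT (le_trans ij)// ler_norm.
Qed.

(** The affine hull of a finite set is a point plus the span of the differences. *)
Lemma has_dim_exists C : finite_set C -> C !=set0 ->
  exists2 k, has_dim C k & (k <= d)%N.
Proof.
move=> /finite_seqP[s sC] [x Cx].
pose V : {vspace E} := <<[seq c - x | c <- s]>>%VS.
exists (\dim V); last first.
  by rewrite (leq_trans (dimvS (subvf V)))// dimvf /dim /= mul1n.
exists x, V; split => //; apply/seteqP; split.
  apply: smallest_sub.
    move=> _ _ t [u /= uV <-] [v /= vV <-].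
    exists ((1 - t) *: u + t *: v); first by rewrite /= rpredD ?rpredZ.
    by rewrite !scalerDr addrACA -scalerDl subrK scale1r.
  rewrite sC => c /= cs; exists (c - x); last by rewrite addrC subrK.
  by rewrite /= memv_span//; apply/mapP; exists c.
move=> _ [v /= vV <-] A [aA CA].
have Ax : A x by exact: CA.
have sc (t : R) u : A (x + u) -> A (x + t *: u).
  move=> Au; have := aA _ _ t Ax Au.
  by rewrite scalerDr addrA -scalerDl subrK scale1r.
have ad u w : A (x + u) -> A (x + w) -> A (x + (u + w)).
  move=> /(sc 2) Au /(sc 2) Aw; have := aA _ _ 2^-1 Au Aw.
  rewrite !scalerDr !scalerA mulVf// addrACA -scalerDl subrK scale1r.
  by rewrite (_ : (1 - 2^-1) * 2 = 1) ?scale1r//; field.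
have cs c : c \in s -> A (x + (c - x)).
  by move=> h; rewrite addrC subrK; apply: CA; rewrite sC.
rewrite (coord_span (X := in_tuple [seq c - x | c <- s]) vV).
apply: (big_ind (fun w => A (x + w))); first by rewrite addr0.
  exact: ad.
move=> i _; apply: sc.
have : (in_tuple [seq c - x | c <- s])`_i \in [seq c - x | c <- s].
  by apply: mem_nth; exact: ltn_ord.
by move=> /mapP[c hc ->]; exact: cs.
Qed.

Lemma is_max_exists (S : set nat) j b : S j -> (forall k, S k -> (k <= b)%N) ->
  exists k, is_max S k.
Proof.
move=> Sj Sb; have ex : exists k, `[<S k>] by exists j; exact/asboolP.
have ub k : `[<S k>] -> (k <= b)%N by move=> /asboolP; exact: Sb.
have [k /asboolP Sk kmax] := ex_maxnP ex ub.
exists k; split => // i Si; exact/kmax/asboolP.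
Qed.

Lemma has_dim_le C k : has_dim C k -> (k <= d)%N.
Proof.
by move=> [x [V [_ <-]]]; rewrite (leq_trans (dimvS (subvf V)))// dimvf /dim /= mul1n.
Qed.

(** If every best packing has dimension at least 2, so has the one of maximal dimension. *)
Lemma is_k_gt1 n C : best_packings n C -> (0 < n)%N ->
  (forall k, has_dim C k -> (1 < k)%N) -> exists2 k, @is_k R d n k & (1 < k)%N.
Proof.
move=> bC n0 hC; have [pC cC] := bC.1.
have [s [_ sC]] := card_enum cC.
have fC : finite_set C by apply/finite_setP; exists n.
have C0 : C !=set0 by rewrite sC; exists (s (Ordinal n0)), (Ordinal n0).
have [j hj _] := has_dim_exists fC C0.
pose S := [set j | exists2 C, @best_packings R d n C & has_dim C j].
have Sj : S j by exists C.
have [k kmax] : exists k, is_max S k.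
  by apply: (@is_max_exists S j d) => // i [C' _]; exact: has_dim_le.
exists k => //; have := kmax.2 j Sj; apply: leq_trans; exact: hC.
Qed.

Lemma is_nstar_exists n : (0 < n)%N -> (exists2 k, @is_k R d n k & (1 < k)%N) ->
  exists2 m, is_nstar R d m & (m <= n)%N.
Proof.
move=> n0 hn; pose P m := (0 < m)%N /\ exists2 k, @is_k R d m k & (1 < k)%N.
have ex : exists m, `[<P m>] by exists n; exact/asboolP.
have [m /asboolP Pm mmin] := ex_minnP ex.
exists m; last by apply: mmin; exact/asboolP.
by split => // i Pi; apply: mmin; exact/asboolP.
Qed.
End Packing.

(** * Continuity of the volume of the outer body *)

Section Existence.
Variable R : realType.
Variable d : nat.
Local Notation E := 'rV[R]_d.
Implicit Types (x y z : E) (A C : set E).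

(** A bounded set lies in a translated simplex. *)
Lemma vol_bounded A M : borel A -> (forall u, A u -> enorm u <= M) -> (vol A < +oo)%E.
Proof.
move=> bA AM.
have [->|/set0P[u0 Au0]] := eqVneq A set0; first by rewrite vol0 ltry.
have M0 : 0 <= M by apply: le_trans (AM _ Au0); exact: enorm_ge0.
pose b : E := const_mx M.
have bS : borel (@simplex R d (d%:R * (2 * M))) by apply: borel_closed; exact: closed_simplex.
apply: (@le_lt_trans _ _ (vol [set u | simplex (d%:R * (2 * M)) (u + b)])).
  apply: le_vol => //.
    by apply: (@borel_preimage _ _ _ (fun u => u + b)) bS; exact: continuousDc.
  move=> u /AM uM; have uiM i : `|u 0 i| <= M := le_trans (coord_le_enorm u i) uM.
  split=> [i|]; first by rewrite !mxE; have := uiM i; rewrite ler_norml; lra.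
  rewrite mulr_natl -[X in _ <= _ *+ X]card_ord -sumr_const; apply: ler_sum => i _.
  by rewrite !mxE; have := uiM i; rewrite ler_norml; lra.
by rewrite vol_preimageD// vol_simplex ?ltry// mulr_ge0// mulr_ge0.
Qed.

Lemma compact_enorm_bounded A : compact A -> exists M, forall u, A u -> enorm u <= M.
Proof.
move=> /compact_bounded[M [_ hM]].
have [M0 M1] : exists M0, M < M0 /\ 0 <= M0.
  exists (`|M| + 1); split; first by rewrite (le_lt_trans (ler_norm M))// ltrDl.
  by rewrite addr_ge0.
exists (d%:R * M0) => u /(hM M0 M1.1) /= uM; apply: enorm_le_coord; first exact: M1.2.
move=> i; apply: le_trans uM; rewrite [leRHS]/Num.Def.normr /= mx_normrE.
by rewrite (le_bigmax _ (fun k => `|u k.1 k.2|) (0, i)).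
Qed.

Lemma vol_outer_fin C : finite_set C -> (vol (outer C) < +oo)%E.
Proof.
move=> fC; have [M hM] := compact_enorm_bounded (compact_outer fC).
exact: (vol_bounded (borel_outer fC) hM).
Qed.

Lemma fin_vol_outer C : finite_set C -> vol (outer C) \is a fin_num.
Proof. by move=> fC; rewrite ge0_fin_numE ?vol_ge0// vol_outer_fin. Qed.

Lemma hull_translate C a y : convex_hull C y -> convex_hull [set x + a | x in C] (y + a).
Proof.
move=> hy; apply: (@hull_min R d C [set y | convex_hull [set x + a | x in C] (y + a)]) hy.
  move=> u v t t01 /= hu hv.
  rewrite (_ : _ + a = t *: (u + a) + (1 - t) *: (v + a)); first exact: hull_convex.
  by rewrite !scalerDr addrACA -[t *: a + _]scalerDl [t + _]addrC subrK scale1r.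
by move=> u Cu; apply: sub_hull; exists u.
Qed.

Lemma vol_outer_translate C a : finite_set C ->
  vol (outer [set x + a | x in C]) = vol (outer C).
Proof.
move=> fC; have bK : borel (outer [set x + a | x in C]).
  by apply: borel_outer; exact: finite_image.
rewrite -(vol_preimageD a bK); congr vol; apply/seteqP; split => u /=; last first.
  move=> [p hp [b hb <-]]; exists (p + a); first exact: hull_translate.
  by exists b => //; rewrite addrAC.
move=> [p hp [b hb pb]]; exists (p - a).
  have := hull_translate (a := - a) hp; congr (convex_hull _ _).
  by apply/seteqP; split => v /=; [move=> [_ [w Cw <-] <-]; rewrite addrK|
    move=> Cv; exists (v + a); [exists v|rewrite addrK]].
by exists b => //; rewrite addrAC pb addrK.
Qed.

Lemma continuous_sub (T : topologicalType) (V : normedModType R) (f g : T -> V) :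
  continuous f -> continuous g -> continuous (fun t => f t - g t).
Proof. by move=> cf cg t; apply: cvgB; [exact: cf|exact: cg]. Qed.

Section config.
Variable m : nat.
Local Notation conf := 'rV[E]_m.+1.
Implicit Types c : conf.

(** The origin is added, so that scaling the hull down by a factor keeps it inside itself
    ([cvol_le]). *)
Definition pts c : set E := 0 |` range (c 0).

Lemma finite_pts c : finite_set (pts c).
Proof.
by rewrite /pts finite_setU; split; [exact: finite_set1|apply: finite_image; exact: finite_finset].
Qed.

Definition cvol c : R := fine (vol (outer (pts c))).

Lemma cvol_ge0 c : 0 <= cvol c.
Proof. by apply: fine_ge0; exact: vol_ge0. Qed.

(** Moving every centre by at most e changes the hull inside its e-neighbourhood,
    so the outer body grows at most like the dilation by 1 + e. *)
Lemma cvol_le c c' (e : R) : 0 < e -> (forall i, enorm (c 0 i - c' 0 i) <= e) ->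
  cvol c <= (1 + e) ^+ d * cvol c'.
Proof.
move=> ep he; have e0 := ltW ep; have en0 := lt0r_neq0 ep.
pose s := (1 + e)^-1.
have e1 : 0 < 1 + e by rewrite ltr_pwDl.
have s0 : 0 < s by rewrite invr_gt0.
have s1 : s <= 1 by rewrite invf_le1// lerDl.
have bK : borel (outer (pts c')) by apply: borel_outer; exact: finite_pts.
have uM : s%:M \in @unitmx R d.
  by rewrite unitmxE det_scalar unitfE expf_neq0// gt_eqF.
have V := unitmx_linear_law uM bK.
rewrite det_scalar normrX gtr0_norm// -exprVn invrK in V.
suff : (vol (outer (pts c)) <= ((1 + e) ^+ d)%:E * vol (outer (pts c')))%E.
  move=> h; have := fine_le (fin_vol_outer (finite_pts c)) _ h.
  rewrite fineM ?fin_vol_outer//; last exact: finite_pts.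
  by apply; rewrite fin_numM// fin_vol_outer//; exact: finite_pts.
rewrite -V; apply: le_vol.
- by apply: borel_outer; exact: finite_pts.
- exact: borel_mulmx.
have h0 : convex_hull (pts c') 0 by apply: sub_hull; left.
pose A : set E := [set u | exists p b, [/\ convex_hull (pts c') p, unit_ball b & u = p + e *: b]].
have hA : convex_hull (pts c) `<=` A.
  apply: hull_min.
    move=> _ _ t t01 [p [b [hp hb ->]]] [q [b' [hq hb' ->]]].
    exists (t *: p + (1 - t) *: q), (t *: b + (1 - t) *: b'); split.
    - exact: hull_convex.
    - exact: convex_unit_ball.
    - by rewrite !scalerDr addrACA !scalerA ![e * _]mulrC.
  move=> u [->|[i _ <-]].
    exists 0, 0; split => //; last by rewrite scaler0 addr0.
    by rewrite /unit_ball /= enorm0 ler01.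
  exists (c' 0 i), (e^-1 *: (c 0 i - c' 0 i)); split.
  - by apply: sub_hull; right; exists i.
  - rewrite /unit_ball /= enormZ normrV ?unitfE// ger0_norm//.
    by rewrite ler_pdivrMl ?mulr1.
  - by rewrite scalerA mulfV// scale1r addrC subrK.
move=> u [q /hA[p [b [hp hb ->]]] [b' hb' <-]] /=.
exists (s *: p).
  rewrite -[s *: p]addr0 -(scaler0 _ (1 - s)); apply: hull_convex => //.
  by rewrite s1 ltW.
exists (s *: (e *: b + b')).
  rewrite /unit_ball /= enormZ gtr0_norm// ler_pdivrMl// mulr1.
  rewrite (le_trans (ler_enormD _ _))// enormZ ger0_norm// addrC lerD//.
  by rewrite -[leRHS]mulr1 ler_wpM2l.
by rewrite mul_mx_scalar -scalerDr addrA.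
Qed.

Lemma continuous_entry (i : 'I_m.+1) : continuous (fun c : conf => c 0 i).
Proof.
move=> c U cU; exists (fun k l => if l == i then U else setT).
  by move=> k l; case: eqP => [->|_]; [rewrite ord1|exact: filterT].
by move=> c' /= h; have := h 0 i; rewrite eqxx.
Qed.

(** Apply [cvol_le] in both directions. *)
Lemma continuous_cvol : continuous cvol.
Proof.
move=> c U /nbhs_ballP[eps' /= eps'0 hU].
have [eps eps0 eps1] : exists2 eps, 0 < eps & eps < eps' by exists (eps' / 2); lra.
set V := cvol c.
have V0 : 0 <= V := cvol_ge0 c.
have [e [e0 e1 heps]] : exists e, [/\ 0 < e, e <= 1 &
    ((1 + e) ^+ d - 1) * (1 + e) ^+ d * V <= eps].
  pose f (e : R) := ((1 + e) ^+ d - 1) * (1 + e) ^+ d * V.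
  have cp : {for 0, continuous (fun e : R => (1 + e) ^+ d)}.
    apply: (@cvg_comp _ _ _ (fun e => 1 + e) (fun e => e ^+ d)); last exact: exprn_continuous.
    by apply: cvgD; [exact: cvg_cst|exact: cvg_id].
  have cf : {for 0, continuous f}.
    apply: cvgM; last exact: cvg_cst.
    by apply: cvgM => //; apply: cvgB => //; exact: cvg_cst.
  have f0 : f 0 = 0 by rewrite /f addr0 expr1n subrr !mul0r.
  have /cvgrPdist_le/(_ eps eps0) := cf; rewrite f0 => /nbhs_ballP[r /= r0 hr].
  exists (Num.min (r / 2) 1); split; first by rewrite lt_min divr_gt0// ltr01.
    by rewrite ge_min lexx orbT.
  have := hr (Num.min (r / 2) 1); rewrite /ball /= !sub0r !normrN => h.
  have m0 : 0 < Num.min (r / 2) 1 by rewrite lt_min divr_gt0// ltr01.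
  apply: le_trans (ler_norm _) (h _); rewrite gtr0_norm//.
  by rewrite gt_min; apply/orP; left; lra.
have : nbhs c [set c' : conf | forall i, enorm (c' 0 i - c 0 i) < e].
  apply: (filter_forall (nbhs_filter c)) => i.
  have cn : {for c 0 i, continuous (fun u : E => enorm (u - c 0 i))}.
    apply: (@cvg_comp _ _ _ (fun u : E => u - c 0 i) (@enorm R d)).
      by apply: continuousDc.
    exact: continuous_enorm.
  apply: (@continuous_entry i c [set u | enorm (u - c 0 i) < e]).
  have := cn [set t | t < e]; apply; rewrite subrr enorm0.
  by apply: open_nbhs_nbhs; split; [exact: open_lt|].
apply: filterS => c' hc'; apply: hU; rewrite /ball /= -/V; apply: le_lt_trans eps1.
have le1 : cvol c' <= (1 + e) ^+ d * V by apply: cvol_le; [by []|move=> i; exact: ltW].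
have le2 : V <= (1 + e) ^+ d * cvol c'.
  by apply: cvol_le; [by []|move=> i; rewrite -enormN opprB; exact: ltW].
have a1 : 1 <= (1 + e) ^+ d by rewrite exprn_ege1// lerDl ltW.
move: le1 le2 heps a1; move: (cvol c') ((1 + e) ^+ d) => W a le1 le2 heps a1.
have b1 : 0 <= (a - 1) * V by rewrite mulr_ge0// subr_ge0.
have b2 : 0 <= (a - 1) * V * (a - 1) by rewrite mulr_ge0// subr_ge0.
have b3 : (a - 1) * W <= (a - 1) * (a * V) by rewrite ler_wpM2l// subr_ge0.
rewrite ler_norml; apply/andP; split; lra.
Qed.

(** Configurations with first point 0, bounded by M and with distances at least 2:
    a compact set. *)
Definition spread_conf (M : R) : set conf :=
  [set c | [/\ c 0 ord0 = 0, (forall i, enorm (c 0 i) <= M) &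
            (forall i j, i != j -> 2 <= enorm (c 0 i - c 0 j))]].

Lemma compact_spread_conf M : compact (spread_conf M).
Proof.
have ->: spread_conf M =
    [set c : conf | forall i, [set u : E | enorm u <= M] (c 0 i)] `&`
    ([set c : conf | enorm (c 0 ord0) <= 0] `&`
    \bigcap_(p in [set p : 'I_m.+1 * 'I_m.+1 | p.1 != p.2])
      [set c : conf | 2 <= enorm (c 0 p.1 - c 0 p.2)]).
  apply/seteqP; split => c /=.
    move=> [c0 cM cd]; split => //; split; first by rewrite c0 enorm0.
    by move=> [i j] /= ij; exact: cd.
  move=> [cM [c0 cd]]; split => //.
    by apply: enorm_eq0; apply/eqP; rewrite eq_le c0 enorm_ge0.
  by move=> i j ij; exact: (cd (i, j)).
have cen (f : conf -> E) : continuous f -> continuous (fun c => enorm (f c)).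
  move=> cf c; apply: (@cvg_comp _ _ _ f (@enorm R d)); first exact: cf.
  exact: continuous_enorm.
apply: compact_closedI.
  apply: (@rV_compact E _ (fun _ => [set u : E | enorm u <= M])) => _.
  apply: bounded_closed_compact; last first.
    by apply: closed_le_cont; [exact: continuous_enorm|exact: cst_continuous].
  exists M; split; first exact: num_real.
  move=> M' MM' u /= uM; rewrite /Num.Def.normr /= mx_normrE.
  apply: bigmax_le; first by rewrite (le_trans (enorm_ge0 u))// (le_trans uM)// ltW.
  by move=> [i j] _ /=; rewrite ord1 (le_trans (coord_le_enorm u j))// (le_trans uM)// ltW.
apply: closedI.
  apply: closed_le_cont; last exact: cst_continuous.
  by apply: (cen (fun c => c 0 ord0)); exact: continuous_entry.
apply: closed_bigI => p _; apply: closed_le_cont; first exact: cst_continuous.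
apply: (cen (fun c : conf => c 0 p.1 - c 0 p.2)).
by apply: continuous_sub; exact: continuous_entry.
Qed.

Lemma cvol_min M : spread_conf M !=set0 ->
  exists2 c, spread_conf M c & forall c', spread_conf M c' -> cvol c <= cvol c'.
Proof.
move=> c0; have [c|c hc cmin] := @compact_EVT_min _ R cvol _ c0 (@compact_spread_conf M).
  by apply: continuous_subspaceT; exact: continuous_cvol.
exists c; first by rewrite inE in hc.
by move=> c' hc'; apply: cmin; rewrite inE.
Qed.
End config.
End Existence.

(** * Existence of a best packing *)

Section Best.
Variable R : realType.
Variable d : nat.
Local Notation E := 'rV[R]_d.+1.
Implicit Types (x y z : E) (A C : set E).

Lemma fin_vol_ball k : vol (@sqball R k 1) \is a fin_num.
Proof.
rewrite ge0_fin_numE ?vol_ge0//; apply: (@vol_bounded R k _ 1).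
  by apply: borel_closed; exact: closed_sqball.
by move=> u; rewrite -unit_ballE.
Qed.

Definition crossvol : R := fine (vol (@sqball R d 1)).

Lemma outer_length C p q : finite_set C -> C p -> C q ->
  enorm (q - p) * crossvol <= fine (vol (outer C)).
Proof.
move=> fC Cp Cq; have h := vol_outer_ge (borel_outer fC) Cp Cq.
rewrite -lee_fin fineK ?fin_vol_outer// EFinM fineK//; exact: fin_vol_ball.
Qed.

Lemma packings_finite C n : packings n C -> finite_set C.
Proof. by move=> [_ cC]; apply/finite_setP; exists n. Qed.

Lemma outer_pos C m : 0 < crossvol -> packings m.+2 C -> 0 < fine (vol (outer C)).
Proof.
move=> v0 pC; have [hC cC] := pC; have [s [si sC]] := card_enum cC.
have Cs i : C (s i) by rewrite sC; exists i.
have ne : s ord0 != s ord_max by apply/eqP => /si.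
have := outer_length (packings_finite pC) (Cs ord_max) (Cs ord0).
apply: lt_le_trans; rewrite mulr_gt0//.
by apply: lt_le_trans (packing_dist hC (Cs ord0) (Cs ord_max) ne).
Qed.

Lemma density_le C C' m : 0 < crossvol -> packings m.+2 C -> packings m.+2 C' ->
  fine (vol (outer C)) <= fine (vol (outer C')) -> density m.+2 C' <= density m.+2 C.
Proof.
move=> v0 pC pC' h; rewrite /density -!/(outer _) ler_wpM2l//.
  by rewrite mulr_ge0// fine_ge0// vol_ge0.
by rewrite lef_pV2 ?posrE ?(outer_pos v0 pC) ?(outer_pos v0 pC').
Qed.

Lemma pts_range m (c : 'rV[E]_m.+1) : c 0 ord0 = 0 -> pts c = range (c 0).
Proof.
move=> c0; apply/seteqP; split => [x [->|//]|x hx]; first by exists ord0.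
by right.
Qed.

Lemma packings_conf m C : packings m.+1 C -> exists c : 'rV[E]_m.+1,
  [/\ c 0 ord0 = 0, (forall i j, i != j -> 2 <= enorm (c 0 i - c 0 j)) &
      cvol c = fine (vol (outer C))].
Proof.
move=> pC; have [hC cC] := pC; have [s [si sC]] := card_enum cC.
have Cs i : C (s i) by rewrite sC; exists i.
exists (\row_i (s i - s ord0)); split.
- by rewrite mxE subrr.
- move=> i j ij; rewrite !mxE opprB addrA subrK.
  by apply: (packing_dist hC) => //; apply/eqP => /si/eqP; exact/negP.
rewrite /cvol pts_range ?mxE ?subrr// -(vol_outer_translate (- s ord0) (packings_finite pC)).
congr (fine (vol (outer _))); apply/seteqP; split => x.
  by move=> [i _ <-]; exists (s i) => //; rewrite mxE.
by move=> [y]; rewrite {1}sC => -[i _ <-] <-; exists i => //; rewrite mxE.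
Qed.

Lemma conf_packings m (c : 'rV[E]_m.+1) :
  (forall i j, i != j -> 2 <= enorm (c 0 i - c 0 j)) -> packings m.+1 (range (c 0)).
Proof.
move=> h; have ci : injective (c 0).
  move=> i j cij; apply/eqP; apply/negPn/negP => /h.
  by rewrite cij subrr enorm0; apply/negP; rewrite -ltNge.
split; last exact: (enum_card ci).
apply: dist_packing => _ _ [i _ <-] [j _ <-] ij; apply: h.
by apply: contra_neq ij => ->.
Qed.

(** Translate a packing so that it contains the origin.  If it reaches beyond radius M, the cylinder
    around a segment of length M already has more volume than a given packing; the
    others form a compact set on which the continuous volume attains its minimum. *)
Theorem best_packing_exists m : 0 < crossvol -> (@packings R d.+1 m.+2) !=set0 ->
  exists2 C : set E, best_packings m.+2 C &
    forall C', packings m.+2 C' -> fine (vol (outer C)) <= fine (vol (outer C')).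
Proof.
move=> v0 [C0 pC0].
have [c0 [c00 c0d _]] := packings_conf pC0.
(* large enough to contain c0 and to make a cylinder of length M bigger than c0 *)
pose M := \sum_i enorm (c0 0 i) + cvol c0 / crossvol.
have q0 : 0 <= cvol c0 / crossvol by rewrite divr_ge0 ?cvol_ge0// ltW.
have c0M : spread_conf M c0.
  split => // i; rewrite /M (bigD1 i)//= -addrA lerDl addr_ge0//.
  by apply: sumr_ge0 => j _; exact: enorm_ge0.
have [c [cc0 cM cd] cmin] := @cvol_min R d.+1 m.+1 M (ex_intro _ _ c0M).
have pc := conf_packings cd.
suff H C' : packings m.+2 C' -> fine (vol (outer (range (c 0)))) <= fine (vol (outer C')).
  exists (range (c 0)) => //; split => // C' pC'.
  by apply: density_le => //; exact: H.
move=> pC'; rewrite -(pts_range cc0) -/(cvol c).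
have [c' [c'0 c'd <-]] := packings_conf pC'.
have [h|/existsNP[i hi]] := pselect (forall i, enorm (c' 0 i) <= M); first exact: cmin.
have {}hi : M < enorm (c' 0 i) by rewrite ltNge; exact/negP.
apply: (le_trans (cmin _ c0M)).
have h0 : pts c' 0 by left.
have hci : pts c' (c' 0 i) by right; exists i.
apply: le_trans (outer_length (finite_pts c') h0 hci); rewrite subr0.
rewrite -ler_pdivrMr// (le_trans _ (ltW hi))// /M lerDr.
by apply: sumr_ge0 => j _; exact: enorm_ge0.
Qed.
End Best.

(** * Four-dimensional cells given by linear forms *)

Section Four.
Variable R : realType.
Local Notation E := 'rV[R]_4.

(** The Laplace expansion, for entries indexed by natural numbers so that explicit
    matrices can be given by pattern matching. *)
Lemma det4 (f : nat -> nat -> R) : \det (\matrix_(i < 4, j < 4) f i j) =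
  f 0 0 * (f 1 1 * (f 2 2 * f 3 3 - f 2 3 * f 3 2) - f 1 2 * (f 2 1 * f 3 3 - f 2 3 * f 3 1)
           + f 1 3 * (f 2 1 * f 3 2 - f 2 2 * f 3 1))
- f 0 1 * (f 1 0 * (f 2 2 * f 3 3 - f 2 3 * f 3 2) - f 1 2 * (f 2 0 * f 3 3 - f 2 3 * f 3 0)
           + f 1 3 * (f 2 0 * f 3 2 - f 2 2 * f 3 0))
+ f 0 2 * (f 1 0 * (f 2 1 * f 3 3 - f 2 3 * f 3 1) - f 1 1 * (f 2 0 * f 3 3 - f 2 3 * f 3 0)
           + f 1 3 * (f 2 0 * f 3 1 - f 2 1 * f 3 0))
- f 0 3 * (f 1 0 * (f 2 1 * f 3 2 - f 2 2 * f 3 1) - f 1 1 * (f 2 0 * f 3 2 - f 2 2 * f 3 0)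
           + f 1 2 * (f 2 0 * f 3 1 - f 2 1 * f 3 0)).
Proof.
do 3 rewrite !(expand_det_row _ 0) !big_ord_recl !big_ord0 /cofactor.
rewrite !det_mx11 !mxE /= /bump /= !addn0 !add0n !add1n.
rewrite !exprS !expr0 !mulr1 !mulrNN !mulr1 !mulN1r !mul1r !addr0.
ring.
Qed.

Definition o0 : 'I_4 := @Ordinal 4 0 isT.
Definition o1 : 'I_4 := @Ordinal 4 1 isT.
Definition o2 : 'I_4 := @Ordinal 4 2 isT.
Definition o3 : 'I_4 := @Ordinal 4 3 isT.

Lemma sum4 (V : nmodType) (F : 'I_4 -> V) : \sum_i F i = F o0 + F o1 + F o2 + F o3.
Proof.
rewrite !big_ord_recl big_ord0 addr0 !addrA.
by congr (F _ + F _ + F _ + F _); exact: val_inj.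
Qed.

Lemma all4 (P : 'I_4 -> Prop) : (forall i, P i) <-> [/\ P o0, P o1, P o2 & P o3].
Proof.
split=> [h|[p0 p1 p2 p3] [[|[|[|[|//]]]] hi]]; first by split.
- by rewrite (_ : Ordinal hi = o0)//; exact: val_inj.
- by rewrite (_ : Ordinal hi = o1)//; exact: val_inj.
- by rewrite (_ : Ordinal hi = o2)//; exact: val_inj.
- by rewrite (_ : Ordinal hi = o3)//; exact: val_inj.
Qed.

Definition coord_set (P : R -> R -> R -> R -> Prop) : set E :=
  [set y | P (y 0 o0) (y 0 o1) (y 0 o2) (y 0 o3)].

Definition affine_form (f : nat -> nat -> R) (b : nat -> R) (j : nat) (x y z t : R) : R :=
  x * f 0 j + y * f 1 j + z * f 2 j + t * f 3 j + b j.

Definition bisimplex s t : set E :=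
  [set w | simplex s (lsubmx (w : 'rV_(2 + 2))) /\ simplex t (rsubmx (w : 'rV_(2 + 2)))].

Lemma closed_bisimplex s t : closed (bisimplex s t).
Proof.
apply: closedI.
  apply: (@closed_comp _ _ (fun w : E => lsubmx (w : 'rV_(2 + 2)))); last exact: closed_simplex.
  by move=> w _; exact: continuous_lsub.
apply: (@closed_comp _ _ (fun w : E => rsubmx (w : 'rV_(2 + 2)))); last exact: closed_simplex.
by move=> w _; exact: continuous_rsub.
Qed.

Lemma vol_bisimplex s t : 0 <= s -> 0 <= t ->
  vol (bisimplex s t) = (s ^+ 2 / 2 * (t ^+ 2 / 2))%:E.
Proof.
move=> s0 t0; rewrite (@vol_prod R 2 2); last by apply: borel_closed; exact: closed_simplex.
by rewrite !vol_simplex// -EFinM.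
Qed.

Lemma bisimplexP s t (w : E) : bisimplex s t w <->
  [/\ 0 <= w 0 o0, 0 <= w 0 o1 & w 0 o0 + w 0 o1 <= s] /\
  [/\ 0 <= w 0 o2, 0 <= w 0 o3 & w 0 o2 + w 0 o3 <= t].
Proof.
rewrite /bisimplex /simplex /= !big_ord_recl !big_ord0 !mxE !addr0.
have e0 : lshift 2 (0 : 'I_2) = o0 by exact: val_inj.
have e1 : lshift 2 (lift ord0 (ord0 : 'I_1)) = o1 by exact: val_inj.
have e2 : rshift 2 (0 : 'I_2) = o2 by exact: val_inj.
have e3 : rshift 2 (lift ord0 (ord0 : 'I_1)) = o3 by exact: val_inj.
rewrite e0 e1 e2 e3; split.
  move=> [[h1 h2] [h3 h4]]; split; split => //.
  - by have := h1 ord0; rewrite mxE e0.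
  - by have := h1 (lift ord0 ord0); rewrite mxE e1.
  - by have := h3 ord0; rewrite mxE e2.
  - by have := h3 (lift ord0 ord0); rewrite mxE e3.
have two (k : 'I_2) : k = ord0 \/ k = lift ord0 (ord0 : 'I_1).
  by case: k => [[|[|//]] hk]; [left|right]; exact: val_inj.
move=> [[a1 a2 a3] [b1 b2 b3]]; split; split => // k; rewrite mxE;
  by have [->|->] := two k; rewrite ?e0 ?e1 ?e2 ?e3.
Qed.

Section forms.
Variables (f : nat -> nat -> R) (b : nat -> R) (D : R).
Hypothesis detD : \det (\matrix_(i < 4, j < 4) f i j) = D.
Hypothesis D0 : D != 0.

Lemma formE (y : E) j : (y *m (\matrix_(i < 4, j < 4) f i j) + \row_(j < 4) b j) 0 j
  = affine_form f b j (y 0 o0) (y 0 o1) (y 0 o2) (y 0 o3).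
Proof. by rewrite !mxE sum4 !mxE. Qed.

Lemma borel_forms (X : set E) : borel X ->
  borel [set y : E | X (y *m (\matrix_(i < 4, j < 4) f i j) + \row_(j < 4) b j)].
Proof.
move=> bX; apply: (@borel_mulmx _ _ _ _ [set w | X (w + \row_(j < 4) b j)]).
by apply: (@borel_preimage _ _ _ (fun w : E => w + _)) bX; exact: continuousDc.
Qed.

Lemma vol_forms (X : set E) : borel X ->
  vol [set y : E | X (y *m (\matrix_(i < 4, j < 4) f i j) + \row_(j < 4) b j)] =
  ((`|D|^-1)%:E * vol X)%E.
Proof.
move=> bX; have uM : (\matrix_(i < 4, j < 4) f i j) \in unitmx.
  by rewrite unitmxE unitfE detD.
have bX' : borel [set w : E | X (w + \row_(j < 4) b j)].
  by apply: (@borel_preimage _ _ _ (fun w : E => w + _)) bX; exact: continuousDc.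
by rewrite (unitmx_linear_law uM bX') detD vol_preimageD.
Qed.

(** Four independent linear forms map the set onto a product of two triangles. *)
Lemma vol_biforms P s t : 0 <= s -> 0 <= t ->
  (forall x y z u, P x y z u <->
    [/\ 0 <= affine_form f b 0 x y z u, 0 <= affine_form f b 1 x y z u &
        affine_form f b 0 x y z u + affine_form f b 1 x y z u <= s] /\
    [/\ 0 <= affine_form f b 2 x y z u, 0 <= affine_form f b 3 x y z u &
        affine_form f b 2 x y z u + affine_form f b 3 x y z u <= t]) ->
  borel (coord_set P) /\ vol (coord_set P) = (`|D|^-1 * (s ^+ 2 / 2 * (t ^+ 2 / 2)))%:E.
Proof.
move=> s0 t0 PE; have bB : borel (bisimplex s t).
  by apply: borel_closed; exact: closed_bisimplex.
have -> : coord_set P = [set y : E | bisimplex s t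
    (y *m (\matrix_(i < 4, j < 4) f i j) + \row_(j < 4) b j)].
  by apply/seteqP; split => y /=; rewrite bisimplexP !formE => /PE.
split; first exact: borel_forms.
by rewrite vol_forms// vol_bisimplex// -EFinM.
Qed.
End forms.

(** A translated simplex. *)
Lemma vol_corner P s (b : nat -> R) : 0 <= s ->
  (forall x y z u, P x y z u <->
     [/\ 0 <= x + b 0%N, 0 <= y + b 1%N, 0 <= z + b 2%N & 0 <= u + b 3%N] /\
     (x + b 0%N) + (y + b 1%N) + (z + b 2%N) + (u + b 3%N) <= s) ->
  borel (coord_set P) /\ vol (coord_set P) = (s ^+ 4 / 24)%:E.
Proof.
move=> s0 PE; have bB : borel (@simplex R 4 s) by apply: borel_closed; exact: closed_simplex.
have -> : coord_set P = [set y : E | simplex s (y + \row_(j < 4) b j)].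
  apply/seteqP; split => y; rewrite /coord_set /simplex /= PE sum4 !mxE.
    by move=> [h ?]; split => //; apply/all4; rewrite !mxE.
  by move=> [/all4 + ?]; rewrite !mxE.
split; first by apply: (@borel_preimage _ _ _ (fun w : E => w + _)) bB; exact: continuousDc.
by rewrite vol_preimageD// vol_simplex.
Qed.

End Four.

(** * The cells cut off from the simplex: inequalities *)

Section Pieces.
Variable R : realType.
Local Notation E := 'rV[R]_4.
Implicit Types x y z u : R.

Definition cent : R := 1 / 100.
Definition mill : R := cent / 10.
Definition del : R := mill / 100.
(** The numbers pad_N are decimal upper bounds of sqrt (N / 2), the amount by which
    a linear form with squared norm N grows when a ball of radius 1 / sqrt 2 is
    added.  The walls of the slabs and wedges stand at pad1m, slightly below pad1,
    to separate them strictly from the corners. *)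
Definition pad1m : R := 70 * cent + 7 * mill + 10 * del.
Definition pad1 : R := pad1m + del.
(** An upper bound of 33 + sqrt 2. *)
Definition smax : R := 34 + 41 * cent + 4 * mill + 22 * del.
Definition pad3 : R := 1 + 22 * cent + 4 * mill + 75 * del.
Definition pad7 : R := 1 + 87 * cent + 83 * del.
Definition pad28 : R := 3 + 74 * cent + mill + 66 * del.
Notation hW := (smax - 33 - pad3).
Notation s0 := (smax - 33 - pad1m).
Notation c1 := (pad7 - 2 * pad1m).
Notation c2 := (pad28 - 5 * pad1m).
Notation H1 := (2 * (s0 - c1)).
Notation H2 := (s0 - del - c2).

(** Numerals stay below one hundred, and the decimals are atoms, because linear
    arithmetic on large unary numerals is slow. *)
Lemma pad_values : [/\ pad1 = pad1m + del, pad1m = 70 * cent + 7 * mill + 10 * del &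
    smax = 34 + 41 * cent + 4 * mill + 22 * del] /\
  [/\ pad3 = 1 + 22 * cent + 4 * mill + 75 * del, pad7 = 1 + 87 * cent + 83 * del &
      pad28 = 3 + 74 * cent + mill + 66 * del] /\
  [/\ 100 * cent = 1, 10 * mill = cent & 100 * del = mill].
Proof. by split=> //; split=> //; rewrite /del /mill /cent; split; lra. Qed.

(** The corner of the simplex beyond the wall x = a. *)
Definition corner_ineqs (a : R) x y z u : Prop :=
  [/\ 0 <= x - (a + pad1), 0 <= y, 0 <= z & 0 <= u] /\
  x - (a + pad1) + y + z + u <= smax - (a + pad1).

(** The intersection of the corners of two coordinates of half width 16: the walls are
    at 16 + sqrt (1/2), and 2 (16 + sqrt (1/2)) < 33 + sqrt 2. *)
Definition two_corner_ineqs x y z u : Prop :=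
  [/\ 0 <= x - (16 + pad1), 0 <= y - (16 + pad1), 0 <= z & 0 <= u] /\
  x - (16 + pad1) + (y - (16 + pad1)) + z + u <= smax - 2 * (16 + pad1).

(** Over a triangle in the depths of y and z below their walls, a triangle in x and the
    excess of y + z + w over 33 + pad3. *)
Definition slab_ineqs (D : R) x y z w : Prop :=
  [/\ 0 <= 16 + pad1m - y, 0 <= 16 + pad1m - z & (16 + pad1m - y) + (16 + pad1m - z) <= D] /\
  [/\ 0 <= x, 0 <= y + z + w - 33 - pad3 & x + (y + z + w - 33 - pad3) <= hW].

(** With f the depth of x below its wall and t the excess of y + z + u over 33 - a, the
    second conjunct says that (f, t) lies in the triangle bounded by the facet
    x + y + z + u = smax, the diagonal f + t = s0 and the line
    2 x + y + z + u = 33 + a + pad7.  The first conjunct keeps y and z above 1/5 and,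
    because t >= c1 in this triangle, u above e. *)
Definition upper_wedge_ineqs (a e : R) x y z u : Prop :=
  [/\ 0 <= y - 1 / 5, 0 <= z - 1 / 5 &
      y - 1 / 5 + (z - 1 / 5) <= 33 - a + c1 - (2 / 5 + e)] /\
  [/\ 0 <= 3 * (smax - x - y - z - u), 0 <= (a + pad1m - x) + (y + z + u - (33 - a)) - s0 &
      3 * (smax - x - y - z - u) + ((a + pad1m - x) + (y + z + u - (33 - a)) - s0) <= H1].

(** As for the upper wedge, with the triangle under the diagonal f + t = s0, bounded by
    f = 0 and the line 5 x + y + z + u = 33 + 4 a + pad28.  The shift by del keeps
    the two wedges apart. *)
Definition lower_wedge_ineqs (a e : R) x y z u : Prop :=
  [/\ 0 <= y - 1 / 5, 0 <= z - 1 / 5 &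
      y - 1 / 5 + (z - 1 / 5) <= 33 - a + c2 - (2 / 5 + e)] /\
  [/\ 0 <= 6 * (a + pad1m - x), 0 <= s0 - del - (a + pad1m - x) - (y + z + u - (33 - a)) &
      6 * (a + pad1m - x) + (s0 - del - (a + pad1m - x) - (y + z + u - (33 - a))) <= H2].

Definition simplex_ineqs x y z u : Prop :=
  [/\ 0 <= x, 0 <= y, 0 <= z & 0 <= u] /\ x + y + z + u <= smax.

Ltac split_and := repeat match goal with
  | H : _ /\ _ |- _ => destruct H
  | H : [/\ _, _ & _] |- _ => destruct H
  | H : [/\ _, _, _ & _] |- _ => destruct H end.
Ltac lin := intros; have := pad_values; intros; split_and;
  repeat split; try (match goal with |- is_true _ => idtac end; lra).

Lemma corner_in_simplex a x y z u : 0 <= a -> corner_ineqs a x y z u -> simplex_ineqs x y z u.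
Proof. rewrite /corner_ineqs /simplex_ineqs; lin. Qed.

Definition slab_levels a b c x y z u : Prop := x <= 19 * cent + 5 * mill /\
  [/\ 1 / 5 <= y, 1 / 5 <= z & 1 / 5 <= u] /\ [/\ y <= a + pad1m, z <= b + pad1m & u <= c + pad1m].

(** The levels recorded here and in the next lemmas are what separates the cells: every
    coordinate of a point of a cell is close to 0, in the middle, just below its wall,
    or beyond its wall. *)
Lemma slab_facts_123 x y z u : slab_ineqs (33 / 2) x y z u -> [/\ simplex_ineqs x y z u, 33 + pad3 <= y + z + u &
  slab_levels 16 16 19 x y z u].
Proof. rewrite /slab_ineqs /simplex_ineqs /slab_levels; lin. Qed.

Lemma slab_facts_4 x y z u : slab_ineqs (48 + 3 * pad1m - smax) u x y z -> [/\ simplex_ineqs u x y z, 33 + pad3 <= x + y + z &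
  slab_levels 16 16 16 u x y z].
Proof. rewrite /slab_ineqs /simplex_ineqs /slab_levels; lin. Qed.

Definition wedge_levels a b c d x y z u : Prop := a + 45 * cent <= x <= a + pad1m /\
  [/\ 1 / 5 <= y, 1 / 5 <= z & 1 / 5 <= u] /\ 
  [/\ y <= b + 40 * cent, z <= c + 40 * cent & u <= d + 40 * cent].

Lemma upper_wedge_facts_123 x y z u : upper_wedge_ineqs 16 (13 / 10) x y z u -> [/\ simplex_ineqs x y z u, 49 + pad7 <= 2 * x + y + z + u,
  x + y + z + u - 2 * x + 32 + pad1m - 33 - s0 >= 0 &
  wedge_levels 16 16 16 19 x y z u].
Proof. rewrite /upper_wedge_ineqs /simplex_ineqs /wedge_levels; lin. Qed.

Lemma upper_wedge_facts_4 x y z u : upper_wedge_ineqs 19 (1 / 5) u x y z -> [/\ simplex_ineqs u x y z, 52 + pad7 <= 2 * u + x + y + z,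
  u + x + y + z - 2 * u + 38 + pad1m - 33 - s0 >= 0 &
  wedge_levels 19 16 16 16 u x y z].
Proof. rewrite /upper_wedge_ineqs /simplex_ineqs /wedge_levels; lin. Qed.

Lemma lower_wedge_facts_123 x y z u : lower_wedge_ineqs 16 (13 / 10) x y z u -> [/\ simplex_ineqs x y z u, 33 + 64 + pad28 <= 5 * x + y + z + u,
  x + y + z + u - 2 * x + 32 + pad1m - 33 - s0 < 0 &
  wedge_levels 16 16 16 19 x y z u].
Proof. rewrite /lower_wedge_ineqs /simplex_ineqs /wedge_levels; lin. Qed.

Lemma lower_wedge_facts_4 x y z u : lower_wedge_ineqs 19 (1 / 5) u x y z -> [/\ simplex_ineqs u x y z, 33 + 76 + pad28 <= 5 * u + x + y + z,
  u + x + y + z - 2 * u + 38 + pad1m - 33 - s0 < 0 &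
  wedge_levels 19 16 16 16 u x y z].
Proof. rewrite /lower_wedge_ineqs /simplex_ineqs /wedge_levels; lin. Qed.
End Pieces.

(** * Permuting coordinates and removing disjoint sets *)

Section Removal.
Variable R : realType.
Local Notation E := 'rV[R]_4.

(** The cell described by P with its distinguished first coordinate placed at i and
    the other coordinates in increasing order. *)
Definition along (i : 'I_4) (P : R -> R -> R -> R -> Prop) : set E :=
  coord_set (match val i with
      | 0 => P
      | 1 => fun x y z u => P y x z u
      | 2 => fun x y z u => P z x y u
      | _ => fun x y z u => P u x y z
      end).

Lemma vol_along i P : borel (coord_set P) -> borel (along i P) /\ vol (along i P) = vol (coord_set P).
Proof.
move=> bP.
pose t (j : nat) : nat := match val i, j with
  | 0, _ => j | 1, 0 => 1 | 1, 1 => 0 | 1, _ => j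
  | 2, 0 => 2 | 2, 1 => 0 | 2, 2 => 1 | 2, _ => j
  | _, 0 => 3 | _, 1 => 0 | _, 2 => 1 | _, _ => 2 end%N.
pose f (c j : nat) : R := if c == t j then 1 else 0.
pose D := \det (\matrix_(i < 4, j < 4) f i j).
have D1 : `|D| = 1.
  rewrite /D det4 /f /t; case: i {t f D} => [[|[|[|[|//]]]] hi] /=;
    by rewrite !(mulr0, mul0r, mulr1, subr0, sub0r, addr0, add0r, oppr0, mul1r, normrN, normr1).
have D0 : D != 0 by rewrite -normr_eq0 D1 oner_eq0.
have -> : along i P = [set y : E | coord_set P (y *m (\matrix_(i < 4, j < 4) f i j)
    + \row_(j < 4) (fun=> 0 : R) j)].
  rewrite /along /coord_set; apply/seteqP; split => y /=;
  rewrite !(formE f (fun=> 0)) /affine_form /f /t; case: i {t f D D1 D0} => [[|[|[|[|//]]]] hi] /=;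
    by rewrite !(mulr0, mulr1, addr0, add0r).
split; first exact: (@borel_forms _ f (fun=> 0)).
by rewrite (@vol_forms _ f (fun=> 0) D)// D1 invr1 mul1e.
Qed.

Lemma vol_diff (A B : set E) (a b : R) : borel A -> borel B -> (vol A = a%:E)%E ->
  (b%:E <= vol (A `&` B))%E -> (vol (A `\` B) <= (a - b)%:E)%E.
Proof.
move=> bA bB vA vB.
have bI := borelI bA bB; have bD := borelD bA bB.
have disj : A `&` B `&` (A `\` B) = set0.
  by apply/seteqP; split => y //= [[_ By] [_ /(_ By)]].
have dec : A = A `&` B `|` (A `\` B).
  apply/seteqP; split => y; last by move=> [[]|[]].
  by move=> Ay; have [By|] := pselect (B y); [left|right].
have := volU bI bD disj; rewrite -dec.
rewrite vA; have := vol_ge0 (A `\` B).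
case: (vol (A `\` B)) => [r| |]//; case: (vol (A `&` B)) vB => [q| |]//.
by rewrite !lee_fin => + _ [->] /=; lra.
Qed.

Lemma vol_diff_ge (A B : set E) (a b : R) : borel A -> borel B -> (a%:E <= vol A)%E ->
  (vol B = b%:E)%E -> ((a - b)%:E <= vol (A `\` B))%E.
Proof.
move=> bA bB vA vB.
have bI := borelI bA bB; have bD := borelD bA bB.
have disj : B `&` (A `\` B) = set0 by apply/seteqP; split => y //= [By [_ /(_ By)]].
have : (vol A <= vol (B `|` (A `\` B)))%E.
  apply: le_vol => //; first exact: borelU.
  by move=> y Ay; have [By|] := pselect (B y); [left|right].
rewrite (volU bB bD disj).
move=> /(le_trans vA); rewrite vB; have := vol_ge0 (A `\` B).
by case: (vol (A `\` B)) => [r| |]//=; rewrite ?leey// !lee_fin; lra.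
Qed.

(** Peeling the disjoint sets off one at a time. *)
Lemma vol_remove (I : eqType) (s : seq I) (F : I -> set E) (v : I -> R) (T : set E) (t : R) :
  uniq s -> borel T -> vol T = t%:E ->
  (forall i, i \in s -> borel (F i) /\ F i `<=` T) ->
  (forall i j, i \in s -> j \in s -> forall y, F i y -> F j y -> i = j) ->
  (forall i, i \in s -> (v i)%:E <= vol (F i))%E ->
  borel [set y | T y /\ forall i, i \in s -> ~ F i y] /\
  (vol [set y | T y /\ forall i, i \in s -> ~ F i y] <= (t - \sum_(i <- s) v i)%:E)%E.
Proof.
move=> + bT vT; elim: s => [|i s IH] /=.
  move=> _ _ _ _; rewrite big_nil subr0.
  by rewrite (_ : [set y | _] = T) ?vT//; apply/seteqP; split => y // [].
move=> /andP[is_ us] bF dF vF.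
have si j : j \in s -> j \in i :: s by move=> js; rewrite inE js orbT.
have [|||b le_] := IH us.
- by move=> j /si /bF.
- by move=> j k /si js /si ks; exact: dF.
- by move=> j /si /vF.
have [bFi FiT] := bF i (mem_head _ _).
set G := [set y | _] in b le_.
have -> : [set y | T y /\ (forall j, j \in i :: s -> ~ F j y)] = G `\` F i.
  apply/seteqP; split => y /=.
    by move=> [Ty h]; split; [split=> // j /si /h|apply: h; exact: mem_head].
  by move=> [[Ty h] Fi]; split=> // j; rewrite inE => /predU1P[->//|]; exact: h.
split; first exact: borelD.
have [r vG] : exists r, vol G = r%:E.
  have := vol_ge0 G; move: le_; case: (vol G) => [r| |]//; by exists r.
have IFi : G `&` F i = F i.
  apply/seteqP; split => y; first by case.
  move=> Fi; split=> //; split; first exact: FiT.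
  move=> j js Fj; have ij := dF i j (mem_head _ _) (si j js) y Fi Fj.
  by move: is_; rewrite ij js.
apply: (le_trans (@vol_diff _ _ r (v i) b bFi vG _)).
  by rewrite IFi; apply: vF; exact: mem_head.
by move: le_; rewrite vG big_cons !lee_fin; lra.
Qed.
End Removal.

(** * The sixteen cells are disjoint and avoid the polytope *)

Section Cells.
Variable R : realType.
Local Notation E := 'rV[R]_4.
Local Notation smax := (smax R).
Local Notation pad1 := (pad1 R).
Local Notation pad1m := (pad1m R).
Local Notation pad3 := (pad3 R).
Local Notation pad7 := (pad7 R).
Local Notation pad28 := (pad28 R).
Local Notation cent := (cent R).
Local Notation mill := (mill R).

(** The bounds of the coordinates in the cluster. *)
Definition halfwidth (i : 'I_4) : R := if val i == 3%N then 19 else 16.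
Definition coord_sum (y : E) : R := \sum_i y 0 i.

Definition in_polytope (y : E) : Prop :=
  [/\ (forall i, 0 <= y 0 i < halfwidth i + pad1),
      coord_sum y < smax,
      (forall i, coord_sum y - y 0 i < 33 + pad3),
      (forall i, coord_sum y + y 0 i < 33 + halfwidth i + pad7) &
      (forall i, coord_sum y + 4 * y 0 i < 33 + 4 * halfwidth i + pad28)].

(** One statement covering the four positions of the distinguished coordinate. *)
Lemma along_split i (y : E) : exists j k l, [/\
  (forall P, along i P y <-> P (y 0 i) (y 0 j) (y 0 k) (y 0 l)),
  coord_sum y = y 0 i + y 0 j + y 0 k + y 0 l,
  (forall m, m != i -> [\/ m = j, m = k | m = l]) &
  [/\ j != i, k != i & l != i] /\
  [/\ halfwidth j = 16, halfwidth k = 16 &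
      halfwidth i = 16 /\ halfwidth l = 19 \/ halfwidth i = 19 /\ halfwidth l = 16]].
Proof.
have A : forall m : 'I_4, [\/ m = o0, m = o1, m = o2 | m = o3].
  by move=> [[|[|[|[|//]]]] hm]; [constructor 1|constructor 2|constructor 3|constructor 4];
    exact: val_inj.
rewrite /coord_sum sum4 /halfwidth /along /coord_set.
case: (A i) => ->; [exists o1, o2, o3|exists o0, o2, o3|exists o0, o1, o3|exists o0, o1, o2];
  (split; [by []|by ring| |by split=> //; split=> //=; first [by left|by right]]);
  by move=> m; case: (A m) => ->//= _; by [constructor 1|constructor 2|constructor 3].
Qed.

Definition corner i : set E := along i (corner_ineqs (halfwidth i)).

(** Four kinds of cells, one of each for each coordinate: corners, slabs, upper
    and lower wedges.  The corners of the first three coordinates overlap, so each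
    one gives up its intersection with the preceding ones.  The triangle in a slab and the margin
    of a wedge depend on whether the long coordinate is the distinguished one. *)
Definition cell (k i : 'I_4) : set E :=
  match val k with
  | 0%N => match val i with
           | 1%N => corner o1 `\` corner o0
           | 2%N => corner o2 `\` corner o0 `\` corner o1
           | _ => corner i end
  | 1%N => along i (slab_ineqs (if val i == 3%N then 48 + 3 * pad1m - smax else 33 / 2))
  | 2%N => along i (upper_wedge_ineqs (halfwidth i) (if val i == 3%N then 1 / 5 else 13 / 10))
  | _ => along i (lower_wedge_ineqs (halfwidth i) (if val i == 3%N then 1 / 5 else 13 / 10))
  end.

Definition corner_profile i (y : E) : Prop :=
  halfwidth i + pad1 <= y 0 i /\ forall j : 'I_4, (j < i)%N -> y 0 j < halfwidth j + pad1.
Definition slab_profile i (y : E) : Prop := y 0 i <= 19 * cent + 5 * mill /\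
  forall j, j != i -> 1 / 5 <= y 0 j <= halfwidth j + pad1m.
Definition wedge_profile i (y : E) : Prop := halfwidth i + 45 * cent <= y 0 i <= halfwidth i + pad1m /\
  forall j, j != i -> 1 / 5 <= y 0 j <= halfwidth j + 40 * cent.
(** Nonnegative exactly above the diagonal that separates the two wedges. *)
Definition diagonal_side i (y : E) : R := coord_sum y - 2 * y 0 i + 2 * halfwidth i + pad1m - 33 - (smax - 33 - pad1m).

Definition profile (k i : 'I_4) (y : E) : Prop :=
  match val k with
  | 0%N => corner_profile i y
  | 1%N => slab_profile i y
  | 2%N => wedge_profile i y /\ 0 <= diagonal_side i y
  | _ => wedge_profile i y /\ diagonal_side i y < 0
  end.

(** The level of each coordinate determines the kind of the cell and its
    distinguished coordinate: only corners reach beyond a wall, only slabs come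
    close to 0, and wedges have one coordinate just below its wall. *)
Lemma profile_inj k i k' i' y : profile k i y -> profile k' i' y -> (k, i) = (k', i').
Proof.
have : [/\ pad1m < pad1, 19 * cent + 5 * mill < 1 / 5, 40 * cent < 45 * cent & 45 * cent < pad1m].
  by have [[? ? ?] [[? ? ?] [? ? ?]]] := pad_values R; split; lra.
move=> [r1 r2 r3 r4].
have CC a b : corner_profile a y -> corner_profile b y -> a = b.
  move=> [h1 h2] [h3 h4]; case: (ltngtP a b) => [ab|ba|/val_inj //].
    by have := h4 _ ab; rewrite ltNge h1.
  by have := h2 _ ba; rewrite ltNge h3.
have CW a b : corner_profile a y -> slab_profile b y -> False.
  move=> [h1 h2] [h3 h4]; have [ab|ab] := eqVneq a b.
    by move: h3; rewrite -ab; move: h1; rewrite /halfwidth; case: ifP => _; lra.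
  by have /andP[_] := h4 _ ab; lra.
have CE a b : corner_profile a y -> wedge_profile b y -> False.
  move=> [h1 h2] [/andP[h3 h5] h4]; have [ab|ab] := eqVneq a b.
    by move: h5; rewrite -ab; lra.
  by have /andP[_] := h4 _ ab; lra.
have WW a b : slab_profile a y -> slab_profile b y -> a = b.
  move=> [h1 h2] [h3 h4]; apply: contrapT => /eqP ab.
  by have /andP[+ _] := h4 _ ab; lra.
have WE a b : slab_profile a y -> wedge_profile b y -> False.
  move=> [h1 h2] [/andP[h3 h5] h4]; have [ab|ab] := eqVneq a b.
    by move: h3; rewrite -ab /halfwidth; case: ifP => _; lra.
  by have /andP[+ _] := h4 _ ab; lra.
have EE a b : wedge_profile a y -> wedge_profile b y -> a = b.
  move=> [/andP[h1 h6] h2] [/andP[h3 h5] h4]; apply: contrapT => /eqP ab.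
  by have /andP[_ +] := h4 _ ab; lra.
case: k => [[|[|[|[|//]]]] hk]; case: k' => [[|[|[|[|//]]]] hk']; rewrite /profile /=;
  (try (rewrite (_ : hk = hk'); last exact: bool_irrelevance)).
- by move=> h /(CC _ _ h) ->.
- by move=> h /(CW _ _ h).
- by move=> h [/(CE _ _ h)].
- by move=> h [/(CE _ _ h)].
- by move=> h h'; have := CW _ _ h' h.
- by move=> h /(WW _ _ h) ->.
- by move=> h [/(WE _ _ h)].
- by move=> h [/(WE _ _ h)].
- by move=> [h _] h'; have := CE _ _ h' h.
- by move=> [h _] h'; have := WE _ _ h' h.
- by move=> [h _] [h' _]; rewrite (EE _ _ h h').
- by move=> [h +] [h' +]; rewrite (EE _ _ h h') ltNge => ->.
- by move=> [h _] h'; have := CE _ _ h' h.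
- by move=> [h _] h'; have := WE _ _ h' h.
- by move=> [h +] [h' +]; rewrite (EE _ _ h h') ltNge => /negP.
- by move=> [h _] [h' _]; rewrite (EE _ _ h h').
Qed.

Definition big_simplex : set E := simplex smax.

Lemma big_simplexP y : big_simplex y <-> (forall i, 0 <= y 0 i) /\ coord_sum y <= smax.
Proof. by []. Qed.

Lemma split_big_simplex i y j k l : coord_sum y = y 0 i + y 0 j + y 0 k + y 0 l ->
  (forall m, m != i -> [\/ m = j, m = k | m = l]) ->
  big_simplex y <-> simplex_ineqs (y 0 i) (y 0 j) (y 0 k) (y 0 l).
Proof.
move=> hs hm; rewrite big_simplexP /simplex_ineqs -hs; split=> [[h1 h2]|[[p1 p2 p3 p4] p5]]; first by split.
split=> // m; have [->//|/hm [->|->|->]//] := eqVneq m i.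
Qed.

Lemma cornerP i y : corner i y <-> big_simplex y /\ halfwidth i + pad1 <= y 0 i.
Proof.
have [j [k [l [hP hs hm _]]]] := along_split i y.
rewrite /corner hP (split_big_simplex hs hm).
have ha : 0 <= halfwidth i by rewrite /halfwidth; case: ifP => _; lra.
split=> [h|[[[p1 p2 p3 p4] p5] p6]].
  by split; [exact: (corner_in_simplex ha h)|case: h => [[+ _ _ _] _]; lra].
by split; [split|]; lra.
Qed.

Lemma cell_corner i y : cell o0 i y -> big_simplex y /\ corner_profile i y.
Proof.
have hl m : big_simplex y -> ~ corner m y -> y 0 m < halfwidth m + pad1.
  by move=> by_ h; rewrite ltNge; apply/negP => h'; apply: h; apply/cornerP.
have hj m : val m = 0%N -> m = o0 by move=> h; exact: val_inj.
have hj1 m : val m = 1%N -> m = o1 by move=> h; exact: val_inj.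
case: i => [[|[|[|[|//]]]] hi]; rewrite /cell /= cornerP.
- by move=> [bY h].
- rewrite (_ : Ordinal hi = o1); last exact: val_inj.
  move=> [[bY h] /(hl _ bY) h0]; split=> //; split=> // j.
  by rewrite ltnS leqn0 => /eqP/hj ->.
- rewrite (_ : Ordinal hi = o2); last exact: val_inj.
  move=> [[[bY h] /(hl _ bY) h0] /(hl _ bY) h1]; split=> //; split=> // j.
  by rewrite ltnS leq_eqVlt ltnS leqn0 => /orP[/eqP/hj1 ->|/eqP/hj ->].
- rewrite (_ : Ordinal hi = o3); last exact: val_inj.
  move=> [bY h]; split=> //; split=> // j j3.
  have [p s] := bY; have := s; rewrite sum4.
  have q0 := p o0; have q1 := p o1; have q2 := p o2.
  have [[c1 c2 c3] [_ [d1 d2 d3]]] := pad_values R.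
  have h' : 19 + pad1 <= y 0 o3 by [].
  have sj : 16 <= halfwidth j by rewrite /halfwidth; case: ifP => _; lra.
  case: j {sj} j3 sj => [[|[|[|//]]] hj'] _ sj.
  - by rewrite (_ : Ordinal hj' = o0) in sj *; [lra|exact: val_inj].
  - by rewrite (_ : Ordinal hj' = o1) in sj *; [lra|exact: val_inj].
  - by rewrite (_ : Ordinal hj' = o2) in sj *; [lra|exact: val_inj].
Qed.

Lemma halfwidth_cases i : (if val i == 3%N then halfwidth i = 19 else halfwidth i = 16).
Proof. by rewrite /halfwidth; case: (val i == 3%N). Qed.

Lemma cell_slab i y : cell o1 i y -> [/\ big_simplex y, 33 + pad3 <= coord_sum y - y 0 i & slab_profile i y].
Proof.
have [j [k [l [hP hs hm [_ [sj sk si]]]]]] := along_split i y.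
have bE := split_big_simplex hs hm; rewrite /cell /= hP.
have := halfwidth_cases i; case: ifP => _ e; rewrite e in si.
  have sl : halfwidth l = 16 by case: si => -[? ->] //; exfalso; lra.
  move=> /slab_facts_4 [bY h [p1 [[p2 p3 p4] [p5 p6 p7]]]]; move/bE: bY => bY.
  split=> //; first by rewrite hs; lra.
  by split=> // m /hm [->|->|->]; rewrite ?sj ?sk ?sl; apply/andP; split.
have sl : halfwidth l = 19 by case: si => -[? ->] //; exfalso; lra.
move=> /slab_facts_123 [bY h [p1 [[p2 p3 p4] [p5 p6 p7]]]]; move/bE: bY => bY.
split=> //; first by rewrite hs; lra.
by split=> // m /hm [->|->|->]; rewrite ?sj ?sk ?sl; apply/andP; split.
Qed.

Lemma cell_upper_wedge i y : cell o2 i y -> [/\ big_simplex y, 33 + halfwidth i + pad7 <= coord_sum y + y 0 i,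
  wedge_profile i y & 0 <= diagonal_side i y].
Proof.
have [j [k [l [hP hs hm [_ [sj sk si]]]]]] := along_split i y.
have bE := split_big_simplex hs hm; rewrite /cell /= hP /diagonal_side /wedge_profile.
have := halfwidth_cases i; case: ifP => _ e; rewrite e in si *.
  have sl : halfwidth l = 16 by case: si => -[? ->] //; exfalso; lra.
  move=> /upper_wedge_facts_4 [bY h h' [p1 [[p2 p3 p4] [p5 p6 p7]]]]; move/bE: bY => bY.
  split=> //; [by rewrite hs; lra| |by rewrite hs; lra].
  by split=> // m /hm [->|->|->]; rewrite ?sj ?sk ?sl; apply/andP; split.
have sl : halfwidth l = 19 by case: si => -[? ->] //; exfalso; lra.
move=> /upper_wedge_facts_123 [bY h h' [p1 [[p2 p3 p4] [p5 p6 p7]]]]; move/bE: bY => bY.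
split=> //; [by rewrite hs; lra| |by rewrite hs; lra].
by split=> // m /hm [->|->|->]; rewrite ?sj ?sk ?sl; apply/andP; split.
Qed.

Lemma cell_lower_wedge i y : cell o3 i y -> [/\ big_simplex y, 33 + 4 * halfwidth i + pad28 <= coord_sum y + 4 * y 0 i,
  wedge_profile i y & diagonal_side i y < 0].
Proof.
have [j [k [l [hP hs hm [_ [sj sk si]]]]]] := along_split i y.
have bE := split_big_simplex hs hm; rewrite /cell /= hP /diagonal_side /wedge_profile.
have := halfwidth_cases i; case: ifP => _ e; rewrite e in si *.
  have sl : halfwidth l = 16 by case: si => -[? ->] //; exfalso; lra.
  move=> /lower_wedge_facts_4 [bY h h' [p1 [[p2 p3 p4] [p5 p6 p7]]]]; move/bE: bY => bY.
  split=> //; [by rewrite hs; lra| |by rewrite hs; lra].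
  by split=> // m /hm [->|->|->]; rewrite ?sj ?sk ?sl; apply/andP; split.
have sl : halfwidth l = 19 by case: si => -[? ->] //; exfalso; lra.
move=> /lower_wedge_facts_123 [bY h h' [p1 [[p2 p3 p4] [p5 p6 p7]]]]; move/bE: bY => bY.
split=> //; [by rewrite hs; lra| |by rewrite hs; lra].
by split=> // m /hm [->|->|->]; rewrite ?sj ?sk ?sl; apply/andP; split.
Qed.

Lemma cell_props k i y : cell k i y -> [/\ big_simplex y, profile k i y & ~ in_polytope y].
Proof.
case: k => [[|[|[|[|//]]]] hk].
- rewrite (_ : Ordinal hk = o0) => [/cell_corner[bY h]|]; last exact: val_inj.
  split=> // -[h' _ _ _ _]; have /andP[_] := h' i; have [+ _] := h.
  by rewrite leNgt => /negP.
- rewrite (_ : Ordinal hk = o1) => [/cell_slab[bY h s]|]; last exact: val_inj.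
  by split=> // -[_ _ h' _ _]; have := h' i; rewrite ltNge h.
- rewrite (_ : Ordinal hk = o2) => [/cell_upper_wedge[bY h s s']|]; last exact: val_inj.
  by split=> // -[_ _ _ h' _]; have := h' i; rewrite ltNge h.
- rewrite (_ : Ordinal hk = o3) => [/cell_lower_wedge[bY h s s']|]; last exact: val_inj.
  by split=> // -[_ _ _ _ h']; have := h' i; rewrite ltNge h.
Qed.

End Cells.

(** * Volumes of the cells and the numerical estimate *)

Section Volumes.
Variable R : realType.
Local Notation E := 'rV[R]_4.
Local Notation smax := (smax R).
Local Notation pad1 := (pad1 R).
Local Notation pad1m := (pad1m R).
Local Notation pad3 := (pad3 R).
Local Notation pad7 := (pad7 R).
Local Notation pad28 := (pad28 R).
Local Notation del := (del R).
Notation hW := (smax - 33 - pad3).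
Notation s0 := (smax - 33 - pad1m).
Notation c1 := (pad7 - 2 * pad1m).
Notation c2 := (pad28 - 5 * pad1m).
Notation H1 := (2 * (s0 - c1)).
Notation H2 := (s0 - del - c2).

Lemma vol_slab (D : R) : 0 <= D -> borel (coord_set (slab_ineqs D)) /\
  vol (coord_set (slab_ineqs D)) = (D ^+ 2 / 2 * (hW ^+ 2 / 2))%:E.
Proof.
move=> D0.
pose f (c j : nat) : R := match c, j with
  | 1, 0 | 2, 1 => (-1)%R | 0, 2 | 1, 3 | 2, 3 | 3, 3 => (1)%R | _, _ => (0)%R end%N.
pose b (j : nat) : R := match j with
  | 0 | 1 => (16 + pad1m)%R | 2 => (0)%R | _ => (- 33 - pad3)%R end%N.
have d1 : \det (\matrix_(i < 4, j < 4) f i j) = 1.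
  by rewrite det4 /f /=; ring.
have n1 : (1 : R) != 0 by exact: oner_neq0.
have h0 : 0 <= hW by have [[? ? ?] [[? ? ?] [? ? ?]]] := pad_values R; lra.
have [|bS ->] := vol_biforms d1 n1 (P := slab_ineqs D) (b := b) D0 h0.
  move=> x y z u; rewrite /slab_ineqs /affine_form /f /b /=.
  have e0 : x * 0 + y * -1 + z * 0 + u * 0 + (16 + pad1m) = 16 + pad1m - y by ring.
  have e1 : x * 0 + y * 0 + z * -1 + u * 0 + (16 + pad1m) = 16 + pad1m - z by ring.
  have e2 : x * 1 + y * 0 + z * 0 + u * 0 + 0 = x by ring.
  have e3 : x * 0 + y * 1 + z * 1 + u * 1 + (- 33 - pad3) = y + z + u - 33 - pad3 by ring.
  by rewrite e0 e1 e2 e3.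
by rewrite normr1 invr1 mul1r.
Qed.

Lemma vol_upper_wedge (a e : R) : 0 <= 33 - a + c1 - (2 / 5 + e) -> borel (coord_set (upper_wedge_ineqs a e)) /\
  vol (coord_set (upper_wedge_ineqs a e)) = (6^-1 * ((33 - a + c1 - (2 / 5 + e)) ^+ 2 / 2 * (H1 ^+ 2 / 2)))%:E.
Proof.
move=> D0.
pose f (c j : nat) : R := match c, j with
  | 1, 0 | 2, 1 => (1)%R | _, 2 => (-3)%R | 0, 3 => (-1)%R | _, 3 => (1)%R | _, _ => (0)%R end%N.
pose b (j : nat) : R := match j with
  | 0 | 1 => (- (1 / 5))%R | 2 => (3 * smax)%R | _ => (a + pad1m - (33 - a) - s0)%R end%N.
have d1 : \det (\matrix_(i < 4, j < 4) f i j) = - 6.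
  by rewrite det4 /f /=; ring.
have n1 : (- 6 : R) != 0 by rewrite oppr_eq0 pnatr_eq0.
have h0 : 0 <= H1 by have [[? ? ?] [[? ? ?] [? ? ?]]] := pad_values R; lra.
have [|bS ->] := vol_biforms d1 n1 (P := upper_wedge_ineqs a e) (b := b) D0 h0.
  move=> x y z u; rewrite /upper_wedge_ineqs /affine_form /f /b /=.
  have e0 : x * 0 + y * 1 + z * 0 + u * 0 + - (1 / 5) = y - 1 / 5 by ring.
  have e1 : x * 0 + y * 0 + z * 1 + u * 0 + - (1 / 5) = z - 1 / 5 by ring.
  have e2 : x * -3 + y * -3 + z * -3 + u * -3 + 3 * smax = 3 * (smax - x - y - z - u) by ring.
  have e3 : x * -1 + y * 1 + z * 1 + u * 1 + (a + pad1m - (33 - a) - s0) =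
    (a + pad1m - x) + (y + z + u - (33 - a)) - s0 by ring.
  by rewrite e0 e1 e2 e3.
by rewrite normrN ger0_norm.
Qed.

Lemma vol_lower_wedge (a e : R) : 0 <= 33 - a + c2 - (2 / 5 + e) -> borel (coord_set (lower_wedge_ineqs a e)) /\
  vol (coord_set (lower_wedge_ineqs a e)) = (6^-1 * ((33 - a + c2 - (2 / 5 + e)) ^+ 2 / 2 * (H2 ^+ 2 / 2)))%:E.
Proof.
move=> D0.
pose f (c j : nat) : R := match c, j with
  | 1, 0 | 2, 1 => (1)%R | 0, 2 => (-6)%R | 0, 3 => (1)%R | _, 3 => (-1)%R | _, _ => (0)%R end%N.
pose b (j : nat) : R := match j with
  | 0 | 1 => (- (1 / 5))%R | 2 => (6 * (a + pad1m))%R | _ => (s0 - del - (a + pad1m) + (33 - a))%R end%N.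
have d1 : \det (\matrix_(i < 4, j < 4) f i j) = 6.
  by rewrite det4 /f /=; ring.
have n1 : (6 : R) != 0 by rewrite pnatr_eq0.
have h0 : 0 <= H2 by have [[? ? ?] [[? ? ?] [? ? ?]]] := pad_values R; lra.
have [|bS ->] := vol_biforms d1 n1 (P := lower_wedge_ineqs a e) (b := b) D0 h0.
  move=> x y z u; rewrite /lower_wedge_ineqs /affine_form /f /b /=.
  have e0 : x * 0 + y * 1 + z * 0 + u * 0 + - (1 / 5) = y - 1 / 5 by ring.
  have e1 : x * 0 + y * 0 + z * 1 + u * 0 + - (1 / 5) = z - 1 / 5 by ring.
  have e2 : x * -6 + y * 0 + z * 0 + u * 0 + 6 * (a + pad1m) = 6 * (a + pad1m - x) by ring.
  have e3 : x * 1 + y * -1 + z * -1 + u * -1 + (s0 - del - (a + pad1m) + (33 - a)) =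
    s0 - del - (a + pad1m - x) - (y + z + u - (33 - a)) by ring.
  by rewrite e0 e1 e2 e3.
by rewrite ger0_norm.
Qed.

Lemma vol_corner_ineqs (a : R) : 0 <= smax - (a + pad1) -> borel (coord_set (corner_ineqs a)) /\
  vol (coord_set (corner_ineqs a)) = ((smax - (a + pad1)) ^+ 4 / 24)%:E.
Proof.
move=> D0; pose b (j : nat) : R := if j is 0%N then - (a + pad1) else 0.
apply: (vol_corner (b := b) D0) => x y z u.
by rewrite /corner_ineqs /b !addr0.
Qed.

(** Lower bounds for the volumes of the cells: powers over factorials for simplices,
    areas of two triangles over the determinant for the others. *)
Definition cellvol (k i : 'I_4) : R :=
  match val k with
  | 0%N => match val i with
           | 0%N => (smax - (16 + pad1)) ^+ 4 / 24
           | 1%N => (smax - (16 + pad1)) ^+ 4 / 24 - (smax - 2 * (16 + pad1)) ^+ 4 / 24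
           | 2%N => (smax - (16 + pad1)) ^+ 4 / 24 - (smax - 2 * (16 + pad1)) ^+ 4 / 24
                     - (smax - 2 * (16 + pad1)) ^+ 4 / 24
           | _ => (smax - (19 + pad1)) ^+ 4 / 24 end
  | 1%N => if val i == 3%N then (48 + 3 * pad1m - smax) ^+ 2 / 2 * (hW ^+ 2 / 2)
           else (33 / 2) ^+ 2 / 2 * (hW ^+ 2 / 2)
  | 2%N => if val i == 3%N then 6^-1 * ((33 - 19 + c1 - (2 / 5 + 1 / 5)) ^+ 2 / 2 * (H1 ^+ 2 / 2))
           else 6^-1 * ((33 - 16 + c1 - (2 / 5 + 13 / 10)) ^+ 2 / 2 * (H1 ^+ 2 / 2))
  | _ => if val i == 3%N then 6^-1 * ((33 - 19 + c2 - (2 / 5 + 1 / 5)) ^+ 2 / 2 * (H2 ^+ 2 / 2))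
           else 6^-1 * ((33 - 16 + c2 - (2 / 5 + 13 / 10)) ^+ 2 / 2 * (H2 ^+ 2 / 2))
  end.

(** The two sides are about 2827356.1 and 2827375.1. *)
Lemma numerical_bound : 64 * (smax ^+ 4 / 24 - \sum_k \sum_i cellvol k i) <
  2 * (32 * 53 * 199 - 1) * (4 / 3 * (3 + 283 / (20 * 100))).
Proof.
rewrite !sum4 /cellvol /=.
have eS : smax = 34 + 41 / 100 + 4 / (10 * 100) + 22 / (1000 * 100).
  by have [[? ? ?] [[? ? ?] [? ? ?]]] := pad_values R; lra.
have er : pad1 = 70 / 100 + 7 / (1000) + 11 / (1000 * 100).
  by have [[? ? ?] [[? ? ?] [? ? ?]]] := pad_values R; lra.
have erm : pad1m = 70 / 100 + 7 / (1000) + 10 / (1000 * 100).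
  by have [[? ? ?] [[? ? ?] [? ? ?]]] := pad_values R; lra.
have ew : pad3 = 1 + 22 / 100 + 4 / 1000 + 75 / (1000 * 100).
  by have [[? ? ?] [[? ? ?] [? ? ?]]] := pad_values R; lra.
have e1 : pad7 = 1 + 87 / 100 + 83 / (1000 * 100).
  by have [[? ? ?] [[? ? ?] [? ? ?]]] := pad_values R; lra.
have e2 : pad28 = 3 + 74 / 100 + 1 / 1000 + 66 / (1000 * 100).
  by have [[? ? ?] [[? ? ?] [? ? ?]]] := pad_values R; lra.
have ed : del = 1 / (1000 * 100).
  by have [[? ? ?] [[? ? ?] [? ? ?]]] := pad_values R; lra.
rewrite eS er erm ew e1 e2 ed.
lra.
Qed.

End Volumes.

(** * Volume of what remains of the simplex *)

Section Region.
Variable R : realType.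
Local Notation E := 'rV[R]_4.
Local Notation smax := (smax R).
Local Notation pad1 := (pad1 R).
Local Notation pad1m := (pad1m R).

Lemma vol_corner_i i : borel (corner i : set E) /\
  vol (corner i : set E) = ((smax - (halfwidth R i + pad1)) ^+ 4 / 24)%:E.
Proof.
have h : 0 <= smax - (halfwidth R i + pad1).
  have [[? ? ?] [[? ? ?] [? ? ?]]] := pad_values R.
  by rewrite /halfwidth; case: (val i == 3%N); lra.
have [b v] := vol_corner_ineqs h; have [b' v'] := vol_along i b.
split; [exact: b'|exact: etrans v' v].
Qed.

(** Both sides describe a simplex translated along two coordinates. *)
Lemma corners10 : corner o1 `&` corner o0 = coord_set (fun x y z u : R => two_corner_ineqs x y z u).
Proof.
have [[e1 e2 e3] [_ [d1 d2 d3]]] := pad_values R.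
apply/seteqP; split => y.
  move=> [/cornerP[[p s] hi] /cornerP[_ hj]]; move: s; rewrite sum4 => s.
  have p0 := p o0; have p1 := p o1; have p2 := p o2; have p3 := p o3.
  have hi' : 16 + pad1 <= y 0 o1 by [].
  have hj' : 16 + pad1 <= y 0 o0 by [].
  by rewrite /coord_set /two_corner_ineqs /=; split; [split|]; lra.
rewrite /coord_set /two_corner_ineqs /= => -[[p1 p2 p3 p4] s].
have b : big_simplex y by rewrite big_simplexP /coord_sum sum4 all4; split; [split|]; lra.
by split; apply/cornerP; split=> //; [change (16 + pad1 <= y 0 o1)|change (16 + pad1 <= y 0 o0)]; lra.
Qed.

Lemma corners20 : corner o2 `&` corner o0 = coord_set (fun x y z u : R => two_corner_ineqs x z y u).
Proof.
have [[e1 e2 e3] [_ [d1 d2 d3]]] := pad_values R.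
apply/seteqP; split => y.
  move=> [/cornerP[[p s] hi] /cornerP[_ hj]]; move: s; rewrite sum4 => s.
  have p0 := p o0; have p1 := p o1; have p2 := p o2; have p3 := p o3.
  have hi' : 16 + pad1 <= y 0 o2 by [].
  have hj' : 16 + pad1 <= y 0 o0 by [].
  by rewrite /coord_set /two_corner_ineqs /=; split; [split|]; lra.
rewrite /coord_set /two_corner_ineqs /= => -[[p1 p2 p3 p4] s].
have b : big_simplex y by rewrite big_simplexP /coord_sum sum4 all4; split; [split|]; lra.
by split; apply/cornerP; split=> //; [change (16 + pad1 <= y 0 o2)|change (16 + pad1 <= y 0 o0)]; lra.
Qed.

Lemma corners21 : corner o2 `&` corner o1 = coord_set (fun x y z u : R => two_corner_ineqs y z x u).
Proof.
have [[e1 e2 e3] [_ [d1 d2 d3]]] := pad_values R.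
apply/seteqP; split => y.
  move=> [/cornerP[[p s] hi] /cornerP[_ hj]]; move: s; rewrite sum4 => s.
  have p0 := p o0; have p1 := p o1; have p2 := p o2; have p3 := p o3.
  have hi' : 16 + pad1 <= y 0 o2 by [].
  have hj' : 16 + pad1 <= y 0 o1 by [].
  by rewrite /coord_set /two_corner_ineqs /=; split; [split|]; lra.
rewrite /coord_set /two_corner_ineqs /= => -[[p1 p2 p3 p4] s].
have b : big_simplex y by rewrite big_simplexP /coord_sum sum4 all4; split; [split|]; lra.
by split; apply/cornerP; split=> //; [change (16 + pad1 <= y 0 o2)|change (16 + pad1 <= y 0 o1)]; lra.
Qed.

Local Notation overlap_vol := ((smax - 2 * (16 + pad1)) ^+ 4 / 24).

Lemma vol_two_corners (f : nat -> bool) P :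
  (forall x y z u, P x y z u <->
     [/\ 0 <= x + (if f 0%N then - (16 + pad1) else 0), 0 <= y + (if f 1%N then - (16 + pad1) else 0),
       0 <= z + (if f 2%N then - (16 + pad1) else 0) & 0 <= u + (if f 3%N then - (16 + pad1) else 0)] /\
     (x + (if f 0%N then - (16 + pad1) else 0)) + (y + (if f 1%N then - (16 + pad1) else 0))
      + (z + (if f 2%N then - (16 + pad1) else 0)) + (u + (if f 3%N then - (16 + pad1) else 0))
       <= smax - 2 * (16 + pad1)) ->
  borel (coord_set P) /\ vol (coord_set P) = overlap_vol%:E.
Proof.
have [[e1 e2 e3] [_ [d1 d2 d3]]] := pad_values R.
have D0 : 0 <= smax - 2 * (16 + pad1) by lra.
exact: (vol_corner (b := fun m => if f m then - (16 + pad1) else 0) D0).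
Qed.

Lemma vol_corners10 : borel (coord_set (fun x y z u : R => two_corner_ineqs x y z u)) /\
  vol (coord_set (fun x y z u : R => two_corner_ineqs x y z u)) = overlap_vol%:E.
Proof. by apply: (@vol_two_corners (fun n => match n with 0 | 1 => true | _ => false end)%N) => x y z u; rewrite /two_corner_ineqs /= !addr0. Qed.

Lemma vol_corners20 : borel (coord_set (fun x y z u : R => two_corner_ineqs x z y u)) /\
  vol (coord_set (fun x y z u : R => two_corner_ineqs x z y u)) = overlap_vol%:E.
Proof.
apply: (@vol_two_corners (fun n => match n with 0 | 2 => true | _ => false end)%N) => x y z u; rewrite /two_corner_ineqs /= !addr0.
by split=> -[[p1 p2 p3 p4] s]; (split; [split|]); lra.
Qed.

Lemma vol_corners21 : borel (coord_set (fun x y z u : R => two_corner_ineqs y z x u)) /\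
  vol (coord_set (fun x y z u : R => two_corner_ineqs y z x u)) = overlap_vol%:E.
Proof.
apply: (@vol_two_corners (fun n => match n with 1 | 2 => true | _ => false end)%N) => x y z u; rewrite /two_corner_ineqs /= !addr0.
by split=> -[[p1 p2 p3 p4] s]; (split; [split|]); lra.
Qed.

Lemma vol_along_ge i P (v : R) : borel (coord_set P) /\ vol (coord_set P) = v%:E ->
  borel (along i P) /\ (v%:E <= vol (along i P))%E.
Proof. move=> [/(vol_along i)[b e] v']; split; [exact: b|rewrite e v'; exact: lexx]. Qed.

Lemma corner_le (i : 'I_4) v : halfwidth R i = v -> borel (corner i : set E) /\
  (((smax - (v + pad1)) ^+ 4 / 24)%:E <= vol (corner i : set E))%E.
Proof. move=> <-; have [b e] := vol_corner_i i; split; [exact: b|rewrite e; exact: lexx]. Qed.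

Lemma vol_diff_inter_ge (A B C : set E) (a c : R) : borel A /\ (a%:E <= vol A)%E -> A `&` B `<=` C -> C `<=` B ->
  borel C /\ vol C = c%:E ->
  borel (A `\` B) /\ ((a - c)%:E <= vol (A `\` B))%E.
Proof.
move=> [bA vA] AB CB [bC vC].
have -> : A `\` B = A `\` C.
  apply/seteqP; split => y [Ay h]; split=> //; first by move=> /CB.
  by move=> By; apply: h; exact: AB.
by split; [exact: borelD|exact: vol_diff_ge].
Qed.

Lemma corner_cell_vol i : borel (cell o0 i : set E) /\ ((cellvol R o0 i)%:E <= vol (cell o0 i : set E))%E.
Proof.
have s1 : corner o1 `\` corner o0 `<=` (corner o1 : set E) by move=> y [].
case: i => [[|[|[|[|//]]]] hi].
- by rewrite /cell /cellvol [val _]/=; exact: corner_le.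
- rewrite /cell /cellvol [val _]/=; apply: vol_diff_inter_ge vol_corners10.
  + exact: corner_le.
  + by rewrite corners10.
  + by rewrite -corners10 => y [].
- rewrite /cell /cellvol [val _]/=; apply: vol_diff_inter_ge vol_corners21.
  + apply: vol_diff_inter_ge vol_corners20.
    * exact: corner_le.
    * by rewrite corners20.
    * by rewrite -corners20 => y [].
  + by rewrite -corners21 => y [[? _] ?].
  + by rewrite -corners21 => y [].
- by rewrite /cell /cellvol [val _]/=; exact: corner_le.
Qed.

Lemma cell_vol k i : borel (cell k i : set E) /\ ((cellvol R k i)%:E <= vol (cell k i : set E))%E.
Proof.
have [[e1 e2 e3] [[f1 f2 f3] [d1 d2 d3]]] := pad_values R.
case: k => [[|[|[|[|//]]]] hk].
- rewrite (_ : Ordinal hk = o0); last exact: val_inj.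
  exact: corner_cell_vol.
- rewrite /cell /cellvol [val _]/=; case: (val i == 3%N); apply: vol_along_ge; apply: vol_slab; lra.
- rewrite /cell /cellvol /halfwidth [val _]/=; case: (val i == 3%N); apply: vol_along_ge; apply: vol_upper_wedge; lra.
- rewrite /cell /cellvol /halfwidth [val _]/=; case: (val i == 3%N); apply: vol_along_ge; apply: vol_lower_wedge; lra.
Qed.

(** What is left of the simplex without the cells; unlike the polytope it is Borel with
    known volume by construction. *)
Definition region : set E := [set y | big_simplex y /\
  forall p : 'I_4 * 'I_4, p \in index_enum ('I_4 * 'I_4)%type -> ~ cell p.1 p.2 y].

Lemma region_borel_vol : borel region /\
  (vol region <= (smax ^+ 4 / 24 - \sum_k \sum_i cellvol R k i)%:E)%E.
Proof.
have [[e1 e2 e3] [_ [d1 d2 d3]]] := pad_values R.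
have S0 : 0 <= smax by lra.
rewrite pair_bigA /=.
apply: (@vol_remove _ _ _ (fun p : 'I_4 * 'I_4 => cell p.1 p.2) (fun p : 'I_4 * 'I_4 => cellvol R p.1 p.2)).
- exact: index_enum_uniq.
- by apply: borel_closed; exact: closed_simplex.
- by rewrite /big_simplex vol_simplex.
- move=> [k i] _; split; first by have [] := cell_vol k i.
  by move=> y /cell_props[].
- by move=> [k i] [k' i'] _ _ y /cell_props[_ h _] /cell_props[_ h' _]; exact: profile_inj h h'.
- by move=> [k i] _; have [] := cell_vol k i.
Qed.

Lemma polytope_region y : in_polytope y -> region y.
Proof.
move=> h; split; last by move=> [k i] _ /cell_props[_ _]; exact.
case: h => h1 h2 _ _ _; apply/big_simplexP; split; last exact: ltW.
by move=> i; have /andP[] := h1 i.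
Qed.

End Region.

(** * The outer body of the cluster *)

Section Cluster.
Variable R : realType.
Local Notation E := 'rV[R]_4.
Local Notation smax := (smax R).
Local Notation pad1 := (pad1 R).
Local Notation halfwidth := (halfwidth R).

(** The factor 1 / sqrt 2 that turns the cluster into integer points. *)
Definition half_root : R := Num.sqrt 2^-1.

Lemma half_root_gt0 : 0 < half_root.
Proof. by rewrite sqrtr_gt0 invr_gt0. Qed.

Lemma sqr_half_root : half_root ^+ 2 = 1 / 2.
Proof. by rewrite sqr_sqrtr ?invr_ge0// div1r. Qed.

Definition folded (x : E) : E := \row_i (half_root * `|x 0 i|).

(** The points whose folding satisfies the inequalities of the cluster; this is a convex set,
    hence contains the hull. *)
Definition admissible (x : E) : Prop :=
  (forall i, folded x 0 i <= halfwidth i) /\ coord_sum (folded x) <= 33.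

Lemma admissible_convex : convexP admissible.
Proof.
move=> x y t /andP[t0 t1] [hx sx] [hy sy].
have t1' : 0 <= 1 - t by rewrite subr_ge0.
have key i : folded (t *: x + (1 - t) *: y) 0 i <=
    t * folded x 0 i + (1 - t) * folded y 0 i.
  rewrite !mxE; apply: (@le_trans _ _ (half_root * (`|t * x 0 i| + `|(1 - t) * y 0 i|))).
    by rewrite ler_pM2l ?half_root_gt0// ler_normD.
  by rewrite !normrM (ger0_norm t0) (ger0_norm t1') le_eqVlt; apply/orP; left; apply/eqP; ring.
split.
  move=> i; apply: le_trans (key i) _; have := ler_wpM2l t0 (hx i).
  by have := ler_wpM2l t1' (hy i); lra.
apply: le_trans (ler_sum _ (fun i _ => key i)) _.
rewrite big_split /= -!mulr_sumr; rewrite -!/(coord_sum _).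
by have := ler_wpM2l t0 sx; have := ler_wpM2l t1' sy; lra.
Qed.

(** Cauchy-Schwarz: on a ball of radius 1 / sqrt 2 a linear form of squared norm N is
    at most sqrt (N / 2). *)
Lemma weight_le (w : 'I_4 -> R) (b : E) (N e : R) : enorm b <= 1 -> 0 <= e ->
  \sum_i w i ^+ 2 <= N -> N / 2 < e ^+ 2 -> \sum_i w i * folded b 0 i < e.
Proof.
move=> b1 e0 hN hNe.
pose W : E := \row_i w i.
have h := dot_le W (folded b).
have -> : \sum_i w i * folded b 0 i = \sum_i W 0 i * folded b 0 i.
  by apply: eq_bigr => i _; rewrite [W 0 i]mxE.
have W2 : enorm W ^+ 2 <= N.
  rewrite sqr_enorm; apply: le_trans hN.
  by rewrite /sqn; under eq_bigr do rewrite mxE.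
have A2 : enorm (folded b) ^+ 2 <= 1 / 2.
  rewrite sqr_enorm; have -> : sqn (folded b) = half_root ^+ 2 * sqn b.
    rewrite /sqn mulr_sumr; apply: eq_bigr => i _.
    by rewrite mxE exprMn real_normK ?num_real.
  rewrite sqr_half_root -sqr_enorm; have := enorm_ge0 b; nra.
apply: le_lt_trans h _.
rewrite -(ltr_pXn2r (n := 2)) ?nnegrE ?mulr_ge0 ?enorm_ge0// exprMn.
apply: le_lt_trans hNe.
apply: (@le_trans _ _ (N * (1 / 2))); last by lra.
by apply: ler_pM => //; exact: sqr_ge0.
Qed.

(** A folded point of the outer body is at most a folded point of the hull plus a
    folded vector of the ball; each weight is maximised on the two separately. *)
Lemma outer_in_polytope (C : set E) : C `<=` admissible -> forall u, outer C u -> in_polytope (folded u).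
Proof.
move=> CA u [x hx [b hb <-]].
have [px sx] := hull_min admissible_convex CA hx.
have [[e1 e2 e3] [[f1 f2 f3] [d1 d2 d3]]] := pad_values R.
have key i : 0 <= folded (x + b) 0 i <= folded x 0 i + folded b 0 i.
  rewrite !mxE; apply/andP; split; last by rewrite -mulrDr ler_pM2l ?half_root_gt0// ler_normD.
  by apply: mulr_ge0 => //; apply: ltW; exact: half_root_gt0.
have key1 i : folded (x + b) 0 i <= folded x 0 i + folded b 0 i by have /andP[] := key i.
have B (w : 'I_4 -> R) N e q : q = e -> 0 <= q -> \sum_i w i ^+ 2 <= N -> N / 2 < q ^+ 2 ->
    \sum_i w i * folded b 0 i < e by move=> <-; exact: weight_le.
have pick i (c : R) : \sum_j (if j == i then c else 1) * folded b 0 j =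
    coord_sum (folded b) + (c - 1) * folded b 0 i.
  rewrite /coord_sum (bigD1 i)//= [in RHS](bigD1 i)//= eqxx.
  have -> : \sum_(j < 4 | j != i) (if j == i then c else 1) * folded b 0 j =
     \sum_(j < 4 | j != i) folded b 0 j.
    by apply: eq_bigr => j /negPf ->; rewrite mul1r.
  by lra.
have norm i (c : R) : \sum_(j < 4) (if j == i then c else 1) ^+ 2 = c ^+ 2 + 3.
  rewrite (bigD1 i)//= eqxx.
  have -> : \sum_(j < 4 | j != i) (if j == i then c else 1) ^+ 2 = \sum_(j < 4 | j != i) (1 : R).
    by apply: eq_bigr => j /negPf ->; rewrite expr1n.
  by rewrite sumr_const cardC1 card_ord.
have sums : coord_sum (folded (x + b)) <= coord_sum (folded x) + coord_sum (folded b).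
  by rewrite /coord_sum -big_split; apply: ler_sum => i _; exact: key1.
have T1 : coord_sum (folded b) < smax - 33.
  have := pick o0 1; rewrite subrr mul0r addr0 => <-.
  by apply: (B _ (1 ^+ 2 + 3) _ (1 + 414 / 1000 + 22 / (1000 * 100))); [lra|lra|rewrite norm|lra].
have T2 i : coord_sum (folded b) - folded b 0 i < pad3 R.
  have -> : coord_sum (folded b) - folded b 0 i = coord_sum (folded b) + (0 - 1) * folded b 0 i by ring.
  rewrite -pick.
  by apply: (B _ (0 ^+ 2 + 3) _ (1 + 224 / 1000 + 75 / (1000 * 100))); [lra|lra|rewrite norm|lra].
have T3 i : coord_sum (folded b) + folded b 0 i < pad7 R.
  have -> : coord_sum (folded b) + folded b 0 i = coord_sum (folded b) + (2 - 1) * folded b 0 i by ring.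
  rewrite -pick.
  by apply: (B _ (2 ^+ 2 + 3) _ (1 + 870 / 1000 + 83 / (1000 * 100))); [lra|lra|rewrite norm|lra].
have T4 i : coord_sum (folded b) + 4 * folded b 0 i < pad28 R.
  have -> : coord_sum (folded b) + 4 * folded b 0 i = coord_sum (folded b) + (5 - 1) * folded b 0 i by ring.
  rewrite -pick.
  by apply: (B _ (5 ^+ 2 + 3) _ (3 + 741 / 1000 + 66 / (1000 * 100))); [lra|lra|rewrite norm|lra].
have T5 i : folded b 0 i < pad1.
  have -> : folded b 0 i = \sum_j (j == i)%:R * folded b 0 j.
    by rewrite (bigD1 i)//= eqxx mul1r big1 ?addr0// => j /negPf ->; rewrite mul0r.
  apply: (B _ 1 _ (707 / 1000 + 11 / (1000 * 100))); [lra|lra| |lra].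
  by rewrite (bigD1 i)//= eqxx expr1n big1 ?addr0// => j /negPf ->; rewrite expr0n.
have L i : coord_sum (folded (x + b)) - folded (x + b) 0 i <=
    (coord_sum (folded x) - folded x 0 i) + (coord_sum (folded b) - folded b 0 i).
  rewrite /coord_sum !(bigD1 (P := xpredT) i)//= ![_ + \sum_(_ | _) _ - _]addrAC !subrr !add0r -big_split.
  by apply: ler_sum => j _; exact: key1.
have px0 i : 0 <= folded x 0 i.
  by rewrite mxE; apply: mulr_ge0 => //; apply: ltW; exact: half_root_gt0.
split.
- by move=> i; have /andP[-> h] := key i; have := px i; have := T5 i; lra.
- by lra.
- by move=> i; have := L i; have := T2 i; have := px0 i; lra.
- by move=> i; have := key1 i; have := T3 i; have := px i; lra.
- by move=> i; have := key1 i; have := T4 i; have := px i; lra.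
Qed.

Definition orthant_region (s : {ffun 'I_4 -> bool}) : set E :=
  [set u | region (u *m (half_root *: diag_mx (\row_i (-1) ^+ s i)))].

(** Each point is folded by the diagonal matrix of the signs of its coordinates. *)
Lemma outer_orthants (C : set E) : C `<=` admissible ->
  outer C `<=` \bigcup_(s in [set` index_enum {ffun 'I_4 -> bool}]) orthant_region s.
Proof.
move=> CA u /(outer_in_polytope CA)/(@polytope_region R) h.
exists [ffun i => u 0 i < 0]; [exact: mem_index_enum|rewrite /orthant_region /=].
suff -> : u *m (half_root *: diag_mx (\row_i (-1) ^+ [ffun i => u 0 i < 0] i)) = folded u by [].
apply/rowP => i; rewrite -scalemxAr !mxE; congr (_ * _).
rewrite (bigD1 i)//= big1 ?addr0; last by move=> j ji; rewrite !mxE (negPf ji) mulr0n mulr0.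
rewrite !mxE eqxx mulr1n ffunE; case: ltP => h0.
  by rewrite expr1 mulrN1 ltr0_norm.
by rewrite expr0 mulr1 ger0_norm.
Qed.

Lemma vol_orthant_region s : borel (orthant_region s) /\ vol (orthant_region s) = (4%:E * vol (@region R))%E.
Proof.
have [bR _] := region_borel_vol R.
set M := half_root *: diag_mx (\row_i (-1) ^+ s i).
have dM : `|\det M| = 1 / 4.
  rewrite detZ det_diag normrM normr_prod big1 ?mulr1.
    rewrite ger0_norm; last by apply: exprn_ge0; apply: ltW; exact: half_root_gt0.
    by rewrite (_ : 4 = 2 * 2)%N// exprM sqr_half_root; field.
  by move=> i _; rewrite mxE normrX normrN1 expr1n.
have uM : M \in unitmx.
  by rewrite unitmxE unitfE -normr_eq0 dM; lra.
split; first exact: borel_mulmx.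
rewrite (unitmx_linear_law uM bR) dM; by rewrite div1r invrK.
Qed.

Lemma vol_bigcup_le (I : choiceType) (s : seq I) (F : I -> set E) :
  (forall i, borel (F i)) ->
  borel (\bigcup_(i in [set` s]) F i) /\
  (vol (\bigcup_(i in [set` s]) F i) <= \sum_(i <- s) vol (F i))%E.
Proof.
move=> bF; rewrite bigcup_seq; elim: s => [|i s [IHb IHv]].
  by rewrite !big_nil vol0; split; [apply: borel_open; exact: open0|exact: lexx].
rewrite !big_cons; split; first exact: borelU.
apply: le_trans (leeD2l _ IHv).
rewrite !volE; apply: measureU2; [exact: bF|exact: IHb].
Qed.

Lemma vol_outer_cluster (C : set E) : finite_set C -> C `<=` admissible ->
  (vol (outer C) <= (64 * (smax ^+ 4 / 24 - \sum_k \sum_i cellvol R k i))%:E)%E.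
Proof.
move=> fC CA.
have [bU vU] := vol_bigcup_le (index_enum {ffun 'I_4 -> bool}) (fun s => (vol_orthant_region s).1).
apply: (@le_trans _ _ (vol (\bigcup_(s in [set` index_enum {ffun 'I_4 -> bool}]) orthant_region s))).
  by apply: le_vol => //; [exact: borel_outer|exact: outer_orthants].
apply: le_trans vU _.
under eq_bigr do rewrite (vol_orthant_region _).2.
have [bR vR] := region_borel_vol R.
rewrite big_const cardT -cardE card_ffun card_bool card_ord.
have [v ev] : exists v, vol (@region R) = v%:E.
  by have := vol_ge0 (@region R); move: vR; case: (vol (@region R)) => [v| |]// _ _; exists v.
rewrite ev lee_fin in vR; rewrite ev -EFinM.
have iterE (w : R) n : iter n (adde w%:E) 0%E = (n%:R * w)%:E.
  elim: n => [|n IH]; first by rewrite mul0r.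
  by rewrite iterS IH -(natr1 n) mulrDl mul1r [in RHS]addrC EFinD.
rewrite iterE.
by rewrite lee_fin (_ : (2 ^ 4)%N = 16%N)//; lra.
Qed.

End Cluster.

(** * Counting the points of the cluster *)

Section Count.
Local Open Scope nat_scope.
Definition gap k x : nat := (x - k) + (k - x).

(** Integer points are stored shifted by the half widths, so the odd coordinate sum becomes
    an even one: the shifts 16, 16, 16, 19 have odd sum. *)
Definition in_cluster (p : 'I_33 * 'I_33 * ('I_33 * 'I_39)) : bool :=
  let: (x, y, (z, u)) := p in
  ~~ odd (x + y + z + u) && (gap 16 x + gap 16 y + gap 16 z + gap 19 u <= 33).

(** The number of values of the last coordinate when the absolute values of the other three
    have sum t: for t <= 13 only the bound 19 matters, then the bound 33 - t. *)
Definition column_count (t : nat) : nat := if (t <= 13) then 20 - odd t else 34 - t.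

Lemma inner_count t : \sum_(u < 39) (odd (t + gap 19 u) && (t + gap 19 u <= 33)) = column_count t.
Proof.
have [t33|t33] := ltnP 33 t.
  rewrite big1 => [|u _]; first by rewrite /column_count; case: leqP => ?; lia.
  have -> : (t + gap 19 u <= 33) = false by rewrite leqNgt ltn_addr.
  by rewrite andbF.
have : (t < 34) by lia.
rewrite !big_ord_recl big_ord0 /=.
by do 34?[case: t t33 => [|t] t33]; rewrite /column_count.
Qed.

Lemma odd_gap k x : odd (gap k x) = odd k (+) odd x.
Proof.
rewrite /gap; case: (leqP k x) => kx.
  by rewrite (eqP (kx : k - x == 0)) addn0 oddB// addbC.
by rewrite (eqP (ltnW kx : x - k == 0)) add0n oddB// ltnW.
Qed.

Definition multiplicity k := if k is 0 then 1 else 2.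

(** Each nonzero absolute value is attained twice. *)
Lemma gap_sum (F : nat -> nat) : \sum_(x < 33) F (gap 16 x) = \sum_(k < 17) multiplicity k * F k.
Proof.
rewrite -(big_mkord xpredT (fun x => F (gap 16 x))) -(big_mkord xpredT (fun k => multiplicity k * F k)).
rewrite -(big_map (gap 16) xpredT F).
have -> : [seq gap 16 x | x <- index_iota 0 33] = [:: 16; 15; 14; 13; 12; 11; 10; 9; 8; 7; 6; 5; 4; 3; 2; 1] ++ iota 0 17 by [].
by rewrite /index_iota /= !big_cons !big_nil /multiplicity; lia.
Qed.

Lemma pair_sum (A B : finType) (G : A * B -> nat) : \sum_p G p = \sum_a \sum_b G (a, b).
Proof. by rewrite pair_bigA; apply: eq_bigr => -[]. Qed.

Lemma card_cluster_sum : #|in_cluster| =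
  \sum_(a < 17) multiplicity a * \sum_(b < 17) multiplicity b * \sum_(c < 17) multiplicity c * column_count (a + b + c).
Proof.
rewrite -sum1_card big_mkcond pair_sum pair_sum.
pose f a b c := column_count (a + b + c).
transitivity (\sum_(x < 33) \sum_(y < 33) \sum_(z < 33) f (gap 16 x) (gap 16 y) (gap 16 z)).
  apply: eq_bigr => x _; apply: eq_bigr => y _; rewrite pair_sum; apply: eq_bigr => z _.
  rewrite /f -inner_count; apply: eq_bigr => u _.
  rewrite unfold_in /in_cluster /=.
  have -> : odd (gap 16 x + gap 16 y + gap 16 z + gap 19 u) = ~~ odd (x + y + z + u).
    have := (odd_gap 16 x, odd_gap 16 y, odd_gap 16 z, odd_gap 19 u).
    move: (gap 16 x) (gap 16 y) (gap 16 z) (gap 19 u) => a b c d [[[ha hb] hc] hd].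
    by rewrite !oddD ha hb hc hd; case: (odd x); case: (odd y); case: (odd z); case: (odd u).
  by case: ifP.
rewrite (gap_sum (fun a => \sum_(y < 33) \sum_(z < 33) f a (gap 16 y) (gap 16 z))).
apply: eq_bigr => a _; congr (_ * _).
rewrite (gap_sum (fun b => \sum_(z < 33) f a b (gap 16 z))).
apply: eq_bigr => b _; congr (_ * _).
by rewrite (gap_sum (f a b)).
Qed.

(** Binary arithmetic, to evaluate the triple sum. *)
Fixpoint sumN (F : nat -> BinNat.N.t) n : BinNat.N.t := if n is n'.+1 then BinNat.N.add (sumN F n') (F n') else BinNat.N.zero.

Lemma sumNE F n : BinNat.N.to_nat (sumN F n) = \sum_(i < n) BinNat.N.to_nat (F i).
Proof.
elim: n => [|n IH]; first by rewrite big_ord0.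
by rewrite big_ord_recr /= Nnat.N2Nat.inj_add IH.
Qed.

Lemma card_cluster : #|in_cluster| = 32 * 53 * 199.
Proof.
rewrite card_cluster_sum.
pose G k v := BinNat.N.mul (BinNat.N.of_nat (multiplicity k)) v.
pose total := sumN (fun a => G a (sumN (fun b => G b (sumN (fun c =>
  G c (BinNat.N.of_nat (column_count (a + b + c)))) 17)) 17)) 17.
transitivity (BinNat.N.to_nat total).
  rewrite sumNE; apply: eq_bigr => a _; rewrite Nnat.N2Nat.inj_mul sumNE Nnat.Nat2N.id.
  congr (_ * _); apply: eq_bigr => b _; rewrite Nnat.N2Nat.inj_mul sumNE Nnat.Nat2N.id.
  congr (_ * _); apply: eq_bigr => c _.
  by rewrite Nnat.N2Nat.inj_mul !Nnat.Nat2N.id.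
have -> : total = BinNat.N.mul 
  (BinNat.N.mul (BinNat.N.of_nat 32) (BinNat.N.of_nat 53)) (BinNat.N.of_nat 199) by vm_compute.
by rewrite !Nnat.N2Nat.inj_mul !Nnat.Nat2N.id.
Qed.

End Count.

(** * The cluster beats every collinear packing *)

Section Final.
Variable R : realType.
Local Notation E := 'rV[R]_4.
Local Notation T := ('I_33 * 'I_33 * ('I_33 * 'I_39))%type.

Definition coord (p : T) (i : 'I_4) : nat :=
  let: (x, y, (z, u)) := p in
  match val i with 0 => x | 1 => y | 2 => z | _ => u end.

Definition center (i : 'I_4) : nat := if val i == 3%N then 19 else 16.

Lemma halfwidthE i : halfwidth R i = (center i)%:R.
Proof. by rewrite /halfwidth /center; case: ifP. Qed.

Definition pt (p : T) : E := \row_i ((half_root R)^-1 * ((coord p i)%:R - (center i)%:R)).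

Lemma normB_gap (k x : nat) : `|x%:R - k%:R : R| = (gap k x)%:R.
Proof.
rewrite /gap; case: (leqP k x) => kx.
  by rewrite (eqP (kx : (k - x == 0)%N)) addn0 natrB// ger0_norm// subr_ge0 ler_nat.
rewrite (eqP (ltnW kx : (x - k == 0)%N)) add0n natrB ?(ltnW kx)// distrC ger0_norm//.
by rewrite subr_ge0 ler_nat ltnW.
Qed.

Lemma folded_pt p i : folded (pt p) 0 i = (gap (center i) (coord p i))%:R.
Proof.
have r0 := half_root_gt0 R.
by rewrite !mxE normrM normfV (gtr0_norm r0) mulVKf ?gt_eqF// normB_gap.
Qed.

Lemma admissible_pt p : in_cluster p -> admissible (pt p).
Proof.
move=> hp; split.
  move=> i; rewrite folded_pt halfwidthE ler_nat /gap.
  case: p hp => [[x y] [z u]] _; rewrite /coord /center.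
  have := ltn_ord x; have := ltn_ord y; have := ltn_ord z; have := ltn_ord u.
  by case: i => [[|[|[|[|//]]]] hi] /=; lia.
rewrite /coord_sum sum4 !folded_pt -!natrD.
case: p hp => [[x y] [z u]] /andP[_ hs].
by rewrite ler_nat.
Qed.

(** The sum of the squares has the same parity as the sum. *)
Lemma even_sum_squares (a b c d : nat) : ~~ odd (a + b + c + d) -> (0 < a + b + c + d)%N ->
  (2 <= a ^ 2 + b ^ 2 + c ^ 2 + d ^ 2)%N.
Proof.
move=> od pos.
have : ~~ odd (a ^ 2 + b ^ 2 + c ^ 2 + d ^ 2) by move: od; rewrite !oddD !oddX.
have : (0 < a ^ 2 + b ^ 2 + c ^ 2 + d ^ 2)%N.
  by move: pos; rewrite !addn_gt0 !expn_gt0 !orbF; case: a b c d {od} => [|?] [|?] [|?] [|?].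
by case: (_ + _)%N => [|[|]].
Qed.

Lemma gap0 k x : gap k x = 0%N -> x = k.
Proof. rewrite /gap; lia. Qed.

Lemma pt_dist p q : in_cluster p -> in_cluster q -> p != q -> 2 <= enorm (pt p - pt q).
Proof.
move=> hp hq pq; have r0 := half_root_gt0 R.
rewrite -(ler_pXn2r (n := 2)) ?nnegrE ?enorm_ge0// sqr_enorm.
pose g i := gap (coord q i) (coord p i).
have -> : sqn (pt p - pt q) = 2 * \sum_i (g i)%:R ^+ 2.
  rewrite /sqn mulr_sumr; apply: eq_bigr => i _.
  rewrite !mxE -mulrBr exprMn exprVn sqr_half_root div1r invrK; congr (_ * _).
  rewrite /g -normB_gap real_normK ?num_real//; congr (_ ^+ 2); ring.
rewrite sum4 -!natrX -!natrD.
suff : (2 <= g o0 ^ 2 + g o1 ^ 2 + g o2 ^ 2 + g o3 ^ 2)%N.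
  by rewrite -(ler_nat R); lra.
case: p q hp hq pq @g => [[x y] [z u]] [[x' y'] [z' u']] /andP[op _] /andP[oq _] pq g.
apply: even_sum_squares.
  rewrite /g /coord /=; move: op oq.
  have := (odd_gap x' x, odd_gap y' y, odd_gap z' z, odd_gap u' u).
  move: (gap x' x) (gap y' y) (gap z' z) (gap u' u) => a b c d [[[ha hb] hc] hd].
  rewrite !oddD ha hb hc hd.
  by do 8!case: (odd _).
rewrite lt0n; apply: contra pq => /eqP gs.
have [a b c d] : [/\ g o0 = 0%N, g o1 = 0%N, g o2 = 0%N & g o3 = 0%N].
  by move: gs; move: (g o0) (g o1) (g o2) (g o3) => a b c d; split; lia.
have ex : x = x' :> nat := gap0 a.
have ey : y = y' :> nat := gap0 b.
have ez : z = z' :> nat := gap0 c.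
have eu : u = u' :> nat := gap0 d.
by rewrite !xpair_eqE -!val_eqE /= ex ey ez eu !eqxx.
Qed.

Definition cluster : set E := [set pt p | p in [set p | in_cluster p]].

Lemma cluster_packing : packings (32 * 53 * 199) cluster.
Proof.
pose s (i : 'I_(32 * 53 * 199)) : E := pt (enum_val (cast_ord (esym card_cluster) i)).
have sl i : in_cluster (enum_val (cast_ord (esym card_cluster) i)) by exact: enum_valP.
have ptI p q : in_cluster p -> in_cluster q -> pt p = pt q -> p = q.
  move=> hp hq e; apply/eqP; apply: contraT => /(pt_dist hp hq).
  by rewrite e subrr enorm0; lra.
split.
  apply: dist_packing => _ _ [p hp <-] [q hq <-] pq; apply: pt_dist => //.
  by apply: contra_neq pq => ->.
apply: (@enum_card _ _ _ _ s).
  by move=> i j /(ptI _ _ (sl i) (sl j)) /enum_val_inj /cast_ord_inj.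
apply/seteqP; split => x.
  move=> [p hp <-]; exists (cast_ord card_cluster (enum_rank_in hp p)) => //.
  by rewrite /s cast_ordK enum_rankK_in.
by move=> [i _ <-]; exists (enum_val (cast_ord (esym card_cluster) i)) => //; exact: sl.
Qed.

End Final.

Theorem theorem1p5 (R : realType) :
  exists2 m : nat, is_nstar R 4 m & (m <= 338196)%N.
Proof.
have K0 : 0 <= 4 / 3 * (3 + 283 / (20 * 100)) :> R by lra.
have [m em] : exists m, (32 * 53 * 199 = m.+2)%N by exists (32 * 53 * 199 - 2)%N; lia.
have mR : m.+1%:R = 32 * 53 * 199 - 1 :> R.
  have : m.+2%:R = 32 * 53 * 199 :> R by rewrite -em !natrM.
  by rewrite -(natr1 m.+1); lra.
have k3 := vol_sqball3 R.
have cv : 4 / 3 * (3 + 283 / (20 * 100)) <= crossvol R 3.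
  rewrite -lee_fin; apply: le_trans (_ : (_ <= vol (@sqball R 3 1))%E) _.
    by apply: le_trans k3; rewrite lee_fin; lra.
  by rewrite /crossvol fineK//; exact: fin_vol_ball.
have cv0 : 0 < crossvol R 3 by apply: lt_le_trans cv; lra.
have pC0 := cluster_packing R; rewrite em in pC0.
have [C bC minC] := best_packing_exists cv0 (ex_intro _ _ pC0).
have hC : forall k, has_dim C k -> (1 < k)%N.
  move=> k dk; rewrite ltnNge; apply/negP => k1.
  have [[pC cC] _] := bC.
  have [p [q [corner_ineqs Cq pq]]] := collinear_spread pC cC dk k1.
  have := outer_length (packings_finite bC.1) corner_ineqs Cq.
  have := minC _ pC0.
  have fC0 := packings_finite pC0.
  have := @vol_outer_cluster R _ fC0 (fun _ '(ex_intro2 p hp e) => ltac:(rewrite -e; exact: admissible_pt hp)).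
  have fv : vol (outer (@cluster R)) \is a fin_num by exact: fin_vol_outer.
  rewrite -(fineK fv) lee_fin => h1 h2 h3.
  have h4 : 2 * m.+1%:R * (4 / 3 * (3 + 283 / (20 * 100))) <= enorm (q - p) * crossvol R 3.
    rewrite [2 * _]mulrC; apply: ler_pM pq cv; first exact: mulr_ge0.
    exact: K0.
  have := numerical_bound R; rewrite -mR ltNge => /negP; apply.
  exact: le_trans h4 (le_trans h3 (le_trans h2 h1)).
have [j] := is_nstar_exists (isT : (0 < m.+2)%N) (is_k_gt1 bC isT hC).
by move=> hj jm; exists j; [exact: hj|apply: leq_trans jm _; rewrite -em; vm_compute].
Qed.
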